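(* Let $K\subset\mathbb{R}^2$ be a convex figure, and let $\gamma$ be a planar curve, given by a continuous map $\varphi:[a,b]\to\mathbb{R}^2$, such that $K\subset \operatorname{co}(\gamma)$. Then $$\operatorname{length}(\gamma)\ \geq\ \operatorname{per}(K)-\operatorname{diam}(K).$$ Moreover, equality holds if and only if $\gamma$ is a convex curve (traversed once), $\operatorname{bd}(K)=\gamma\cup[A,B]$, and $\operatorname{diam}(K)=d(A,B)$, where $A=\varphi(a)$ and $B=\varphi(b)$ are the endpoints of $\gamma$.
   Context: $d$ is the Euclidean metric on $\mathbb{R}^2$; $\operatorname{co}$ denotes convex hull; $[A,B]$ is the (possibly degenerate) line segment between $A$ and $B$. A convex figure is a nonempty compact convex subset of $\mathbb{R}^2$ (possibly with empty interior). $\operatorname{bd}(K)$ is the topological boundary of $K$ in $\mathbb{R}^2$, and $\operatorname{per}(K)$ is its perimeter, i.e. the length of $\operatorname{bd}(K)$ if $K$ has nonempty interior, and twice the length of $K$ if $K$ is a line segment (so $0$ if $K$ is a point). $\operatorname{diam}(K)=\max\{d(x,y): x,y\in K\}$. A planar curve $\gamma$ is the image of a continuous map $\varphi:[a,b]\to\mathbb{R}^2$. Its length is the length of the parametrization, $\operatorname{length}(\gamma)=\sup\sum_{i=1}^m d(\varphi(t_{i-1}),\varphi(t_i))\in[0,\infty]$, the supremum being over all finite sequences $a=t_0<t_1<\dots<t_m=b$. In set-theoretic expressions ($\operatorname{co}(\gamma)$, $\gamma\cup[A,B]$) the symbol $\gamma$ denotes the image $\varphi([a,b])$. A curve $\gamma$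 is called convex if its image is a closed connected subset of the boundary $\operatorname{bd}(\operatorname{co}(\gamma))$ of its convex hull. ''Traversed once'' means that $\varphi^{-1}(p)$ is connected for every $p\in\gamma$ (no backtracking or repeated covering). *)

(* Defs.v *)
From HB Require Import structures.
From mathcomp Require Import all_boot all_order all_algebra.
From mathcomp Require Import all_classical all_reals all_analysis.

Set Implicit Arguments.
Unset Strict Implicit.
Unset Printing Implicit Defensive.

Import Order.TTheory GRing.Theory Num.Theory.
Import numFieldNormedType.Exports.

Local Open Scope classical_set_scope.
Local Open Scope ring_scope.

(* The plane is 'rV[R]_2. Its canonical norm in the library is the sup norm,
   so the Euclidean metric is introduced separately; the library topology on
   'rV[R]_2 is the product topology, i.e. the Euclidean one. *)
Definition eucl_dist (R : realType) (x y : 'rV[R]_2) : R :=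
  Num.sqrt (\sum_(i < 2) (x 0 i - y 0 i) ^+ 2).

Definition line_segment (R : realType) (x y : 'rV[R]_2) : set 'rV[R]_2 :=
  [set (1 - t) *: x + t *: y | t in `[0, 1]].

Definition convex_hull (R : realType) (X : set 'rV[R]_2) : set 'rV[R]_2 :=
  smallest (@convex_set R 'rV[R]_2) X.

Definition boundary (R : realType) (X : set 'rV[R]_2) : set 'rV[R]_2 :=
  closure X `\` X°.

Definition convex_figure (R : realType) (K : set 'rV[R]_2) : Prop :=
  [/\ K !=set0, compact K & convex_set K].

(* On nonempty compact sets this supremum is a maximum. *)
Definition diam (R : realType) (K : set 'rV[R]_2) : R :=
  sup [set eucl_dist x y | x in K & y in K].

(* The subdivision a = t_0 < t_1 < ... < t_m = b is the sequence a :: s; the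
   subdivision with m = 0 occurs only if a = b. *)
Definition polygonal_length (R : realType) (a b : R) (phi : R -> 'rV[R]_2)
    (s : seq R) : R :=
  let F := phi \o nth b (a :: s) in
  \sum_(0 <= i < size s) eucl_dist (F i) (F i.+1).

Definition curve_length (R : realType) (a b : R) (phi : R -> 'rV[R]_2) :
    \bar R :=
  ereal_sup [set (polygonal_length a b phi s)%:E | s in itv_partition a b].

Definition simple_closed_param (R : realType) (psi : R -> 'rV[R]_2)
    (J : set 'rV[R]_2) : Prop :=
  [/\ {within `[0, 1], continuous psi},
      psi 0 = psi 1,
      {in `[0, 1[ &, injective psi} &
      psi @` `[0, 1] = J].

(* The boundary of a convex figure with nonempty interior is a simple closed
   curve, all of whose simple closed parametrizations have the same length;
   a convex figure with empty interior is a segment [x, y], with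
   {x, y} uniquely determined. *)
Definition perimeter_values (R : realType) (K : set 'rV[R]_2) :
    set (\bar R) :=
  [set l | (K° !=set0 /\ exists2 psi : R -> 'rV[R]_2,
              simple_closed_param psi (boundary K) & l = curve_length 0 1 psi)
        \/ (exists x y : 'rV[R]_2,
              K = line_segment x y /\ l = (2 * eucl_dist x y)%:E)].

(* For a convex figure, perimeter_values K is a singleton, and the infimum
   merely extracts its element. *)
Definition perimeter (R : realType) (K : set 'rV[R]_2) : \bar R :=
  ereal_inf (perimeter_values K).

Definition convex_curve (R : realType) (gamma : set 'rV[R]_2) : Prop :=
  [/\ closed gamma, connected gamma &
      gamma `<=` boundary (convex_hull gamma)].

Definition traversed_once (R : realType) (a b : R) (phi : R -> 'rV[R]_2) :
    Prop :=
  forall p, (phi @` `[a, b]) p -> connected (`[a, b] `&` phi @^-1` [set p]).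

(* Main.v *)
(** Projected to a direction u, a polygon becomes a one-dimensional tour and K an interval. By Cauchy's
    formula, the length of a polygon is, up to a common constant, the integral over all u of the
    variation of its projection, and per K that of twice the width of K, so a lower bound for the
    length follows from one-dimensional bounds for each u. A closed tour surrounding K has, for every
    u, variation at least twice the width; so length + |AB| >= per K, and the theorem follows if
    |AB| <= diam K.

    If the ends A, B are farther apart, one replaces the polygon by one that surrounds K and minimises
    the length plus a small penalty for displacing the ends. If the minimiser lies on one side of AB, it
    is closed up by a segment across the slab orthogonal to AB that K spans, of length at most diam K.
    Otherwise it lies in a cone spanned at A by its first edge AP and another vertex Q, and K meets a
    segment from P to a point of AQ near A; similarly at B. The directions in which A and B stick out
    of K then pay for replacing |AB| by the distance of two points of K, and leave a positive slack.

    In the equality case |AB| = diam K, and the closed curve gamma + BA has for every u the least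
    possible variation. Hence its projection does not oscillate, that is, no line separates four
    consecutive points of it alternately, and this forces gamma and AB to run along bd K without
    return. Conversely, a line through the interior of K meets bd K in at most two points, so the
    projections of a curve along bd K do not oscillate and length + |AB| <= per K; the same two bounds
    identify per K with Cauchy's integral. *)
Require Import Defs.
From HB Require Import structures.
From mathcomp Require Import all_boot all_order all_algebra.
From mathcomp Require Import all_classical all_reals all_analysis.
From mathcomp Require Import ring lra.

Set Implicit Arguments.
Unset Strict Implicit.
Unset Printing Implicit Defensive.

Import Order.TTheory GRing.Theory Num.Theory.
Import numFieldNormedType.Exports.

Local Open Scope classical_set_scope.
Local Open Scope ring_scope.

(** * The Euclidean plane *)

Section Plane.
Context {R : realType}.
Notation point := 'rV[R]_2.
Implicit Types (u v w x y z : point) (s t r : R).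

(** The estimates are linear in distances, with coefficients of either sign: Cauchy's formula
    integrates a combination such as |ab| + |AQ| - |aQ| as well as a single length, and this is how
    AB is traded for [ab] direction by direction. On the line such a combination need only be
    checked for points of value 0 or 1, by summing over thresholds; for the polygon with a cone at
    either end this leaves a finite Boolean check.

    The penalty serves the equality case. A curve is only a limit of polygons, so the gain must be
    uniform in the polygon. If |AB| exceeds the diameter by a fixed amount, the penalised minimiser
    has either moved an end and paid for it, or its ends are still too far apart, and then the
    geometry at the ends gives a gain quadratic in the excess. The price is an error linear in
    [kap], chosen small against that square.

    Likewise, an oscillation is measured by a continuous nonnegative function of the direction,
    positive somewhere, whose integral does not depend on the inscribed polygon and therefore
    survives the limit. *)

Definition dot u x : R := u 0 0 * x 0 0 + u 0 1 * x 0 1.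
Definition cross u x : R := u 0 0 * x 0 1 - u 0 1 * x 0 0.
Definition nrm v : R := Num.sqrt (dot v v).
Definition rot v : point := \row_i (if i == 0 then - v 0 1 else v 0 0).

Lemma pt_eq x y : x 0 0 = y 0 0 -> x 0 1 = y 0 1 -> x = y.
Proof.
move=> h0 h1; apply/rowP => i.
by case: i => -[|[|//]] hi; [rewrite (_ : Ordinal hi = 0)|rewrite (_ : Ordinal hi = 1)] => //; apply: val_inj.
Qed.

Definition pt (r t : R) : point := \row_i (if i == 0 then r else t).
Lemma pt0 r t : pt r t 0 0 = r. Proof. by rewrite mxE. Qed.
Lemma pt1 r t : pt r t 0 1 = t. Proof. by rewrite mxE. Qed.
Lemma rot0 v : rot v 0 0 = - v 0 1. Proof. by rewrite mxE. Qed.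
Lemma rot1 v : rot v 0 1 = v 0 0. Proof. by rewrite mxE. Qed.

Lemma dotC u x : dot u x = dot x u. Proof. rewrite /dot; ring. Qed.
Lemma dotDr u x y : dot u (x + y) = dot u x + dot u y.
Proof. rewrite /dot !mxE; ring. Qed.
Lemma dotNr u x : dot u (- x) = - dot u x.
Proof. rewrite /dot !mxE; ring. Qed.
Lemma dotBr u x y : dot u (x - y) = dot u x - dot u y.
Proof. by rewrite dotDr dotNr. Qed.
Lemma dotZr u r x : dot u (r *: x) = r * dot u x.
Proof. rewrite /dot !mxE; ring. Qed.
Lemma dotDl u x y : dot (x + y) u = dot x u + dot y u.
Proof. by rewrite !(dotC _ u) dotDr. Qed.
Lemma dotNl u x : dot (- x) u = - dot x u.
Proof. by rewrite !(dotC _ u) dotNr. Qed.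
Lemma dotBl u x y : dot (x - y) u = dot x u - dot y u.
Proof. by rewrite dotDl dotNl. Qed.
Lemma dotZl u r x : dot (r *: x) u = r * dot x u.
Proof. by rewrite !(dotC _ u) dotZr. Qed.
Lemma dot0r u : dot u 0 = 0. Proof. rewrite /dot !mxE; ring. Qed.
Lemma dot0l u : dot 0 u = 0. Proof. by rewrite dotC dot0r. Qed.
Definition dotE := (dotDr, dotNr, dotZr, dotDl, dotNl, dotZl).

Lemma crossE u x : cross u x = dot (rot u) x.
Proof. rewrite /cross /dot rot0 rot1; ring. Qed.
Lemma crossC u x : cross x u = - cross u x.
Proof. rewrite /cross; ring. Qed.
Lemma cross_self u : cross u u = 0.
Proof. rewrite /cross; ring. Qed.
Lemma crossDr u x y : cross u (x + y) = cross u x + cross u y.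
Proof. by rewrite !crossE dotDr. Qed.
Lemma crossNr u x : cross u (- x) = - cross u x.
Proof. by rewrite !crossE dotNr. Qed.
Lemma crossZr u r x : cross u (r *: x) = r * cross u x.
Proof. by rewrite !crossE dotZr. Qed.
Lemma crossDl u x y : cross (x + y) u = cross x u + cross y u.
Proof. by rewrite !(crossC u) crossDr opprD. Qed.
Lemma crossNl u x : cross (- x) u = - cross x u.
Proof. by rewrite !(crossC u) crossNr. Qed.
Lemma crossZl u r x : cross (r *: x) u = r * cross x u.
Proof. by rewrite !(crossC u) crossZr mulrN. Qed.

Lemma cramer v w x : cross v w != 0 ->
  x = (cross x w / cross v w) *: v + (cross v x / cross v w) *: w.
Proof.
move=> h; apply: pt_eq; rewrite !mxE; rewrite /cross in h *; field; exact: h.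
Qed.

Lemma dot_sq_ge0 v : 0 <= dot v v.
Proof. by rewrite /dot -!expr2 addr_ge0 ?sqr_ge0. Qed.
Lemma dot_sq_eq0 v : (dot v v == 0) = (v == 0).
Proof.
apply/idP/eqP => [|->]; last by rewrite dot0r.
rewrite /dot -!expr2 paddr_eq0 ?sqr_ge0 // !sqrf_eq0 => /andP[/eqP h0 /eqP h1].
by apply: pt_eq; rewrite ?h0 ?h1 mxE.
Qed.
Lemma dot_sq_gt0 v : v != 0 -> 0 < dot v v.
Proof. by move=> h; rewrite lt0r dot_sq_ge0 dot_sq_eq0 h. Qed.

Lemma nrm_ge0 v : 0 <= nrm v. Proof. exact: sqrtr_ge0. Qed.
Lemma sqr_nrm v : nrm v ^+ 2 = dot v v.
Proof. by rewrite sqr_sqrtr // dot_sq_ge0. Qed.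
Lemma nrm_eq0 v : (nrm v == 0) = (v == 0).
Proof. by rewrite -sqrf_eq0 sqr_nrm dot_sq_eq0. Qed.
Lemma nrm_gt0 v : (0 < nrm v) = (v != 0).
Proof. by rewrite lt0r nrm_eq0 nrm_ge0 andbT. Qed.
Lemma nrm0 : nrm 0 = 0. Proof. by apply/eqP; rewrite nrm_eq0. Qed.
Lemma nrmZ r v : nrm (r *: v) = `|r| * nrm v.
Proof.
rewrite /nrm (_ : dot (r *: v) (r *: v) = r ^+ 2 * dot v v); last by rewrite !dotE; ring.
by rewrite sqrtrM ?sqr_ge0 // sqrtr_sqr.
Qed.
Lemma nrmN v : nrm (- v) = nrm v.
Proof. by rewrite -scaleN1r nrmZ normrN1 mul1r. Qed.

Lemma lagrange u v : dot u v ^+ 2 + cross u v ^+ 2 = dot u u * dot v v.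
Proof. rewrite /dot /cross; ring. Qed.

Lemma dot_le_nrm u v : dot u v <= nrm u * nrm v.
Proof.
apply: le_trans (ler_norm _) _.
rewrite -(@ler_pXn2r _ 2) ?nnegrE ?mulr_ge0 ?nrm_ge0 // real_normK ?num_real // exprMn !sqr_nrm.
by rewrite -lagrange lerDl sqr_ge0.
Qed.

Lemma nrmD v w : nrm (v + w) <= nrm v + nrm w.
Proof.
rewrite -(@ler_pXn2r _ 2) ?nnegrE ?addr_ge0 ?nrm_ge0 // sqr_nrm sqrrD !sqr_nrm !dotE (dotC w v).
by have := dot_le_nrm v w; lra.
Qed.

Lemma nrmD_lt v w : cross v w != 0 -> nrm (v + w) < nrm v + nrm w.
Proof.
move=> h; have d : dot v w < nrm v * nrm w.
  apply: le_lt_trans (ler_norm _) _.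
  rewrite -(@ltr_pXn2r _ 2) ?nnegrE ?mulr_ge0 ?nrm_ge0 // real_normK ?num_real // exprMn !sqr_nrm.
  by rewrite -lagrange ltrDl lt0r sqrf_eq0 h sqr_ge0.
rewrite -(@ltr_pXn2r _ 2) ?nnegrE ?addr_ge0 ?nrm_ge0 // sqr_nrm sqrrD !sqr_nrm !dotE (dotC w v).
lra.
Qed.

Notation dist := (@eucl_dist R).

Lemma distE x y : dist x y = nrm (x - y).
Proof.
rewrite /eucl_dist /nrm /dot !mxE !big_ord_recl big_ord0 addr0 -!expr2.
by congr (Num.sqrt (_ + _)); congr (_ ^+ 2); congr (_ - _); congr (_ _ _); apply: val_inj.
Qed.

Lemma dist_ge0 x y : 0 <= dist x y. Proof. by rewrite distE nrm_ge0. Qed.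
Lemma distC x y : dist x y = dist y x.
Proof. by rewrite !distE -nrmN opprB. Qed.
Lemma distxx x : dist x x = 0. Proof. by rewrite distE subrr nrm0. Qed.
Lemma dist_eq0 x y : (dist x y == 0) = (x == y).
Proof. by rewrite distE nrm_eq0 subr_eq0. Qed.
Lemma dist_gt0 x y : (0 < dist x y) = (x != y).
Proof. by rewrite distE nrm_gt0 subr_eq0. Qed.
Lemma dist_triangle y x z : dist x z <= dist x y + dist y z.
Proof. by rewrite !distE -(subrKA y) nrmD. Qed.
Lemma dist_triangle_lt y x z : cross (x - y) (z - y) != 0 ->
  dist x z < dist x y + dist y z.
Proof.
move=> h; rewrite !distE -(subrKA y) nrmD_lt //.
by rewrite -[y - z]opprB crossNr oppr_eq0.
Qed.
Lemma sqr_dist x y : dist x y ^+ 2 = dot (x - y) (x - y).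
Proof. by rewrite distE sqr_nrm. Qed.

Definition mid s x y : point := x + s *: (y - x).

Lemma dot_mid u s x y : dot u (mid s x y) = (1 - s) * dot u x + s * dot u y.
Proof. rewrite /mid !dotE; ring. Qed.
Lemma mid0 x y : mid 0 x y = x. Proof. by rewrite /mid scale0r addr0. Qed.
Lemma mid1 x y : mid 1 x y = y. Proof. by rewrite /mid scale1r addrC subrK. Qed.
Lemma dist_mid_l s x y : 0 <= s -> dist x (mid s x y) = s * dist x y.
Proof.
move=> s0; rewrite (distC _ (mid _ _ _)) (distC x y) !distE /mid addrC addKr nrmZ ger0_norm //.
Qed.
Lemma dist_mid_r s x y : s <= 1 -> dist (mid s x y) y = (1 - s) * dist x y.
Proof.
move=> s1; rewrite !distE /mid.
have -> : x + s *: (y - x) - y = (1 - s) *: (x - y).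
  apply: pt_eq; rewrite !mxE; ring.
by rewrite nrmZ ger0_norm // subr_ge0.
Qed.
Lemma mid_split s x y : 0 <= s <= 1 -> dist x y = dist x (mid s x y) + dist (mid s x y) y.
Proof. by move=> /andP[s0 s1]; rewrite dist_mid_l // dist_mid_r //; ring. Qed.
Lemma line_segmentP x y z : line_segment x y z <-> exists2 s, 0 <= s <= 1 & z = mid s x y.
Proof.
split=> [[s /= hs <-]|[s hs ->]]; exists s; rewrite /= ?in_itv //= ?in_itv in hs *; rewrite /mid.
all: apply: pt_eq; rewrite !mxE; ring.
Qed.

End Plane.

Section Paths.
Context {R : realType} {T : Type}.
Variable d : T -> T -> R.

Fixpoint tot x (s : seq T) : R := if s is y :: s' then d x y + tot y s' else 0.

Lemma tot_cat x s t : tot x (s ++ t) = tot x s + tot (last x s) t.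
Proof. by elim: s x => [|y s ih] x /=; rewrite ?add0r // ih addrA. Qed.

Lemma tot_rcons x s y : tot x (rcons s y) = tot x s + d (last x s) y.
Proof. by rewrite -cats1 tot_cat /= addr0. Qed.

Hypothesis dC : forall x y, d x y = d y x.

Lemma tot_rev x s : tot (last x s) (rev (belast x s)) = tot x s.
Proof.
elim: s x => [|y s ih] x //=.
rewrite rev_cons -cats1 tot_cat ih /= addr0 addrC; congr (_ + _).
by case: s {ih} => [|z s] /=; rewrite ?rev_cons ?last_rcons dC.
Qed.

Hypothesis d_ge0 : forall x y, 0 <= d x y.
Lemma tot_ge0 x s : 0 <= tot x s.
Proof. by elim: s x => [|y s ih] x //=; rewrite addr_ge0. Qed.

Hypothesis dxx : forall x, d x x = 0.
Hypothesis dT : forall y x z, d x z <= d x y + d y z.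

Lemma tot_last x s : d x (last x s) <= tot x s.
Proof.
elim: s x => [|y s ih] x /=; first by rewrite dxx.
by apply: le_trans (dT y _ _) _; rewrite lerD2l.
Qed.

End Paths.

Section Totals.
Context {R : realType} {T : Type}.
End Totals.

(** * One-dimensional variation *)

Section Layer.
Context {R : realType}.
Implicit Types (c x y z : R).

Definition absd x y : R := `|x - y|.
Lemma absdC x y : absd x y = absd y x. Proof. exact: distrC. Qed.
Lemma absd_ge0 x y : 0 <= absd x y. Proof. exact: normr_ge0. Qed.
Lemma absdxx x : absd x x = 0. Proof. by rewrite /absd subrr normr0. Qed.
Lemma absdT y x z : absd x z <= absd x y + absd y z. Proof. exact: ler_distD. Qed.

Definition step c x : R := (c < x)%R%:R.

(** Two consecutive values contribute their difference as a weight, with the lower one as threshold: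
    as [step] compares strictly, this threshold separates it from everything above. *)
Lemma layer (zs : seq R) : sorted <%R zs -> exists2 W : seq (R * R),
  {in W, forall w, 0 <= w.1} &
  {in zs &, forall x y, absd x y = \sum_(w <- W) w.1 * absd (step w.2 x) (step w.2 y)}.
Proof.
(* The induction needs every threshold to be at least the head, so that those of the tail do not
   separate the new value [z0] from [z1]. *)
suff: sorted <%R zs -> exists2 W : seq (R * R),
    {in W, forall w, 0 <= w.1 /\ head 0 zs <= w.2} &
    {in zs &, forall x y, absd x y = \sum_(w <- W) w.1 * absd (step w.2 x) (step w.2 y)}.
  by move=> h /h[W hW e]; exists W => // w /hW[].
elim: zs => [|z0 zs ih] /=; first by move=> _; exists [::].
case: zs ih => [|z1 zs] ih hs.
  exists [::] => // x y; rewrite !inE => /eqP -> /eqP ->; by rewrite absdxx big_nil.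
have /andP[z01 hs'] : (z0 < z1) && path <%R z1 zs by [].
have [W hW e] := ih hs'.
have hz : {in z1 :: zs, forall y, z1 <= y}.
  move=> y; rewrite inE => /orP[/eqP ->//|hy].
  have /allP := order_path_min lt_trans hs'; move=> /(_ _ hy); exact: ltW.
have W0 w : w \in W -> step w.2 z0 = 0 /\ step w.2 z1 = 0.
  move=> /hW[_ /= h]; rewrite /step !ltNge h (le_trans (ltW z01) h) //.
have key y : y \in z1 :: zs -> absd z0 y = (z1 - z0) * absd (step z0 z0) (step z0 y) + 
   \sum_(w <- W) w.1 * absd (step w.2 z0) (step w.2 y).
  move=> hy; rewrite (eq_big_seq (fun w => w.1 * absd (step w.2 z1) (step w.2 y))); last first.
    by move=> w hw; have [-> ->] := W0 _ hw.
  rewrite -e ?mem_head //.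
  have := hz _ hy => h; rewrite /step ltxx (lt_le_trans z01 h) /absd.
  rewrite sub0r normrN normr1 mulr1 !(distrC _ y) !ger0_norm ?subr_ge0 //; first by ring.
  exact: le_trans (ltW z01) h.
exists ((z1 - z0, z0) :: W).
  move=> w; rewrite inE => /orP[/eqP -> /=|/hW[h1 h2]]; first by rewrite subr_ge0 ltW.
  by split => //; apply: le_trans (ltW z01) h2.
move=> x y; rewrite big_cons /= (in_cons z0 _ x) (in_cons z0 _ y) => /orP[/eqP ->|hx] /orP[/eqP ->|hy].
- rewrite absdxx absdxx mulr0 add0r big1 // => w _; by rewrite absdxx mulr0.
- exact: key.
- rewrite absdC key // absdC; congr (_ + _); apply: eq_bigr => w _; by rewrite absdC.
have h t : t \in z1 :: zs -> step z0 t = 1.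
  by move=> /hz h; rewrite /step (lt_le_trans z01 h).
by rewrite !h // absdxx mulr0 add0r e.
Qed.

(** An entry [(k, x, y)] stands for k times the distance of [x] and [y]. Weights may be negative, so
    every linear inequality between distances on the line takes the form [0 <= absum L id]; the
    function [g] makes room for [step c]. *)
Definition absum (L : seq (R * R * R)) (g : R -> R) : R :=
  \sum_(p <- L) p.1.1 * absd (g p.1.2) (g p.2).

(* Layer-cake: [`|x - y|] is the integral over [c] of [`|step c x - step c y|]. *)
Lemma layer_cake (L : seq (R * R * R)) :
  (forall c, 0 <= absum L (step c)) -> 0 <= absum L id.
Proof.
move=> h; set zs := sort <=%R (undup ([seq p.1.2 | p <- L] ++ [seq p.2 | p <- L])).
have srt : sorted <%R zs.
  by rewrite sort_lt_sorted undup_uniq.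
have [W hW e] := layer srt.
suff -> : absum L id = \sum_(w <- W) w.1 * absum L (step w.2).
  rewrite big_seq sumr_ge0 // => w hw; by rewrite mulr_ge0 // hW.
under [RHS]eq_bigr do rewrite /absum mulr_sumr.
rewrite exchange_big /= /absum; apply: eq_big_seq => p hp.
have hz y : y \in [seq p.1.2 | p <- L] ++ [seq p.2 | p <- L] -> y \in zs.
  by rewrite mem_sort mem_undup.
rewrite /= e; last by apply: hz; rewrite mem_cat (map_f (fun p => p.2)) ?orbT.
  2: by apply: hz; rewrite mem_cat (map_f (fun p => p.1.2)).
rewrite mulr_sumr; apply: eq_bigr => w _; ring.
Qed.

Fixpoint pairs k x (s : seq R) : seq (R * R * R) :=
  if s is y :: s' then (k, x, y) :: pairs k y s' else [::].

Lemma absum_cons p L (g : R -> R) : absum (p :: L) g = p.1.1 * absd (g p.1.2) (g p.2) + absum L g.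
Proof. by rewrite /absum big_cons. Qed.
Lemma absum_nil (g : R -> R) : absum [::] g = 0.
Proof. by rewrite /absum big_nil. Qed.

Lemma absum_pairs k x s L (g : R -> R) :
  absum (pairs k x s ++ L) g = k * tot absd (g x) (map g s) + absum L g.
Proof.
elim: s x => [|y s ih] x /=; first by rewrite mulr0 add0r.
by rewrite absum_cons ih /= mulrDr addrA.
Qed.

Lemma tot_subseq x (l s : seq R) : subseq l s -> tot absd x (rcons l (last x s)) <= tot absd x s.
Proof.
elim: s x l => [|y s ih] x l; first by rewrite subseq0 => /eqP -> /=; rewrite absdxx addr0.
case: l => [_|z l]; first by rewrite /= addr0; apply: (@tot_last _ _ _ absdxx absdT x (y :: s)).
rewrite /=; case: eqP => [-> h|_ h]; first by rewrite lerD2l ih.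
have := ih y _ h; rewrite /=; have := absdT y x z; lra.
Qed.

Lemma tot_subseq_head x (l s : seq R) : subseq l (x :: s) ->
  tot absd x (rcons l (last x s)) <= tot absd x s.
Proof. by move=> /(tot_subseq x); rewrite /= absdxx add0r. Qed.

Lemma subseq_pair (T : eqType) (s : seq T) v w : v \in s -> w \in s ->
  [\/ v = w, subseq [:: v; w] s | subseq [:: w; v] s].
Proof.
elim: s => // x s ih; rewrite !in_cons => /orP[/eqP ->|vs] /orP[/eqP ->|ws].
- exact: Or31.
- by apply: Or32; rewrite /= eqxx sub1seq.
- by apply: Or33; rewrite /= eqxx sub1seq.
have [->|h|h] := ih vs ws; first exact: Or31.
- by apply: Or32; apply: subseq_trans h (subseq_cons _ _).
- by apply: Or33; apply: subseq_trans h (subseq_cons _ _).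
Qed.

(** Skipping all other points leaves the tour [x], [v], [w], [last x s] and back to [x], up to the
    order of [v] and [w]. *)
Lemma closed_tour x s v w : v \in x :: s -> w \in x :: s ->
  2 * absd v w <= tot absd x s + absd x (last x s).
Proof.
have main v' w' : subseq [:: v'; w'] (x :: s) -> 2 * absd v' w' <= tot absd x s + absd x (last x s).
  move=> /tot_subseq_head /=; have := absdT x v' w'; have := absdT (last x s) x w'.
  by rewrite (absdC v' x) (absdC (last x s) w'); lra.
move=> vs ws; have [->|/main //|/main] := subseq_pair vs ws; last by rewrite absdC.
by rewrite absdxx mulr0 addr_ge0 ?absd_ge0 ?tot_ge0 //; exact: absd_ge0.
Qed.

Lemma absd_step c x y : absd (step c x) (step c y) = ((c < x)%R (+) (c < y)%R)%:R.
Proof.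
rewrite /step /absd; case: (c < x)%R; case: (c < y)%R; rewrite /= ?subrr ?normr0 ?subr0 ?sub0r ?normrN ?normr1 //.
Qed.

(* An oscillation [y1], [y2], [y3], [y4] across a gap [m, M] forces two more crossings of the gap. *)
Lemma closed_tour_excess x s v w y1 y2 y3 y4 m M : v \in x :: s -> w \in x :: s ->
  subseq [:: y1; y2; y3; y4] (x :: s) -> y1 <= m -> y3 <= m -> m <= M -> M <= y2 -> M <= y4 ->
  2 * absd v w + 2 * (M - m) <= tot absd x s + absd x (last x s).
Proof.
move=> vs ws sub h1 h3 mM h2 h4.
pose L := pairs 1 x s ++ [:: (1, x, last x s); (-2, v, w); (-2, m, M)].
have absdmM : absd m M = M - m by rewrite absdC /absd ger0_norm // subr_ge0.
suff: 0 <= absum L id.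
  by rewrite absum_pairs !absum_cons absum_nil /= map_id absdmM; lra.
apply: layer_cake => c; rewrite absum_pairs !absum_cons absum_nil /=.
have := @closed_tour (step c x) (map (step c) s) (step c v) (step c w).
rewrite -map_cons !map_f // last_map => /(_ isT isT) hc.
(* A threshold outside $[m, M)$ does not see the gap, and [closed_tour] suffices. One inside is
   crossed three times between [y1] and [y4] and once more on the way back. *)
have [cm|cm] := ltP c m.
  by rewrite (absd_step c m) cm (lt_le_trans cm mM) /= mulr0 addr0; lra.
have [cM|cM] := ltP c M; last first.
  by rewrite (absd_step c m) !ltNge cm cM /= mulr0 addr0; lra.
have e1 : step c y1 = 0 by rewrite /step ltNge (le_trans h1 cm).
have e3 : step c y3 = 0 by rewrite /step ltNge (le_trans h3 cm).
have e2 : step c y2 = 1 by rewrite /step (lt_le_trans cM h2).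
have e4 : step c y4 = 1 by rewrite /step (lt_le_trans cM h4).
have em : absd (step c m) (step c M) = 1 by rewrite absd_step cM ltNge cm.
have evw : absd (step c v) (step c w) <= 1 by rewrite absd_step; case: (_ (+) _).
have := @tot_subseq_head (step c x) [:: step c y1; step c y2; step c y3; step c y4]
  (map (step c) s) (map_subseq (step c) sub).
rewrite /= e1 e2 e3 e4 em last_map addr0.
have a01 : absd 0 1 = 1 :> R by rewrite /absd sub0r normrN normr1.
rewrite (absdC 1 0) a01.
have := absdT (step c x) 0 1; have := absdT (step c (last x s)) (step c x) 1.
rewrite a01 (absdC 0 (step c x)) (absdC (step c (last x s)) 1).
lra.
Qed.

Section Alternation.
Variables (T : eqType) (g : T -> bool).

Fixpoint changes t (s : seq T) : nat := if s is t' :: s' then (g t (+) g t') + changes t' s' else 0.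

Fixpoint alternates b (s : seq T) : bool := if s is t :: s' then (g t == b) && alternates (~~ b) s' else true.

(** The last element of each run on which [g] is constant is kept. *)
Lemma changes_subseq t s : exists l, [/\ subseq l (t :: s), size l = (changes t s).+1 & alternates (g t) l].
Proof.
elim: s t => [|t' s ih] t; first by exists [:: t]; rewrite /= !eqxx.
have [[|t1 l] [sub sl al]] := ih t' => //.
have [e|e] := eqVneq (g t) (g t').
  exists (t1 :: l); rewrite /= e addbb; split => //.
  exact: subseq_trans sub (subseq_cons _ _).
exists (t :: t1 :: l); split.
- by rewrite /= eqxx.
- by rewrite -[LHS]/(size (t1 :: l)).+1 sl /=; move: e; case: (g t); case: (g t').
- by rewrite /= eqxx; move: e al; rewrite /=; case: (g t); case: (g t').
Qed.

Lemma odd_changes t s : odd (changes t s) = g t (+) g (last t s).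
Proof.
elim: s t => [|t' s ih] t /=; first by rewrite addbb.
by rewrite oddD ih oddb addbA addbK.
Qed.

End Alternation.

Lemma tot_step (T : eqType) (y : T -> R) c t s :
  tot absd (step c (y t)) (map (step c) (map y s)) = (changes (fun t => (c < y t)%R) t s)%:R.
Proof. by elim: s t => [|t' s ih] t //=; rewrite ih natrD absd_step. Qed.

(** Without four alternating points the closed tour crosses each threshold at most twice, and a
    threshold that is crossed at all separates [w] from [v]. *)
Lemma closed_unimodal (T : eqType) (y : T -> R) t s v w :
  (forall c b t1 t2 t3 t4, subseq [:: t1; t2; t3; t4] (t :: s) ->
    ~~ alternates (fun t => (c < y t)%R) b [:: t1; t2; t3; t4]) ->
  {in t :: s, forall t', w <= y t' <= v} ->
  tot absd (y t) (map y s) + absd (y t) (y (last t s)) <= 2 * absd v w.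
Proof.
move=> na bd.
pose L := pairs (-1) (y t) (map y s) ++ [:: (-1, y t, y (last t s)); (2, v, w)].
suff: 0 <= absum L id.
  by rewrite absum_pairs !absum_cons absum_nil /= map_id; lra.
apply: layer_cake => c; rewrite absum_pairs !absum_cons absum_nil /= tot_step.
set g := fun t => (c < y t)%R.
have [l [sub sl al]] := changes_subseq g t s.
have ch2 : (changes g t s <= 2)%N.
  rewrite leqNgt; apply/negP => h.
  case: l sub sl al => [|t1 [|t2 [|t3 [|t4 l]]]] sub sl al;
    [by move: sl|by move: sl h => [<-]|by move: sl h => [<-]|by move: sl h => [<-]|].
  have sub4 : subseq [:: t1; t2; t3; t4] (t :: s).
    by apply: subseq_trans sub; exact: (prefix_subseq [:: t1; t2; t3; t4] l).
  apply: (negP (na c (g t) _ _ _ _ sub4)); case/and5P: al => a1 a2 a3 a4 _.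
  by rewrite /= a1 a2 a3 a4.
have := odd_changes g t s; rewrite !absd_step -/(g t) -/(g (last t s)).
have nc : (0 < changes g t s)%N -> (c < v)%R (+) (c < w)%R.
  case: l sub sl al => [|t1 [|t2 l]] sub sl al; [by move: sl|by move: sl => [<-]|].
  move=> _; have /andP[w1 v1] := bd t1 (mem_subseq sub (mem_head _ _)).
  have /andP[w2 v2] : w <= y t2 <= v by apply: bd; apply: (mem_subseq sub); rewrite !in_cons eqxx orbT.
  have : g t1 (+) g t2 by move: al => /and3P[/eqP -> /eqP -> _]; case: (g t).
  rewrite /g; case: (ltP c (y t1)) => a1; case: (ltP c (y t2)) => a2 //= _.
    by rewrite (lt_le_trans a1 v1) ltNge (le_trans w2 a2).
  by rewrite (lt_le_trans a2 v2) ltNge (le_trans w1 a1).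
move: ch2 nc; case: (changes g t s) => [|[|[|//]]] _ nc /=.
- by move=> <- /=; rewrite !mulr0 !add0r addr0 mulr_ge0.
- by move=> <- /=; rewrite nc //=; lra.
- by move=> <- /=; rewrite nc //=; lra.
Qed.

End Layer.

(** * A one-dimensional inequality for polygons with a cone at either end *)

Section Diamond.

Let all_bool (p : bool -> bool) := p true && p false.
Let all_boolP (p : bool -> bool) : all_bool p -> forall b, p b.
Proof. by move=> /andP[h1 h2] []. Qed.

Let dia_sum (A P x F B : bool) : nat := (A (+) P) + (P (+) x) + (x (+) F) + (F (+) B).
(** Membership of [a] in the interval spanned by [A], [P], [Q], seen from one threshold. *)
Let between (a A P Q : bool) := (A && P && Q ==> a) && (a ==> A || P || Q).

(** The inequality [diamond] at one threshold, a real being replaced by whether it exceeds the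
    threshold. The points [v] and [w] are [A], [B] or one inner vertex each ([x], [y]), and [M] is
    the best lower bound for the crossings of the polygon that routes through a single inner vertex
    provide. *)
Let dia_check (A P F B Q E a b x y : bool) :=
  let M := maxn (maxn (dia_sum A P x F B) (dia_sum A P y F B))
             (maxn (dia_sum A P Q F B) (dia_sum A P E F B)) in
  between a A P Q ==> between b B E F ==>
  all (fun v => all (fun w =>
    2 * (v (+) w) + ((a (+) Q) + (b (+) E)) <= M + ((a (+) b) + (A (+) Q) + (B (+) E)))%N
    [:: A; B; y]) [:: A; B; x].

Let diamond_bool : forall A P F B Q E a b x y, dia_check A P F B Q E a b x y.
Proof.
move=> A P F B Q E a b x y.
move: y; apply: all_boolP; move: x; apply: all_boolP; move: b; apply: all_boolP.
move: a; apply: all_boolP; move: E; apply: all_boolP; move: Q; apply: all_boolP.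
move: B; apply: all_boolP; move: F; apply: all_boolP; move: P; apply: all_boolP.
move: A; apply: all_boolP; vm_compute; reflexivity.
Qed.

Context {R : realType}.
Local Notation absd := (@absd R).

Lemma tot_absd_mid (A P F B x : R) mid : x \in P :: rcons mid F ->
  absd A P + absd P x + absd x F + absd F B <= tot absd A (P :: mid ++ [:: F; B]).
Proof.
move=> hx; rewrite -cat_rcons /= tot_cat last_rcons /= addr0 !addrA lerD2r -!addrA lerD2l.
have := last_rcons P mid F; case: (splitPl hx) => t1 t2 e1; rewrite last_cat e1 => e2.
rewrite -e2 tot_cat e1 lerD //; last by apply: tot_last; [exact: absdxx|exact: absdT].
by rewrite -{1}e1; apply: tot_last; [exact: absdxx|exact: absdT].
Qed.

Let inner (V : eqType) (A P F B v : V) mid : v \in A :: P :: mid ++ [:: F; B] ->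
  exists2 x, x \in P :: rcons mid F & [|| v == A, v == B | v == x].
Proof.
rewrite -cat_rcons in_cons => /orP[/eqP ->|]; first by exists P; rewrite ?mem_head ?eqxx.
rewrite -cat_cons mem_cat => /orP[h|]; first by exists v; rewrite ?eqxx ?orbT.
by rewrite mem_seq1 => /eqP ->; exists P; rewrite ?mem_head ?eqxx ?orbT.
Qed.

(** Replaces the closing edge [AB] of [closed_tour] by [ab], where [a] lies in the triangle [APQ]
    and [b] in [BEF] after projection. By [layer_cake] it is enough to count crossings of one
    threshold, and this is the Boolean check. *)
Lemma diamond (A P F B Q E a b v w : R) mid :
  Q \in rcons mid F -> E \in P :: mid ->
  Num.min A (Num.min P Q) <= a <= Num.max A (Num.max P Q) ->
  Num.min B (Num.min E F) <= b <= Num.max B (Num.max E F) ->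
  v \in A :: P :: mid ++ [:: F; B] -> w \in A :: P :: mid ++ [:: F; B] ->
  2 * absd v w + (absd a Q + absd b E) <=
    tot absd A (P :: mid ++ [:: F; B]) + (absd a b + absd A Q + absd B E).
Proof.
move=> hQ hE ha hb hv hw.
have [x hx xv] := inner hv; have [y hy yw] := inner hw.
pose L := pairs 1 A (P :: mid ++ [:: F; B]) ++
  [:: (1, a, b); (1, A, Q); (1, B, E); (-1, a, Q); (-1, b, E); (-2, v, w)].
suff: 0 <= absum L id.
  by rewrite absum_pairs !absum_cons absum_nil /= map_id; lra.
apply: layer_cake => c; rewrite absum_pairs !absum_cons absum_nil.
set s := map _ _.
have hs z : z \in P :: rcons mid F ->
    (dia_sum (c < A)%R (c < P)%R (c < z)%R (c < F)%R (c < B)%R)%:R <= tot absd (step c A) s.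
  move=> hz; rewrite /dia_sum !natrD -!absd_step /s /= map_cat; apply: tot_absd_mid.
  by rewrite -map_rcons -map_cons map_f.
have := diamond_bool (c < A)%R (c < P)%R (c < F)%R (c < B)%R (c < Q)%R (c < E)%R (c < a)%R (c < b)%R (c < x)%R (c < y)%R.
rewrite /dia_check.
have bet (p q r z : R) : Num.min p (Num.min q r) <= z <= Num.max p (Num.max q r) ->
    between (c < z)%R (c < p)%R (c < q)%R (c < r)%R.
  rewrite !ge_min !le_max => /andP[h1 h2]; apply/andP; split; apply/implyP.
    move=> /andP[/andP[cp cq] cr]; case/or3P: h1 => h; exact: (lt_le_trans _ h).
  move=> cz; case/or3P: h2 => h; rewrite (lt_le_trans cz h) ?orbT //.
rewrite (bet _ _ _ _ ha) (bet _ _ _ _ hb) !implyTb => /allP h1.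
have /allP h2 : all (fun w => 2 * ((c < v)%R (+) w) + (((c < a)%R (+) (c < Q)%R) + ((c < b)%R (+) (c < E)%R)) <=
   maxn (maxn (dia_sum (c < A)%R (c < P)%R (c < x)%R (c < F)%R (c < B)%R)
              (dia_sum (c < A)%R (c < P)%R (c < y)%R (c < F)%R (c < B)%R))
        (maxn (dia_sum (c < A)%R (c < P)%R (c < Q)%R (c < F)%R (c < B)%R)
              (dia_sum (c < A)%R (c < P)%R (c < E)%R (c < F)%R (c < B)%R)) +
   (((c < a)%R (+) (c < b)%R) + ((c < A)%R (+) (c < Q)%R) + ((c < B)%R (+) (c < E)%R)))%N
   [:: (c < A)%R; (c < B)%R; (c < y)%R].
  by apply: h1; rewrite !inE; case/or3P: xv => /eqP ->; rewrite eqxx ?orbT.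
have /h2 h3 : (c < w)%R \in [:: (c < A)%R; (c < B)%R; (c < y)%R].
  by rewrite !inE; case/or3P: yw => /eqP ->; rewrite eqxx ?orbT.
have hM : (maxn (maxn (dia_sum (c < A)%R (c < P)%R (c < x)%R (c < F)%R (c < B)%R)
              (dia_sum (c < A)%R (c < P)%R (c < y)%R (c < F)%R (c < B)%R))
        (maxn (dia_sum (c < A)%R (c < P)%R (c < Q)%R (c < F)%R (c < B)%R)
              (dia_sum (c < A)%R (c < P)%R (c < E)%R (c < F)%R (c < B)%R)))%:R <= tot absd (step c A) s.
  rewrite /maxn; do ?[case: ifP => _]; apply: hs => //; first [by rewrite in_cons hQ orbT | by rewrite -rcons_cons mem_rcons in_cons hE orbT].
move: h3 hM; cbv beta; set M := maxn _ _; move: (tot _ _ _) => N.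
rewrite -(ler_nat R) natrD natrM !natrD -!absd_step /=; lra.
Qed.

End Diamond.

(** * Polygons surrounding a set *)

Section Hulls.
Context {R : realType}.
Notation point := 'rV[R]_2.
Implicit Types (u v w x y z A P Q X : point) (s t : seq point) (a b c r : R).
Notation dist := (@eucl_dist R).

Definition inhull v x y z := exists a b,
  [/\ 0 <= a, 0 <= b, a + b <= 1 & v = x + a *: (y - x) + b *: (z - x)].

Definition exposed s := {in s, forall v, exists u, {in s, forall w, w != v -> dot u w < dot u v}}.

Lemma exposed_hull s v x y z : exposed s -> v \in s -> x \in s -> y \in s -> z \in s ->
  v != x -> v != y -> v != z -> ~ inhull v x y z.
Proof.
move=> es vs xs ys zs; rewrite ![v == _]eq_sym => vx vy vz [a [b [a0 b0 ab e]]].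
have [u hu] := es _ vs.
have : dot u v = (1 - a - b) * dot u x + a * dot u y + b * dot u z.
  by rewrite {1}e !dotE; ring.
have := hu _ xs vx; have := hu _ ys vy; have := hu _ zs vz.
move: (dot u v) (dot u x) (dot u y) (dot u z) => V xu yu zu hz hy hx eV.
suff : V <= Num.max xu (Num.max yu zu) by rewrite !le_max !leNgt hx hy hz.
set m := Num.max _ _.
have [mx my mz] : [/\ xu <= m, yu <= m & zu <= m] by rewrite !le_max !lexx !orbT.
have : 0 <= (1 - a - b) * (m - xu) by rewrite mulr_ge0; lra.
have : 0 <= a * (m - yu) by rewrite mulr_ge0 ?subr_ge0.
have : 0 <= b * (m - zu) by rewrite mulr_ge0 ?subr_ge0.
lra.
Qed.

(** By separation this means that [K] lies in the convex hull of the vertices. The form by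
    half-planes transfers affine inequalities from the vertices to [K] and is a closed condition on
    the vertices. *)
Definition covers s (K : set point) := forall u c,
  {in s, forall v, dot u v <= c} -> forall k, K k -> dot u k <= c.

Definition affine_fun (g : point -> R) := exists u c, forall z, g z = c + dot u z.

Lemma affine_funD g h : affine_fun g -> affine_fun h -> affine_fun (fun z => g z + h z).
Proof.
move=> [u [c e]] [u' [c' e']]; exists (u + u'), (c + c') => z; rewrite e e' dotDl; ring.
Qed.
Lemma affine_funZ r g : affine_fun g -> affine_fun (fun z => r * g z).
Proof. by move=> [u [c e]]; exists (r *: u), (r * c) => z; rewrite e dotZl; ring. Qed.
Lemma affine_func c : affine_fun (fun=> c).
Proof. by exists 0, c => z; rewrite dot0l addr0. Qed.
Lemma affine_fun_dot u c : affine_fun (fun z => dot u z + c).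
Proof. by exists u, c => z; rewrite addrC. Qed.
Lemma affine_fun_cross u A : affine_fun (fun z => cross u (z - A)).
Proof. by exists (rot u), (- cross u A) => z; rewrite crossDr crossNr addrC -crossE. Qed.

Lemma covers_affine s K g : covers s K -> affine_fun g ->
  {in s, forall v, 0 <= g v} -> forall k, K k -> 0 <= g k.
Proof.
move=> cs [u [c e]] h k Kk; rewrite e.
suff : dot (- u) k <= c by rewrite dotNl; lra.
by apply: cs Kk => v /h; rewrite e dotNl; lra.
Qed.

Lemma covers_sub s t K : {subset s <= t} -> covers s K -> covers t K.
Proof. by move=> st cs u c h; apply: cs => v /st; apply: h. Qed.

Lemma covers_neq_nil s K k : K k -> covers s K -> s != [::].
Proof.
move=> Kk; case: s => //= /(_ 0 (-1)) h.
have : dot 0 k <= -1 by apply: h Kk => v; rewrite in_nil.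
by rewrite dot0l; lra.
Qed.

(* Cone coordinates at [A] along [P - A] and [Q - A]. *)
Definition al A P Q z := cross (z - A) (Q - A) / cross (P - A) (Q - A).
Definition be A P Q z := cross (P - A) (z - A) / cross (P - A) (Q - A).

Lemma al_affine A P Q : affine_fun (al A P Q).
Proof.
have [u [c e]] := affine_fun_cross (- (cross (P - A) (Q - A))^-1 *: (Q - A)) A.
exists u, c => z; rewrite -e /al crossC crossZl; ring.
Qed.
Lemma be_affine A P Q : affine_fun (be A P Q).
Proof.
have [u [c e]] := affine_fun_cross ((cross (P - A) (Q - A))^-1 *: (P - A)) A.
exists u, c => z; rewrite -e /be crossZl; ring.
Qed.

Lemma coordE A P Q z : cross (P - A) (Q - A) != 0 ->
  z = A + al A P Q z *: (P - A) + be A P Q z *: (Q - A).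
Proof.
by move=> h; rewrite -addrA -(cramer (z - A) h) addrC subrK.
Qed.

Lemma coord_uniq A P Q a b z : cross (P - A) (Q - A) != 0 ->
  z = A + a *: (P - A) + b *: (Q - A) -> al A P Q z = a /\ be A P Q z = b.
Proof.
move=> h ->; have -> : al A P Q (A + a *: (P - A) + b *: (Q - A)) =
    cross (a *: (P - A) + b *: (Q - A)) (Q - A) / cross (P - A) (Q - A).
  by rewrite /al; congr (cross _ _ / _); apply: pt_eq; rewrite !mxE; ring.
have -> : be A P Q (A + a *: (P - A) + b *: (Q - A)) =
    cross (P - A) (a *: (P - A) + b *: (Q - A)) / cross (P - A) (Q - A).
  by rewrite /be; congr (cross _ _ / _); apply: pt_eq; rewrite !mxE; ring.
move: h; move: (P - A) (Q - A) => v w h.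
by rewrite crossDl crossDr !crossZl !crossZr !cross_self; split; field.
Qed.

Lemma al_A A P Q : al A P Q A = 0.
Proof. by rewrite /al /cross !mxE; ring. Qed.
Lemma be_A A P Q : be A P Q A = 0.
Proof. by rewrite /be /cross !mxE; ring. Qed.
Lemma al_P A P Q : cross (P - A) (Q - A) != 0 -> al A P Q P = 1.
Proof. by move=> h; rewrite /al divff. Qed.
Lemma be_P A P Q : be A P Q P = 0.
Proof. by rewrite /be cross_self mul0r. Qed.
Lemma al_Q A P Q : al A P Q Q = 0.
Proof. by rewrite /al cross_self mul0r. Qed.
Lemma be_Q A P Q : cross (P - A) (Q - A) != 0 -> be A P Q Q = 1.
Proof. by move=> h; rewrite /be divff. Qed.

(** In cone coordinates at [X] the line through [N1] and the new vertex has the equation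
    [r * al + be = r]. As [K] lies in the cone and beyond this line, cutting off the corner [X]
    loses nothing of [K]. *)
Lemma slide X N1 N2 r W K : covers (X :: W) K -> N1 \in W -> N2 \in W -> 0 <= r ->
  cross (N1 - X) (N2 - X) != 0 ->
  (forall k, K k -> [/\ 0 <= al X N1 N2 k, 0 <= be X N1 N2 k &
      r <= r * al X N1 N2 k + be X N1 N2 k]) ->
  covers (mid r X N2 :: W) K.
Proof.
move=> cX h1 h2 r0 D h u c hc k Kk.
have hW : {in W, forall v, dot u v <= c} by move=> v hv; apply: hc; rewrite in_cons hv orbT.
have [hX|hX] := lerP (dot u X) c.
  by apply: cX Kk => v; rewrite in_cons => /orP[/eqP ->//|]; exact: hW.
have := hc _ (mem_head _ _); rewrite dot_mid.
have g1 := hW _ h1; have g2 := hW _ h2; have [a0 b0 ab] := h _ Kk => gs.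
have e : dot u k = dot u X + al X N1 N2 k * (dot u N1 - dot u X) + be X N1 N2 k * (dot u N2 - dot u X).
  by rewrite {1}(coordE k D) !dotE; ring.
have [r_eq0|rn0] := eqVneq r 0; first by move: gs; rewrite r_eq0; lra.
have rp : 0 < r by rewrite lt0r rn0.
rewrite -subr_ge0 -(pmulr_rge0 _ rp) e.
move: (al _ _ _ _) (be _ _ _ _) a0 b0 ab {e} => a b a0 b0 ab.
move: hX gs g1 g2; move: (dot u X) (dot u N1) (dot u N2) => x n1 n2 hX gs g1 g2.
have : 0 <= r * a * (c - n1) by rewrite !mulr_ge0 ?subr_ge0.
have : 0 <= b * (c - ((1 - r) * x + r * n2)) by rewrite mulr_ge0 ?subr_ge0.
have : 0 <= (r * a + b - r) * (x - c) by rewrite mulr_ge0 ?subr_ge0 // ltW.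
nra.
Qed.

Lemma cross0l x : cross 0 x = 0.
Proof. by rewrite /cross !mxE !mul0r subr0. Qed.

Lemma cross0_colinear v w : v != 0 -> cross v w = 0 -> w = (dot v w / dot v v) *: v.
Proof.
move=> /dot_sq_gt0 v0 c; have d0 : dot v v != 0 by rewrite gt_eqF.
apply: pt_eq; rewrite mxE; apply: (mulIf d0); rewrite mulrAC divfK //.
  by transitivity (dot v w * v 0 0 - v 0 1 * cross v w); [rewrite /dot /cross; ring|rewrite c; ring].
by transitivity (dot v w * v 0 1 + v 0 0 * cross v w); [rewrite /dot /cross; ring|rewrite c; ring].
Qed.

(** Under these assumptions the segments [pq] and [xy] cross at an inner point of [pq], and the
    triangle inequality there shows that exchanging partners shortens. *)
Lemma crossing_lt p q x y : cross (q - p) (x - p) * cross (q - p) (y - p) < 0 ->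
  ~ inhull p q x y -> ~ inhull q p x y ->
  dist p x + dist q y < dist p q + dist x y.
Proof.
set cx := cross _ (x - p); set cy := cross _ (y - p) => cc hp hq.
have qp : q - p != 0.
  by apply: contraTneq cc => e; rewrite /cx /cy e !cross0l mul0r ltxx.
have dn : cx - cy != 0.
  by apply: contraTneq cc => /subr0_eq ->; rewrite -leNgt -expr2 sqr_ge0.
(* [r] is the position on [xy] of its intersection [z] with the line [pq], and [l] below is the
   position of [z] on [pq]. If [l <= 0], then [p] lies in the triangle [qxy]; if [l >= 1], then [q]
   lies in [pxy]. *)
pose r := cx / (cx - cy).
have r01 : 0 < r < 1.
  have e : 1 - r = - cy / (cx - cy) by rewrite /r; field.
  have q0 : 0 < (cx - cy) ^+ 2 by rewrite lt0r sqrf_eq0 dn sqr_ge0.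
  have r0 : 0 < r.
    have -> : r = (cx * (cx - cy)) / (cx - cy) ^+ 2 by rewrite /r; field.
    by rewrite divr_gt0 // mulrBr subr_gt0; apply: lt_le_trans cc _; rewrite -expr2 sqr_ge0.
  rewrite r0 /= -subr_gt0 e.
  have -> : - cy / (cx - cy) = (cy ^+ 2 - cx * cy) / (cx - cy) ^+ 2 by field.
  by rewrite divr_gt0 // subr_gt0; apply: lt_le_trans cc _; rewrite sqr_ge0.
have /andP[r0 r1] := r01.
pose z := mid r x y.
have cz : cross (q - p) (z - p) = 0.
  have -> : z - p = (1 - r) *: (x - p) + r *: (y - p) by apply: pt_eq; rewrite !mxE; ring.
  by rewrite crossDr !crossZr -/cx -/cy /r; field.
pose l := dot (q - p) (z - p) / dot (q - p) (q - p).
have dd := dot_sq_gt0 qp.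
have ez : z - p = l *: (q - p) by apply: cross0_colinear.
have cxn : cx != 0 by apply: contraTneq cc => ->; rewrite mul0r ltxx.
have [l0|l0] := lerP l 0.
  exfalso; apply: hp; exists ((1 - r) / (1 - l)), (r / (1 - l)); split.
  - by rewrite divr_ge0; lra.
  - by rewrite divr_ge0; lra.
  - by rewrite -mulrDl subrK ler_pdivrMr; lra.
  have e0 : z = p + l *: (q - p) by rewrite -ez addrC subrK.
  have e (i : 'I_2) : z 0 i = x 0 i + r * (y 0 i - x 0 i) by rewrite !mxE.
  have e' (i : 'I_2) : z 0 i = p 0 i + l * (q 0 i - p 0 i) by rewrite e0 !mxE.
  have l1 : 1 - l != 0 by lra.
  apply/rowP => i; rewrite !mxE.
  have := e i; rewrite e' => ee; apply: (mulfI l1).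
  have f1 : (1 - l) * ((1 - r) / (1 - l)) = 1 - r by rewrite mulrC divfK.
  have f2 : (1 - l) * (r / (1 - l)) = r by rewrite mulrC divfK.
  transitivity ((1 - l) * q 0 i + ((1 - l) * ((1 - r) / (1 - l))) * (x 0 i - q 0 i) +
    ((1 - l) * (r / (1 - l))) * (y 0 i - q 0 i)); last by ring.
  rewrite f1 f2; lra.
have [l1|l1] := lerP 1 l.
  exfalso; apply: hq; exists ((1 - r) / l), (r / l); split.
  - by rewrite divr_ge0; lra.
  - by rewrite divr_ge0; lra.
  - by rewrite -mulrDl subrK ler_pdivrMr; lra.
  have e0 : z = p + l *: (q - p) by rewrite -ez addrC subrK.
  have e (i : 'I_2) : z 0 i = x 0 i + r * (y 0 i - x 0 i) by rewrite !mxE.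
  have e' (i : 'I_2) : z 0 i = p 0 i + l * (q 0 i - p 0 i) by rewrite e0 !mxE.
  have ln0 : l != 0 by lra.
  apply/rowP => i; rewrite !mxE.
  have := e i; rewrite e' => ee; apply: (mulfI ln0).
  have f1 : l * ((1 - r) / l) = 1 - r by rewrite mulrC divfK.
  have f2 : l * (r / l) = r by rewrite mulrC divfK.
  transitivity (l * p 0 i + (l * ((1 - r) / l)) * (x 0 i - p 0 i) +
    (l * (r / l)) * (y 0 i - p 0 i)); last by ring.
  rewrite f1 f2; lra.
have zl : z = mid l p q by rewrite /mid -ez addrC subrK.
have h1 : dist p x < dist p z + dist z x.
  apply: dist_triangle_lt.
  have -> : p - z = - (l *: (q - p)) by rewrite -ez opprB.
  have -> : x - z = (x - p) - l *: (q - p) by rewrite -ez; apply: pt_eq; rewrite !mxE; ring.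
  by rewrite crossNl crossZl crossDr crossNr crossZr cross_self -/cx mulr0 subr0 oppr_eq0 mulf_neq0 // gt_eqF.
have h2 := dist_triangle z q y.
have h3 : dist p q = dist p z + dist z q by rewrite zl; apply: mid_split; rewrite !ltW.
have h4 : dist x y = dist x z + dist z y by apply: mid_split; rewrite !ltW.
rewrite h3 h4 (distC x z); rewrite (distC q z) in h2; lra.
Qed.

End Hulls.

(** * Polygons of minimal penalised length *)

Section Best.
Context {R : realType}.
Notation point := 'rV[R]_2.
Notation dist := (@eucl_dist R).
Implicit Types (u v w x y z A P Q X : point) (s t m : seq point) (a b c r : R).

Definition plen s : R := if s is x :: s' then tot dist x s' else 0.

Lemma plen_ge0 s : 0 <= plen s.
Proof. by case: s => //= x s; apply: tot_ge0; exact: dist_ge0. Qed.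

Lemma plen_cat s x t : plen (s ++ x :: t) = plen (rcons s x) + tot dist x t.
Proof.
case: s => [|y s] /=; first by rewrite add0r.
by rewrite -cat_rcons tot_cat last_rcons.
Qed.

Lemma plen_rev s : plen (rev s) = plen s.
Proof.
case: s => [|x s] //; rewrite lastI rev_rcons -lastI /=; apply: tot_rev; exact: distC.
Qed.

Lemma rev_headE (T : Type) (x0 : T) (s : seq T) : head x0 (rev s) = last x0 s.
Proof. by case/lastP: s => [|s x] //; rewrite rev_rcons last_rcons. Qed.

Lemma rev_lastE (T : Type) (x0 : T) (s : seq T) : last x0 (rev s) = head x0 s.
Proof. by case: s => [|x s] //; rewrite rev_cons last_rcons. Qed.

Variables (K : set point) (kap : R).

Definition Jcost A0 B0 s : R := plen s + kap * dist (head A0 s) A0 + kap * dist (last B0 s) B0.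

(** Competitors have at most as many vertices, which reduces existence to compactness. Strictness
    against fewer vertices makes every vertex indispensable. *)
Definition is_best A0 B0 s := covers s K /\ forall t, covers t K ->
  ((size t <= size s)%N -> Jcost A0 B0 s <= Jcost A0 B0 t) /\ ((size t < size s)%N -> Jcost A0 B0 s < Jcost A0 B0 t).

Lemma covers_rev s : covers s K -> covers (rev s) K.
Proof. by apply: covers_sub => x; rewrite mem_rev. Qed.

Lemma J_rev A0 B0 s : Jcost B0 A0 (rev s) = Jcost A0 B0 s.
Proof.
by rewrite /Jcost plen_rev rev_headE rev_lastE; ring.
Qed.

Lemma best_rev A0 B0 s : is_best A0 B0 s -> is_best B0 A0 (rev s).
Proof.
move=> [cs h]; split; first exact: covers_rev.
by move=> t /covers_rev/h; rewrite !J_rev !size_rev.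
Qed.

Lemma J_cat A0 B0 s x t : Jcost A0 B0 (s ++ x :: t) =
  plen (rcons s x) + tot dist x t + kap * dist (head A0 (rcons s x)) A0 + kap * dist (last x t) B0.
Proof.
rewrite /Jcost plen_cat last_cat /=; congr (_ + _ * dist _ _ + _).
by case: s.
Qed.

Variables (k0 : point) (Kk0 : K k0).
Hypotheses (kap_gt0 : 0 < kap) (kap_le : 10 * kap <= 1).
Variables (A0 B0 : point).
Local Notation best := (is_best A0 B0).

Lemma kap_triangle v w x : kap * dist w x <= dist w v + kap * dist v x.
Proof.
have h1 : kap * dist w x <= kap * (dist w v + dist v x) by rewrite ler_pM2l // dist_triangle.
have h2 : kap * dist w v <= dist w v.
  by rewrite ler_piMl ?dist_ge0 //; have h := kap_le; have h0 := kap_gt0; lra.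
lra.
Qed.

(** Omitting an inner vertex does not lengthen the polygon. Omitting an end also moves that end, but
    since [kap] is below 1 the added penalty is at most the length of the omitted edge. *)
Lemma best_delete s1 v s2 : best (s1 ++ v :: s2) -> ~ covers (s1 ++ s2) K.
Proof.
move=> [_ h] hc; have [_] := h _ hc; rewrite !size_cat /= addnS ltnS leqnn => /(_ isT).
apply/negP; rewrite -leNgt.
case: s2 hc {h} => [|w s2] hc.
  rewrite cats0 in hc *; case/lastP: s1 hc => [/(covers_neq_nil Kk0)//|s1 p] hc.
  rewrite -cats1 -catA !J_cat /= !addr0.
  have := kap_triangle v p B0; lra.
case/lastP: s1 hc => [|s1 p] hc; rewrite -?cats1 -?catA !J_cat /=.
  have := kap_triangle v w A0; rewrite (distC w v); lra.
have := dist_triangle v p w; lra.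
Qed.

(** By [best_delete] some half-plane contains all other vertices but not all of [K], so [v] lies
    outside it. The statement is about positions rather than points and hence also excludes repeated
    vertices. *)
Lemma best_exposed_pos s1 v s2 : best (s1 ++ v :: s2) ->
  exists u, {in s1 ++ s2, forall w, dot u w < dot u v}.
Proof.
move=> hb; have [hc _] := hb; have := best_delete hb.
move/existsNP => [u /existsNP[c /not_implyP[h1 /existsNP[k /not_implyP[Kk /negP]]]]].
rewrite -ltNge => ck.
have cv : c < dot u v.
  rewrite ltNge; apply/negP => hv; suff : dot u k <= c by rewrite leNgt ck.
  apply: hc Kk => w; rewrite mem_cat in_cons orbCA => /orP[/eqP ->//|h].
  by apply: h1; rewrite mem_cat.
by exists u => w /h1 hw; apply: le_lt_trans cv.
Qed.

Lemma best_uniq s : best s -> uniq s.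
Proof.
have sfx : forall s2 s1, best (s1 ++ s2) -> uniq s2.
  elim=> [//|v s2 ih] s1 hb /=; rewrite (ih (rcons s1 v)) ?cat_rcons // andbT.
  apply/negP => hv; have [u /(_ v)] := best_exposed_pos hb.
  by rewrite mem_cat hv orbT ltxx => /(_ isT).
exact: (sfx s [::]).
Qed.

Lemma best_exposed s : best s -> exposed s.
Proof.
move=> hb v vs; case/splitPr: vs hb => s1 s2 hb.
have [u hu] := best_exposed_pos hb; exists u => w; rewrite mem_cat in_cons => hw wv.
by apply: hu; rewrite mem_cat; move: hw; rewrite (negbTE wv).
Qed.

(** Reversing the part from [q] to [x] keeps the vertices and both ends, so only two edges
    change. *)
Lemma best_two_opt s1 p q m x y s2 : best (s1 ++ p :: q :: m ++ x :: y :: s2) ->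
  dist p q + dist x y <= dist p x + dist q y.
Proof.
move=> hb; have [hc h] := hb.
have pe : perm_eq (s1 ++ p :: q :: m ++ x :: y :: s2) (s1 ++ p :: x :: rev m ++ q :: y :: s2).
  rewrite perm_cat2l perm_cons -!cat_cons.
  have -> : (q :: m) ++ [:: x, y & s2] = (q :: rcons m x) ++ y :: s2 by rewrite /= cat_rcons.
  have -> : (x :: rev m) ++ [:: q, y & s2] = rev (q :: rcons m x) ++ y :: s2.
    by rewrite rev_cons rev_rcons -cats1 -catA.
  by rewrite perm_cat2r perm_sym perm_rev.
have [] := h (s1 ++ p :: x :: rev m ++ q :: y :: s2).
  by apply: covers_sub hc => z; rewrite (perm_mem pe).
rewrite (perm_size pe) leqnn => /(_ isT) + _.
rewrite !J_cat /= !tot_cat !last_cat /=.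
have e : tot dist q m + dist (last q m) x = tot dist x (rev m) + dist (last x (rev m)) q.
  have := tot_rev (@distC R) q (rcons m x).
  by rewrite last_rcons belast_rcons rev_cons !tot_rcons => ->.
lra.
Qed.

Lemma adjacent_sign (g : point -> R) s : {in s, forall v, g v != 0} ->
  [\/ {in s, forall v, 0 < g v}, {in s, forall v, g v < 0} |
   exists m x y s2, s = m ++ x :: y :: s2 /\ g x * g y < 0].
Proof.
elim: s => [|x s ih] h; first by apply: Or31.
have hx : g x != 0 by apply: h; rewrite mem_head.
have [|hp|hn|[m [x' [y [s2 [-> hxy]]]]]] := ih _.
- by move=> v vs; apply: h; rewrite in_cons vs orbT.
- have [xn|xp] := ltrP (g x) 0.
    case: s hp {ih h} => [|y s] hp.
      by apply: Or32 => v; rewrite inE => /eqP ->.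
    by apply: Or33; exists [::], x, y, s; split => //; rewrite pmulr_llt0 // hp ?mem_head.
  apply: Or31 => v; rewrite in_cons => /orP[/eqP ->|/hp //]; by rewrite lt0r hx.
- have [xn|xp] := ltrP (g x) 0.
    by apply: Or32 => v; rewrite in_cons => /orP[/eqP ->|/hn].
  have xp' : 0 < g x by rewrite lt0r hx.
  case: s hn {ih h} => [|y s] hn.
    by apply: Or31 => v; rewrite inE => /eqP ->.
  by apply: Or33; exists [::], x, y, s; split => //; rewrite pmulr_rlt0 // hn ?mem_head.
- by apply: Or33; exists (x :: m), x', y, s2.
Qed.

Lemma inhull_collinear p q v : q != p -> cross (q - p) (v - p) = 0 ->
  [\/ inhull v p q q, inhull p q v v | inhull q p v v].
Proof.
move=> qp c; have qp' : q - p != 0 by rewrite subr_eq0.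
have := cross0_colinear qp' c; set l := _ / _ => e.
have hv (i : 'I_2) : v 0 i = p 0 i + l * (q 0 i - p 0 i).
  by have /rowP /(_ i) := e; rewrite !mxE => h; lra.
have [l0|l0] := ltrP l 0.
  apply: Or32; exists ((1 - l)^-1), 0; have l1 : 1 - l != 0 by lra.
  split => //; first by rewrite invr_ge0; lra.
    by rewrite addr0 invf_le1; lra.
  by apply/rowP => i; rewrite !mxE hv; apply: (mulfI l1); field.
have [l1|l1] := lerP l 1.
  apply: Or31; exists l, 0; split; rewrite ?addr0 //.
  by apply/rowP => i; rewrite !mxE hv; ring.
apply: Or33; exists (l^-1), 0; have ln : l != 0 by lra.
split => //; first by rewrite invr_ge0.
  by rewrite addr0 invf_le1; lra.
by apply/rowP => i; rewrite !mxE hv; field.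
Qed.

(** If two consecutive later vertices lay on different sides, their edge would cross [pq], against
    [best_two_opt] and [crossing_lt]. Being exposed keeps the later vertices off the line and rules
    out the exceptional positions in [crossing_lt]. *)
Lemma best_side s1 p q s : best (s1 ++ p :: q :: s) ->
  {in s, forall v, 0 < cross (q - p) (v - p)} \/ {in s, forall v, cross (q - p) (v - p) < 0}.
Proof.
move=> hb; have he := best_exposed hb; have hu := best_uniq hb.
have pin : p \in s1 ++ p :: q :: s by rewrite mem_cat mem_head orbT.
have qin : q \in s1 ++ p :: q :: s by rewrite mem_cat !in_cons eqxx !orbT.
have sin : {in s, forall v, v \in s1 ++ p :: q :: s}.
  by move=> v vs; rewrite mem_cat !in_cons vs !orbT.
move: hu; rewrite cat_uniq /= !in_cons => /and3P[_ _ /and3P[]].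
rewrite negb_or => /andP[pq ps] qs _.
have pv : {in s, forall v, p != v} by move=> v vs; apply: contraNneq ps => ->.
have qv : {in s, forall v, q != v} by move=> v vs; apply: contraNneq qs => ->.
have vp : {in s, forall v, v != p} by move=> v /pv; rewrite eq_sym.
have vq : {in s, forall v, v != q} by move=> v /qv; rewrite eq_sym.
have qp : q != p by rewrite eq_sym.
have [|h|h|[m [x [y [s2 [e hxy]]]]]] := @adjacent_sign (fun v => cross (q - p) (v - p)) s; last 3 first.
- by left.
- by right.
- exfalso; have xs : x \in s by rewrite e mem_cat mem_head orbT.
  have ys : y \in s by rewrite e mem_cat !in_cons eqxx !orbT.
  have := crossing_lt hxy; rewrite ltNge; move: hb; rewrite e => /best_two_opt ->.
  have h : ~ inhull p q x y.
    by apply: (exposed_hull he) => //; first [exact: sin | exact: pv | exact: qv | exact: vp | exact: vq].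
  have h' : ~ inhull q p x y.
    by apply: (exposed_hull he) => //; first [exact: sin | exact: pv | exact: qv | exact: vp | exact: vq].
  by move=> /(_ h h').
move=> v vs; apply/eqP => c; have [] := @inhull_collinear p q v qp c.
- by apply: (exposed_hull he) => //; first [exact: sin | exact: pv | exact: qv | exact: vp | exact: vq].
- by apply: (exposed_hull he) => //; first [exact: sin | exact: pv | exact: qv | exact: vp | exact: vq].
- by apply: (exposed_hull he) => //; first [exact: sin | exact: pv | exact: qv | exact: vp | exact: vq].
Qed.

(** Directions in an open half-plane are linearly ordered by angle, and [q] is the last one; [e]
    witnesses the half-plane and gives transitivity. *)
Lemma cross_argmin (e : point) s x : {in x :: s, forall v, 0 < cross e v} ->
  exists2 q, q \in x :: s & {in x :: s, forall v, 0 <= cross v q}.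
Proof.
elim: s x => [|y s ih] x h.
  by exists x; rewrite ?mem_head // => v; rewrite inE => /eqP ->; rewrite cross_self.
have [|q qs hq] := ih y; first by move=> v vs; apply: h; rewrite in_cons vs orbT.
have [h0|h0] := lerP 0 (cross x q).
  exists q; first by rewrite in_cons qs orbT.
  by move=> v; rewrite in_cons => /orP[/eqP ->|/hq].
exists x; rewrite ?mem_head // => v; rewrite in_cons => /orP[/eqP ->|vs]; first by rewrite cross_self.
have hv := hq _ vs.
have e0 : 0 < cross e q by apply: h; rewrite in_cons qs orbT.
have e1 : 0 < cross e v by apply: h; rewrite in_cons vs orbT.
have e2 : 0 < cross e x by apply: h; rewrite mem_head.
rewrite -(pmulr_rge0 _ e0).
have -> : cross e q * cross v x = cross e v * cross q x + cross e x * cross v q.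
  rewrite /cross; ring.
by rewrite addr_ge0 // mulr_ge0 // ?(ltW e1) ?(ltW e2) // crossC oppr_ge0 ltW.
Qed.

(** By [best_side] the later vertices lie on one side of [AP]; [Q] is the one whose direction from
    [A] is farthest from that of [AP]. A later vertex with coordinates summing to less than 1 would
    lie in the triangle [APQ]. *)
Lemma best_cone P s A : best (A :: P :: s) -> s != [::] -> exists Q, [/\ Q \in s,
  cross (P - A) (Q - A) != 0 & {in s, forall v, [/\ 0 <= al A P Q v, 0 < be A P Q v &
    1 <= al A P Q v + be A P Q v]}].
Proof.
move=> hb sn; have he := best_exposed hb; have hu := best_uniq hb.
suff [Q [Qs D hQ]] : exists Q, [/\ Q \in s, cross (P - A) (Q - A) != 0 &
    {in s, forall v, 0 <= al A P Q v /\ 0 < be A P Q v}].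
  exists Q; split => // v vs; have [a0 b0] := hQ v vs; split => //.
  rewrite leNgt; apply/negP => ab.
  have vQ : v != Q by apply: contraTneq ab => ->; rewrite al_Q be_Q // add0r ltxx.
  apply: (@exposed_hull _ _ v A P Q he); rewrite ?mem_head ?in_cons ?eqxx ?vs ?Qs ?orbT //.
  - by move: hu => /= /and3P[]; rewrite in_cons => /norP[_ h _ _]; apply: contraNneq h => <-.
  - by move: hu => /= /and3P[_ h _]; apply: contraNneq h => <-.
  - by exists (al A P Q v), (be A P Q v); split; [exact: a0|exact: ltW|exact: ltW|exact: coordE].
have [h|h] := best_side (s1 := [::]) hb.
- case: s sn hb he hu h => // x s _ hb he hu h.
  have [|q] := @cross_argmin (P - A) [seq v - A | v <- s] (x - A).
    by move=> v; rewrite -(map_cons (fun v => v - A)) => /mapP[z /h zs ->].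
  rewrite -(map_cons (fun v => v - A)) => /mapP[Q Qs ->] hQ; exists Q; split => //; first by rewrite gt_eqF // h.
  move=> v vs; split; last by rewrite /be divr_gt0 // h.
  by rewrite /al divr_ge0 //; [exact/hQ/(map_f (fun v => v - A))|exact/ltW/h].
- case: s sn hb he hu h => // x s _ hb he hu h.
  (* Swapping the coordinates reverses orientation and reduces this case to the same ordering by
     angle. *)
  pose refl z : point := pt (z 0 1) (z 0 0).
  have reflE z w : cross (refl z) (refl w) = - cross z w.
    by rewrite /cross !pt0 !pt1; ring.
  have [|q] := @cross_argmin (refl (P - A)) [seq refl (v - A) | v <- s] (refl (x - A)).
    by move=> v; rewrite -(map_cons (fun v => refl (v - A))) => /mapP[z /h zs ->]; rewrite reflE oppr_gt0.
  rewrite -(map_cons (fun v => refl (v - A))) => /mapP[Q Qs ->] hQ; exists Q; split => //; first by rewrite lt_eqF // h.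
  move=> v vs; split; last by rewrite /be nmulr_rgt0 ?invr_lt0 h.
  rewrite /al nmulr_lge0 ?invr_lt0 ?h // -oppr_ge0 -reflE.
  by apply: hQ; exact: (map_f (fun v => refl (v - A))).
Qed.

End Best.

(** * Contact with a moving line, and two ways to shorten a polygon at its end *)

Section Touch.
Context {R : realType}.
Notation point := 'rV[R]_2.
Implicit Types (u v w x y z A P Q X T : point) (W : seq point) (a b c r s t kap : R).

Lemma dot_continuous u : continuous (dot u).
Proof.
move=> z; rewrite /dot.
apply: (@continuousD _ _ _ (fun z : point => u 0 0 * z 0 0) (fun z : point => u 0 1 * z 0 1)).
  apply: (@continuousM _ _ (fun=> u 0 0) (fun z : point => z 0 0)); first exact: cst_continuous.
  exact: coord_continuous.
apply: (@continuousM _ _ (fun=> u 0 1) (fun z : point => z 0 1)); first exact: cst_continuous.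
exact: coord_continuous.
Qed.

Lemma affine_continuous (g : point -> R) : affine_fun g -> continuous g.
Proof.
move=> [u [c e]]; have -> : g = (fun z => c + dot u z) by apply/funext.
move=> z; apply: (@continuousD _ _ _ (fun=> c) (dot u)); first exact: cst_continuous.
exact: dot_continuous.
Qed.

Variable K : set point.
Hypothesis cK : compact K.
Variables (k0 : point) (Kk0 : K k0).

Lemma compact_argmin (g : point -> R) : continuous g ->
  exists2 z, K z & forall z', K z' -> g z <= g z'.
Proof.
move=> cg; have [||z] := @compact_EVT_min _ _ g K _ cK; first by exists k0.
  exact: continuous_subspaceT.
by rewrite inE => Kz h; exists z => // z' Kz'; apply: h; rewrite inE.
Qed.

Lemma compact_max_pos (g h : point -> R) : affine_fun g -> affine_fun h ->
  (forall k, K k -> 0 < g k \/ 0 < h k) ->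
  exists2 e, 0 < e & forall k, K k -> e <= g k \/ e <= h k.
Proof.
move=> ag ah gh; have [|z Kz hz] := @compact_argmin (fun z => Num.max (g z) (h z)).
  by move=> z; apply: (@continuous_max _ _ g h); apply: affine_continuous.
exists (Num.max (g z) (h z)); first by rewrite lt_max; apply/orP; exact: gh.
by move=> k /hz; rewrite le_max => /orP.
Qed.

(** [r] is the largest admissible value, and [T] is a point that stops it from growing. Points with
    [g >= 1] never stop it, since [r * (1 - g) <= 0 <= h]; if no other point did, compactness would
    leave a margin for a larger [r]. *)
Lemma sup_slide (g h : point -> R) : affine_fun g -> affine_fun h ->
  (forall k, K k -> 0 <= g k /\ 0 <= h k) -> ~ (forall k, K k -> 1 <= g k + h k) ->
  exists r, [/\ 0 <= r < 1, forall k, K k -> r <= r * g k + h k &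
    exists T, [/\ K T, r = r * g T + h T & g T <= 1]].
Proof.
move=> ag ah gh n1.
pose S := [set r | 0 <= r <= 1 /\ forall k, K k -> r <= r * g k + h k].
have S0 : S 0 by split; rewrite ?lexx ?ler01 // => k /gh[]; rewrite mul0r add0r.
have hS : has_sup S by split; [exists 0|exists 1 => r [/andP[]]].
have r0 : 0 <= sup S by apply: ub_le_sup => //; case: hS.
have r1 : sup S <= 1 by apply: ge_sup => [|r [/andP[]]//]; exists 0.
have Sr k : K k -> sup S <= sup S * g k + h k.
  move=> Kk; have [g0 h0] := gh _ Kk.
  have [g1|g1] := lerP 1 (g k).
    have : 0 <= sup S * (g k - 1) by rewrite mulr_ge0 ?subr_ge0. lra.
  suff : sup S <= h k / (1 - g k) by rewrite ler_pdivlMr ?subr_gt0 //; lra.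
  apply: ge_sup => [|r [_ /(_ _ Kk)]]; first by exists 0.
  by rewrite ler_pdivlMr ?subr_gt0 //; lra.
exists (sup S); split => //.
  rewrite r0 lt_neqAle r1 andbT; apply/eqP => e; apply: n1 => k /Sr; rewrite e mul1r //.
apply: contrapT => nT.
have lt1 : sup S < 1.
  rewrite lt_neqAle r1 andbT; apply/eqP => e; apply: n1 => k /Sr; rewrite e mul1r //.
have [|||d d0 hd] := @compact_max_pos (fun k => sup S * g k + h k + - sup S) (fun k => g k + - 1).
- apply: affine_funD; [apply: affine_funD => //; exact: affine_funZ|exact: affine_func].
- by apply: affine_funD => //; exact: affine_func.
- move=> k Kk; have [h1|h1] := ltrP 0 (sup S * g k + h k + - sup S); [by left|right].
  rewrite ltNge; apply/negP => h2; apply: nT; exists k; have := Sr _ Kk; split => //; lra.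
pose e := Num.min d (1 - sup S).
have e0 : 0 < e by rewrite lt_min d0 subr_gt0.
have ed : e <= d by rewrite ge_min lexx.
have e1 : e <= 1 - sup S by rewrite ge_min lexx orbT.
have : sup S + e <= sup S; last by lra.
apply: ub_le_sup; first by case: hS.
split; first lra.
move=> k Kk; have [g0 h0] := gh _ Kk; case: (hd _ Kk) => hk.
  have : 0 <= e * g k by rewrite mulr_ge0 // ltW.
  lra.
have : 0 <= (sup S + e) * (g k - 1) by rewrite mulr_ge0; lra.
lra.
Qed.

Lemma covers_hull x y z r W : covers (x :: W) K -> 0 <= r <= 1 -> x = mid r y z ->
  y \in W -> z \in W -> covers W K.
Proof.
move=> cx /andP[r0 r1] e yW zW u c h; apply: cx => v; rewrite in_cons => /orP[/eqP ->|/h //].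
by rewrite e dot_mid; have := h _ yW; have := h _ zW; nra.
Qed.

(** Read [p] as [P - A] and [e] as [Q - A]. If the cosine of the angle at [A] exceeds [kap], moving
    the end from [A] towards [Q] shortens [AP] faster than the penalty grows. *)
Lemma mid_closer (p e : point) kap r : 0 < kap -> 10 * kap <= 1 -> 0 < r -> e != 0 -> p != 0 ->
  kap * nrm p * nrm e < dot p e ->
  exists2 s, 0 < s <= r & nrm (p - s *: e) + kap * (s * nrm e) < nrm p.
Proof.
move=> k0' k1 r0; rewrite -!nrm_gt0 => e0 p0 h.
pose d := dot p e - kap * nrm p * nrm e.
have d0 : 0 < d by rewrite subr_gt0.
(* The second bound keeps the penalty below [nrm p], so that squaring is allowed; the third makes
   the quadratic term [s ^+ 2 * nrm e ^+ 2] at most [s * d]. *)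
pose s := Num.min r (Num.min (nrm p / nrm e) (d / nrm e ^+ 2)).
have s0 : 0 < s by rewrite !lt_min r0 !divr_gt0 // exprn_gt0.
have s1 : s * nrm e <= nrm p by rewrite -ler_pdivlMr // !ge_min lexx !orbT.
have s2 : s * nrm e ^+ 2 <= d by rewrite -ler_pdivlMr ?exprn_gt0 // !ge_min lexx !orbT.
exists s; first by rewrite s0 !ge_min lexx.
have ks : kap * (s * nrm e) < nrm p.
  have : kap * (s * nrm e) <= kap * nrm p by rewrite ler_pM2l.
  have : kap * nrm p <= 10^-1 * nrm p by rewrite ler_pM2r //; lra.
  lra.
rewrite -ltrBrDr -(@ltr_pXn2r _ 2) ?nnegrE ?nrm_ge0 //; last by rewrite subr_ge0 ltW.
rewrite sqr_nrm.
have -> : dot (p - s *: e) (p - s *: e) = nrm p ^+ 2 - 2 * s * dot p e + s ^+ 2 * nrm e ^+ 2.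
  by rewrite !sqr_nrm !dotE (dotC e p); ring.
have : s * (s * nrm e ^+ 2) <= s * d by rewrite ler_pM2l.
have : 0 < s * d by rewrite mulr_gt0.
have : 0 <= (kap * (s * nrm e)) ^+ 2 by rewrite sqr_ge0.
rewrite /d; nra.
Qed.

(** For an almost right angle at [A] the path A, P, Q is replaced by P, A', Q with A' at fraction
    [s] of AQ. This saves [4 * kap * nrm p] along AQ. It costs a penalty [kap * nrm p] for starting
    at P, at most as much again because |PQ| may be below |AQ|, and [12 * kap ^+ 2 * nrm p] because
    |PA'| may exceed |AP|. With [10 * kap <= 1] a surplus remains. *)
Lemma detour_shorter (p e : point) kap s : 0 < kap -> 10 * kap <= 1 -> p != 0 ->
  `|dot p e| <= kap * nrm p * nrm e -> s * nrm e = 4 * kap * nrm p -> 0 <= s <= 1 ->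
  nrm (p - s *: e) + (1 - s) * nrm e + kap * nrm p < nrm p + nrm (p - e).
Proof.
move=> k0' k1; rewrite -nrm_gt0 => p0; rewrite ler_norml => /andP[h1 h2] hs /andP[s0 s1].
have e0 := nrm_ge0 e.
have n1 : nrm e - kap * nrm p <= nrm (p - e).
  have [h|h] := lerP (nrm e - kap * nrm p) 0; first exact: le_trans h (nrm_ge0 _).
  rewrite -(@ler_pXn2r _ 2) ?nnegrE ?nrm_ge0 ?(ltW h) // sqr_nrm.
  have -> : dot (p - e) (p - e) = nrm p ^+ 2 - 2 * dot p e + nrm e ^+ 2.
    by rewrite !sqr_nrm !dotE (dotC e p); ring.
  have : (kap * nrm p) ^+ 2 <= nrm p ^+ 2.
    by rewrite lerXn2r ?nnegrE ?mulr_ge0 ?ltW //; nra.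
  nra.
have n2 : nrm (p - s *: e) <= nrm p * (1 + 12 * kap ^+ 2).
  rewrite -(@ler_pXn2r _ 2) ?nnegrE ?nrm_ge0 // ?mulr_ge0 ?nrm_ge0 //; last by rewrite addr_ge0 // mulr_ge0 // sqr_ge0.
  rewrite sqr_nrm.
  have -> : dot (p - s *: e) (p - s *: e) = nrm p ^+ 2 - 2 * s * dot p e + (s * nrm e) ^+ 2.
    by rewrite exprMn !sqr_nrm !dotE (dotC e p); ring.
  have h3 : - (s * dot p e) <= kap * nrm p * (s * nrm e).
    have : 0 <= s * (dot p e + kap * nrm p * nrm e) by rewrite mulr_ge0 //; lra.
    lra.
  rewrite hs in h3 *.
  have : 0 <= (nrm p * (12 * kap ^+ 2)) ^+ 2 by rewrite sqr_ge0.
  nra.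
have : kap * kap * nrm p <= 10^-1 * kap * nrm p.
  by rewrite ler_pM2r // ler_pM2r //; lra.
have : 0 < kap * nrm p by rewrite mulr_gt0.
lra.
Qed.

End Touch.

(** * Choice of a point of [K] and of a foot on [AQ] near an end *)

Section Ends.
Context {R : realType}.
Notation point := 'rV[R]_2.
Notation dist := (@eucl_dist R).
Implicit Types (u v w x y z A P Q X T : point) (W : seq point) (a b c r t : R).

Variable K : set point.
Hypothesis cK : compact K.
Variables (k0 : point) (Kk0 : K k0).

(** The hypothesis says that [y] and [Q] are seen from [mid t A Q] under an angle that is not
    acute. *)
Lemma mid_pythagoras A Q y t : (1 - t) * (dot (y - A) (Q - A) - t * dot (Q - A) (Q - A)) <= 0 ->
  dist (mid t A Q) Q ^+ 2 + dist y (mid t A Q) ^+ 2 <= dist y Q ^+ 2.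
Proof.
rewrite !sqr_dist /mid /dot !mxE; nra.
Qed.

(** The foot [mid s A Q] will stand in for [A]. It has [K] and [B] beyond its perpendicular to [AQ],
    unless [s = r]; in that case the slope bound for [r] will place it close to [A]. *)
Lemma end_geometry A P Q B T r t : cross (P - A) (Q - A) != 0 -> 0 <= r < 1 ->
  (forall k, K k -> [/\ 0 <= al A P Q k, 0 <= be A P Q k & r <= r * al A P Q k + be A P Q k]) ->
  0 <= al A P Q B -> 0 <= be A P Q B -> 1 <= al A P Q B + be A P Q B ->
  K T -> 0 <= t <= 1 -> T = mid t (mid r A Q) P ->
  exists (a : point) (s : R), [/\ K a, inhull a A P Q, 0 <= s <= 1,
    dist (mid s A Q) Q ^+ 2 + dist a (mid s A Q) ^+ 2 <= dist a Q ^+ 2 &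
    s = r \/ forall z, K z \/ z = B -> 0 <= dot (z - mid s A Q) (Q - A)].
Proof.
move=> D /andP[r0 r1] hK B0 B1 B2 KT /andP[t0 t1] eT.
pose x z := dot (z - A) (Q - A); pose L := dot (Q - A) (Q - A).
have L0 : 0 < L.
  by apply: dot_sq_gt0; apply: contraNneq D => ->; rewrite crossC cross0l oppr0.
have xE z : x z = al A P Q z * x P + be A P Q z * L.
  by have := congr1 (fun w => dot w (Q - A)) (cramer (z - A) D); rewrite [RHS]dotDl !dotZl.
have xT : x T = t * x P + (1 - t) * r * L.
  by rewrite /x /L eT /mid /dot !mxE; ring.
have TH : inhull T A P Q.
  exists t, ((1 - t) * r); split => //; first by rewrite mulr_ge0 //; lra.
    have : 0 <= (1 - t) * (1 - r) by rewrite mulr_ge0; lra. lra.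
  by rewrite eT; apply: pt_eq; rewrite !mxE; ring.
have xc z s : dot (z - mid s A Q) (Q - A) = x z - s * L.
  by rewrite /x /L /mid /dot !mxE; ring.
(* [x] measures along [AQ], with value [L] at [Q]. If [P] is not ahead of [mid r A Q], neither is
   the contact point [T], which then makes an angle with [Q] there that is not acute. *)
have [p0|p0] := lerP (x P) (r * L).
  exists T, r; split => //; [by rewrite r0 ltW| |by left].
  apply: mid_pythagoras; rewrite -/L -/(x T) xT.
  have : 0 <= (1 - r) * (t * (r * L - x P)) by rewrite !mulr_ge0 // ?subr_ge0 // ltW.
  lra.
have xlow z : 0 <= al A P Q z -> 0 <= be A P Q z -> r <= r * al A P Q z + be A P Q z ->
    r * L <= x z.
  move=> a0 b0 ab; rewrite xE.
  have : 0 <= al A P Q z * (x P - r * L) by rewrite mulr_ge0 // subr_ge0 ltW.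
  have : 0 <= (r * al A P Q z + be A P Q z - r) * L by rewrite mulr_ge0 ?subr_ge0 ?(ltW L0).
  lra.
have [m Km hm] := compact_argmin cK Kk0 (affine_continuous (affine_fun_dot (Q - A) (- dot (Q - A) A))).
have {}hm z : K z -> x m <= x z by move=> /hm /=; rewrite /x !(dotBl (Q - A)) ![dot _ (Q - A)]dotC; lra.
have xTP : x T <= x P.
  have : 0 <= (1 - t) * (x P - r * L) by rewrite mulr_ge0 // subr_ge0 // ltW.
  rewrite xT; lra.
have xB M : M <= x P -> M <= L -> r * L <= M -> M <= x B.
  move=> MP ML Mr.
  rewrite -(@ler_pM2l _ (1 - r)) ?subr_gt0 // xE.
  move: (al _ _ _ _) (be _ _ _ _) (x P) B0 B1 B2 MP p0 {xE xT xlow xTP} => b0 b1 X B0 B1 B2 MP p0.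
  have h1 : 0 <= (b0 * (1 - r)) * (X - M) by rewrite !mulr_ge0 ?subr_ge0 ?(ltW r1).
  have h2 : 0 <= (r * b0 + b1 - r) * (L - M) by rewrite mulr_ge0 //; nra.
  have h3 : 0 <= (b0 + b1 - 1) * (M - r * L) by rewrite mulr_ge0 ?subr_ge0.
  have h4 : 0 <= r * b0 * (X - M) by rewrite !mulr_ge0 ?subr_ge0.
  nra.
(* [m] is the first point of [K] along [AQ], and its orthogonal projection is the foot. If already
   [m] lies beyond [Q], the foot is [Q] itself. *)
have [mL|mL] := lerP (x m) L.
  have [am bm abm] := hK _ Km; have mr := xlow _ am bm abm.
  have ess : x m / L * L = x m by rewrite divfK // gt_eqF.
  exists m, (x m / L); split => //.
  - exists (al A P Q m), (be A P Q m); split => //; last by rewrite -coordE.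
    have h1 := hm _ KT; have h2 : x m <= x P by apply: le_trans h1 xTP.
    pose mu := Num.min (x P - r * L) ((1 - r) * L).
    have mu0 : 0 < mu by rewrite lt_min subr_gt0 p0 mulr_gt0 // subr_gt0.
    have [mu1 mu2] : mu <= x P - r * L /\ mu <= (1 - r) * L by rewrite !ge_min !lexx orbT.
    have mu3 : x m - r * L <= mu by rewrite le_min mulrBl mul1r !lerD2r h2 mL.
    rewrite -(@ler_pM2l _ mu) // mulr1; rewrite xE in mu3.
    move: (al _ _ _ _) (be _ _ _ _) am bm abm (x P) mu1 mu3 {h2 p0 xE xT xlow xTP xB} => a b am bm abm X mu1 mu3.
    have g1 : 0 <= (1 - r) * a * (X - r * L - mu) by rewrite !mulr_ge0 ?subr_ge0 ?(ltW r1).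
    have g2 : 0 <= (r * a + b - r) * ((1 - r) * L - mu) by rewrite mulr_ge0 ?subr_ge0.
    have g3 : 0 <= (1 - r) * (mu - (a * X + b * L - r * L)) by rewrite mulr_ge0 ?subr_ge0 ?(ltW r1).
    nra.
  - rewrite ler_pdivrMr // mul1r mL andbT divr_ge0 ?(ltW L0) //; apply: le_trans mr; exact: mulr_ge0 r0 (ltW L0).
  - by apply: mid_pythagoras; rewrite -/L -/(x m) ess subrr mulr0.
  - right => z; rewrite xc ess subr_ge0 => -[/hm //|->]; apply: xB => //.
    exact: le_trans (hm _ KT) xTP.
exists T, 1; split => //; first by rewrite ler01 lexx.
  by apply: mid_pythagoras; rewrite subrr mul0r.
right => z; rewrite xc mul1r subr_ge0 => -[/hm h|->]; first by rewrite (le_trans _ h) // ltW.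
apply: xB => //; last by rewrite ger_pMl // ltW.
by apply: le_trans xTP; apply: le_trans (hm _ KT); rewrite ltW.
Qed.

End Ends.

(** * Contact of [K] with the end of a minimal polygon *)

Section TouchPath.
Context {R : realType}.
Notation point := 'rV[R]_2.
Notation dist := (@eucl_dist R).
Implicit Types (u v w x y z A P Q X T : point) (W : seq point) (a b c r t : R).

Variable K : set point.
Hypothesis cK : compact K.
Variables (k0 : point) (Kk0 : K k0).
Variable kap : R.
Hypotheses (kap_gt0 : 0 < kap) (kap_le : 10 * kap <= 1).
Variables (A0 B0 : point).
Local Notation best := (is_best K kap A0 B0).

Lemma best_lt s (t : seq point) : best s -> covers t K -> (size t <= size s)%N ->
  Jcost kap A0 B0 t < Jcost kap A0 B0 s -> False.
Proof. by move=> [_ h] ct st; rewrite ltNge; case: (h _ ct) => /(_ st) ->. Qed.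

Lemma cone_affine s A P Q : covers s K ->
  {in s, forall v, 0 <= al A P Q v /\ 0 <= be A P Q v} ->
  forall k, K k -> 0 <= al A P Q k /\ 0 <= be A P Q k.
Proof.
move=> cs h k Kk; split.
  by apply: (covers_affine cs (al_affine A P Q)) Kk => v /h[].
by apply: (covers_affine cs (be_affine A P Q)) Kk => v /h[].
Qed.

(** As the later vertices lie on the same side of [P v2] as [A], [K] lies in the cone at [P] spanned
    by [A] and [v2]. If it missed the edge [AP], then [P] could slide towards [v2], which shortens
    the polygon. *)
Lemma touch_same A P v2 s : best (A :: P :: v2 :: s) ->
  {in s, forall v, 0 < cross (v2 - P) (v - P) * cross (v2 - P) (A - P)} ->
  exists t T, [/\ 0 <= t <= 1, K T & T = mid t A P].
Proof.
move=> hb hs; have [hc _] := hb.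
have side := best_side Kk0 kap_gt0 kap_le (s1 := [::]) hb.
have AP z : cross (A - P) (z - P) = - cross (P - A) (z - A).
  by rewrite /cross !mxE; ring.
have D : cross (A - P) (v2 - P) != 0.
  rewrite AP oppr_eq0; case: side => /(_ v2); rewrite mem_head => /(_ isT) h.
    by rewrite gt_eqF.
  by rewrite lt_eqF.
have cone : {in [:: A, P, v2 & s], forall v, 0 <= al P A v2 v /\ 0 <= be P A v2 v}.
  move=> v; rewrite !in_cons => /or4P[/eqP ->|/eqP ->|/eqP ->|vs].
  - by rewrite al_P // be_P ler01 lexx.
  - by rewrite al_A be_A lexx.
  - by rewrite al_Q be_Q // ler01 lexx.
  split.
    have c0 : cross (v2 - P) (A - P) != 0 by rewrite crossC oppr_eq0.
    have -> : al P A v2 v = cross (v2 - P) (v - P) * cross (v2 - P) (A - P) / cross (v2 - P) (A - P) ^+ 2.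
      rewrite /al; have -> : cross (v - P) (v2 - P) = - cross (v2 - P) (v - P) := crossC _ _.
      by have -> : cross (A - P) (v2 - P) = - cross (v2 - P) (A - P) := crossC _ _; field.
    have := hs _ vs => h.
    by rewrite divr_ge0 ?sqr_ge0 // ltW.
  rewrite /be !AP invrN mulrNN; case: side => h.
    by rewrite divr_ge0 // ltW // h // in_cons ?vs ?eqxx ?orbT.
  by rewrite mulr_le0 ?invr_le0 // ltW // h // in_cons ?vs ?eqxx ?orbT.
have hK := cone_affine hc cone.
apply: contrapT => nT.
have [||k Kk|d d0 hd] := @compact_max_pos _ K cK k0 Kk0 (be P A v2) (fun k => al P A v2 k + -1).
- exact: be_affine.
- by apply: affine_funD; [exact: al_affine|exact: affine_func].
- have [b0|b0] := ltrP 0 (be P A v2 k); [by left|right].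
  rewrite ltNge; apply/negP => a1; have [a0 b1] := hK _ Kk; apply: nT.
  have bE : be P A v2 k = 0 by lra.
  exists (1 - al P A v2 k), k; split => //; first by lra.
  by rewrite {1}(coordE k D) bE; apply: pt_eq; rewrite !mxE; ring.
pose s0 := Num.min d 1.
have s0p : 0 < s0 by rewrite lt_min d0 ltr01.
have s01 : s0 <= 1 by rewrite ge_min lexx orbT.
have s0d : s0 <= d by rewrite ge_min lexx.
have ct : covers (A :: mid s0 P v2 :: v2 :: s) K.
  have : covers (mid s0 P v2 :: A :: v2 :: s) K.
    apply: (@slide _ P A v2 s0 (A :: v2 :: s)) => //.
    - by apply: covers_sub hc => z; rewrite !in_cons orbCA.
    - by rewrite mem_head.
    - by rewrite !in_cons eqxx orbT.
    - exact: ltW.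
    move=> k Kk; have [a0 b0] := hK _ Kk; split => //; case: (hd _ Kk) => h.
      have : 0 <= s0 * al P A v2 k by rewrite mulr_ge0 // ltW.
      lra.
    have : 0 <= s0 * (al P A v2 k - 1) by rewrite mulr_ge0; lra.
    lra.
  by apply: covers_sub => z; rewrite !in_cons orbCA.
apply: (best_lt hb ct) => //; rewrite /Jcost /= ltrD2r ltrD2r !addrA ltrD2r.
have := @mid_split _ s0 P v2; rewrite s01 (ltW s0p) => /(_ isT) ->.
rewrite addrA ltrD2r; apply: dist_triangle_lt.
have -> : mid s0 P v2 - P = s0 *: (v2 - P) by rewrite /mid addrC addKr.
by rewrite crossZr mulf_neq0 // gt_eqF.
Qed.

(** Otherwise the polygon can be improved: if the cosine at [A] exceeds [kap], by moving [A] towards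
    [Q]; if it is below [- kap], by moving [A] away from [Q]; in between by the detour P, A', Q,
    whose fraction of AQ is then at most [r]. Up to fraction [r], [slide] keeps [K] covered. *)
Lemma touch_slope A P Q s r : best (A :: P :: Q :: s) -> 0 <= r < 1 ->
  cross (P - A) (Q - A) != 0 ->
  (forall k, K k -> [/\ 0 <= al A P Q k, 0 <= be A P Q k & r <= r * al A P Q k + be A P Q k]) ->
  r * dist A Q <= 4 * kap * dist A P.
Proof.
move=> hb /andP[r0 r1] D hK; have [hc _] := hb.
have e0 : Q - A != 0 by apply: contraNneq D => ->; rewrite crossC cross0l oppr0.
have p0 : P - A != 0 by apply: contraNneq D => ->; rewrite cross0l.
rewrite !(distC A) !distE; have n0 : 0 < nrm (Q - A) by rewrite nrm_gt0.
rewrite leNgt; apply/negP => big.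
have rp : 0 < r.
  have : 0 < r * nrm (Q - A).
    by apply: le_lt_trans big; rewrite mulr_ge0 ?nrm_ge0 // mulr_ge0 // ltW.
  by rewrite pmulr_lgt0.
have hS t : 0 <= t <= r -> covers (mid t A Q :: P :: Q :: s) K.
  move=> /andP[t0 tr]; apply: (@slide _ A P Q t) => //.
  - by rewrite mem_head.
  - by rewrite !in_cons eqxx orbT.
  move=> k /hK[a0 b0 ab]; split => //.
  have [a1|a1] := lerP 1 (al A P Q k).
    have : 0 <= t * (al A P Q k - 1) by rewrite mulr_ge0 //; lra.
    lra.
  have : 0 <= (r - t) * (1 - al A P Q k) by rewrite mulr_ge0; lra.
  lra.
have move_A t : covers (mid t A Q :: P :: Q :: s) K ->
    ~ (nrm (P - A - t *: (Q - A)) + kap * (`|t| * nrm (Q - A)) < nrm (P - A)).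
  move=> ct h; apply: (best_lt hb ct) => //; rewrite /Jcost /= ltrD2r.
  have := dist_triangle A (mid t A Q) A0.
  have -> : dist (mid t A Q) A = `|t| * nrm (Q - A).
    by rewrite distE /mid addrC addKr nrmZ.
  rewrite -(ler_pM2l kap_gt0) (distC A P) (distC _ P) !distE.
  have -> : P - mid t A Q = P - A - t *: (Q - A) by rewrite /mid opprD addrA.
  lra.
have [h|h] := ltrP (kap * nrm (P - A) * nrm (Q - A)) (dot (P - A) (Q - A)).
  have [t /andP[t0 tr] ht] := mid_closer kap_gt0 kap_le rp e0 p0 h.
  by apply: (@move_A t); rewrite ?gtr0_norm //; apply: hS; rewrite ltW.
have [h'|h'] := ltrP (kap * nrm (P - A) * nrm (Q - A)) (- dot (P - A) (Q - A)).
  rewrite -dotNr -[nrm (Q - A)]nrmN in h'.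
  have e0' : - (Q - A) != 0 by rewrite oppr_eq0.
  have [t /andP[t0 tr]] := mid_closer kap_gt0 kap_le rp e0' p0 h'.
  rewrite nrmN scalerN opprK => ht; apply: (@move_A (- t)).
    have t1 : 0 < 1 + t by lra.
    (* Moving away from [Q] only enlarges the hull: the old [A] lies between the new end and [Q]. *)
    apply: (@covers_hull _ _ A (mid (- t) A Q) Q (t / (1 + t))).
    - by apply: covers_sub hc => z; rewrite !in_cons => /or4P[] ->; rewrite ?orbT.
    - rewrite divr_ge0 ?(ltW t0) ?(ltW t1) //= ler_pdivrMr //; lra.
    - have tn : 1 + t != 0 by rewrite gt_eqF.
      by apply/rowP => i; rewrite !mxE; field.
    - by rewrite mem_head.
    - by rewrite !in_cons eqxx !orbT.
  by rewrite normrN gtr0_norm // scaleNr opprK.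
pose t := 4 * kap * nrm (P - A) / nrm (Q - A).
have te : t * nrm (Q - A) = 4 * kap * nrm (P - A) by rewrite divfK // gt_eqF.
have t0 : 0 <= t by rewrite divr_ge0 ?nrm_ge0 // mulr_ge0 ?nrm_ge0 // mulr_ge0 // ltW.
have tr : t <= r by rewrite ler_pdivrMr // ltW.
have ct : covers (P :: mid t A Q :: Q :: s) K.
  have := hS t; rewrite t0 tr => /(_ isT); apply: covers_sub => z.
  by rewrite !in_cons orbCA.
have t1 : t <= 1 by lra.
apply: (best_lt hb ct) => //; rewrite /Jcost /= ltrD2r.
have := @detour_shorter _ (P - A) (Q - A) kap t kap_gt0 kap_le p0.
rewrite ler_norml te t0 t1 => /(_ _ erefl isT).
have -> : - (kap * nrm (P - A) * nrm (Q - A)) <= dot (P - A) (Q - A) <= kap * nrm (P - A) * nrm (Q - A).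
  by rewrite lerNl h' h.
move=> /(_ isT).
have -> : nrm (P - A - t *: (Q - A)) = dist P (mid t A Q).
  by rewrite distE /mid opprD addrA.
have -> : nrm (P - A - (Q - A)) = dist P Q by rewrite distE opprB addrA subrK.
have -> : (1 - t) * nrm (Q - A) = dist (mid t A Q) Q by rewrite dist_mid_r // distC distE.
have := dist_triangle A P A0; rewrite -(ler_pM2l kap_gt0) (distC P A) -distE (distC P A); lra.
Qed.

(** If the vertices after [v2] lie on the side of the line [P v2] where [A] is, [K] meets [AP]
    itself and [r = 0]. Otherwise [v2] serves as [Q], and the line through [P] is turned, its other
    end moving from [A] along [AQ], until [K] stops it. *)
Lemma best_touch A P s : best (A :: P :: s) -> s != [::] -> exists Q (r : R) T (t : R),
  [/\ Q \in s, cross (P - A) (Q - A) != 0,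
    {in s, forall v, [/\ 0 <= al A P Q v, 0 < be A P Q v & 1 <= al A P Q v + be A P Q v]},
    (forall k, K k -> [/\ 0 <= al A P Q k, 0 <= be A P Q k & r <= r * al A P Q k + be A P Q k]) &
    [/\ 0 <= r < 1, r * dist A Q <= 4 * kap * dist A P, K T, 0 <= t <= 1 & T = mid t (mid r A Q) P]].
Proof.
move=> hb sn; have [hc _] := hb.
have coneK Q : cross (P - A) (Q - A) != 0 ->
   {in s, forall v, [/\ 0 <= al A P Q v, 0 < be A P Q v & 1 <= al A P Q v + be A P Q v]} ->
   forall k, K k -> 0 <= al A P Q k /\ 0 <= be A P Q k.
  move=> D hQ; apply: (cone_affine hc) => v; rewrite !in_cons => /or3P[/eqP ->|/eqP ->|/hQ[]].
  - by rewrite al_A be_A.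
  - by rewrite al_P // be_P ler01.
  - by move=> ? /ltW.
have touch0 : (exists (t : R) T, [/\ 0 <= t <= 1, K T & T = mid t A P]) -> exists Q (r : R) T (t : R),
  [/\ Q \in s, cross (P - A) (Q - A) != 0,
    {in s, forall v, [/\ 0 <= al A P Q v, 0 < be A P Q v & 1 <= al A P Q v + be A P Q v]},
    (forall k, K k -> [/\ 0 <= al A P Q k, 0 <= be A P Q k & r <= r * al A P Q k + be A P Q k]) &
    [/\ 0 <= r < 1, r * dist A Q <= 4 * kap * dist A P, K T, 0 <= t <= 1 & T = mid t (mid r A Q) P]].
  move=> [t [T [t01 KT eT]]].
  have [Q [Qs D hQ]] := best_cone Kk0 kap_gt0 kap_le hb sn.
  exists Q, 0, T, t; split => //.
    by move=> k /(coneK _ D hQ)[a0 b0]; split => //; rewrite mul0r add0r.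
  split => //; rewrite ?lexx ?ltr01 ?mid0 // mul0r mulr_ge0 ?dist_ge0 // mulr_ge0 //.
  exact: ltW.
case: s sn hb hc coneK touch0 => // v2 s _ hb hc coneK touch0.
have sideA := best_side Kk0 kap_gt0 kap_le (s1 := [::]) hb.
have side := best_side Kk0 kap_gt0 kap_le (s1 := [:: A]) hb.
have D : cross (P - A) (v2 - A) != 0.
  by case: sideA => /(_ v2); rewrite mem_head => /(_ isT) h; [rewrite gt_eqF|rewrite lt_eqF].
have D' : cross (v2 - P) (A - P) = cross (P - A) (v2 - A).
  by rewrite /cross !mxE; ring.
have [same|opp] : {in s, forall v, 0 < cross (v2 - P) (v - P) * cross (v2 - P) (A - P)} \/
   {in s, forall v, cross (v2 - P) (v - P) * cross (v2 - P) (A - P) < 0}.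
  rewrite D'; case: side => h; have [d|d] := ltrP 0 (cross (P - A) (v2 - A)).
  - by left => v /h h'; rewrite mulr_gt0.
  - by right => v /h h'; rewrite pmulr_rlt0 // lt_neqAle D.
  - by right => v /h h'; rewrite nmulr_rlt0.
  - by left => v /h h'; rewrite nmulr_rgt0 // lt_neqAle D.
- by apply: touch0; apply: touch_same hb same.
have he := best_exposed Kk0 kap_gt0 kap_le hb; have hu := best_uniq Kk0 kap_gt0 kap_le hb.
have b0 : {in v2 :: s, forall v, 0 < be A P v2 v}.
  move=> v vs; rewrite /be; case: sideA => h; first by rewrite divr_gt0 ?h ?mem_head.
  by rewrite nmulr_rgt0 ?invr_lt0 h ?mem_head.
have abE v : al A P v2 v + be A P v2 v - 1 = - (cross (v2 - P) (v - P) / cross (P - A) (v2 - A)).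
  by move: D; rewrite /al /be /cross !mxE => D; field.
have hQ : {in v2 :: s, forall v, [/\ 0 <= al A P v2 v, 0 < be A P v2 v & 1 <= al A P v2 v + be A P v2 v]}.
  move=> v; rewrite in_cons => /orP[/eqP ->|vs].
    by rewrite al_Q be_Q // lexx ltr01 add0r lexx.
  have bv : 0 < be A P v2 v by apply: b0; rewrite in_cons vs orbT.
  have ab : 1 < al A P v2 v + be A P v2 v.
    rewrite -subr_gt0 abE -mulrN -invrN.
    have := opp _ vs; rewrite D' => h.
    have -> : cross (v2 - P) (v - P) / - cross (P - A) (v2 - A) =
      - (cross (v2 - P) (v - P) * cross (P - A) (v2 - A)) / cross (P - A) (v2 - A) ^+ 2 by field.
    by rewrite divr_gt0 ?oppr_gt0 // lt0r sqrf_eq0 D sqr_ge0.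
  split => //; last exact: ltW.
  (* A later vertex [v] beyond the ray [A v2] would put [v2] into the triangle [A P v]. *)
  rewrite leNgt; apply/negP => a0.
  move: hu; rewrite /= !in_cons => /and4P[/norP[AP /norP[Av As]] /norP[Pv Ps] vns _].
  apply: (@exposed_hull _ _ v2 A P v he); rewrite ?in_cons ?eqxx ?vs ?orbT // 1?eq_sym //.
    by apply: contraNneq vns => <-.
  have bn : be A P v2 v != 0 by rewrite gt_eqF.
  exists (- al A P v2 v / be A P v2 v), (be A P v2 v)^-1; split.
  - by rewrite divr_ge0 ?oppr_ge0 // ltW.
  - by rewrite invr_ge0 ltW.
  - by rewrite -{2}[_^-1]mul1r -mulrDl ler_pdivrMr //; lra.
  - have ev := coordE v D; move: (al _ _ _ _) (be _ _ _ _) bn ev {a0 ab bv} => a b bn ev.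
    by apply/rowP => i; rewrite {1}ev !mxE; field.
have hK := coneK _ D hQ.
have [||||r [r01 hr [T [KT eT aT]]]] := @sup_slide _ K cK k0 Kk0 (al A P v2) (be A P v2).
- exact: al_affine.
- exact: be_affine.
- exact: hK.
(* If [K] lay beyond the line [P v2], the vertex [A] could be deleted. *)
- move=> h1; have := best_delete Kk0 kap_gt0 kap_le (s1 := [::]) hb; apply.
  have : covers (mid 1 A v2 :: P :: v2 :: s) K.
    apply: (@slide _ A P v2 1) => //; rewrite ?mem_head ?in_cons ?eqxx ?orbT //.
    by move=> k Kk; have [? ?] := hK _ Kk; split => //; rewrite mul1r h1.
  by rewrite mid1; apply: covers_sub => z; rewrite !in_cons => /orP[->|//]; rewrite orbT.
have hK' k : K k -> [/\ 0 <= al A P v2 k, 0 <= be A P v2 k & r <= r * al A P v2 k + be A P v2 k].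
  by move=> Kk; have [? ?] := hK _ Kk; split => //; exact: hr.
exists v2, r, T, (al A P v2 T); split => //; first by rewrite mem_head.
split => //; first exact: touch_slope hb r01 D hK'.
  by have [-> _] := hK _ KT.
have bT : be A P v2 T = r - r * al A P v2 T by lra.
by rewrite {1}(coordE T D) bT; apply: pt_eq; rewrite !mxE; ring.
Qed.

End TouchPath.

(** * Cauchy's perimeter formula *)

Section PeriodicIntegral.
Context {R : realType}.
Notation mu := (@lebesgue_measure R).
Implicit Types (f g : R -> R) (a b c p x y : R).

Lemma cont_integrable f a b : continuous f -> mu.-integrable `[a, b] (EFin \o f).
Proof.
move=> cf; apply: continuous_compact_integrable; first exact: segment_compact.
exact: continuous_subspaceT.
Qed.

Lemma antiderivative f M : continuous f -> exists H : R -> R,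
  forall x, - M < x < M -> is_derive x (1 : R) H (f x).
Proof.
move=> cf; exists (fun x => \int[mu]_(t in [set` `[- M, x]]) (f t)) => x /andP[Mx xM].
have [] := @continuous_FTC1_closed R f (- M) x M xM (cont_integrable (- M) M cf) Mx (cf x).
by rewrite derive1E => d e; exact: (DeriveDef d e).
Qed.

Lemma is_derive_shift f x c df : is_derive (x + c) (1 : R) f df ->
  is_derive x (1 : R) (fun y => f (y + c)) df.
Proof.
move=> h; have e : df = df * 1 by rewrite mulr1.
rewrite e; apply: is_derive1_comp => //.
rewrite -[X in is_derive _ _ _ X]addr0; exact: is_deriveD.
Qed.

Lemma is_derive_cont f x df : is_derive x (1 : R) f df -> {for x, continuous f}.
Proof. by move=> h; apply/differentiable_continuous/derivable1_diffP. Qed.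

(** The increment of a primitive over one period is constant, because its derivative
    [f (x + p) - f x] vanishes. *)
Lemma periodic_integral_shift f p c : 0 < p -> continuous f -> (forall x, f (x + p) = f x) ->
  \int[mu]_(t in `[0, p]) f (t + c) = \int[mu]_(t in `[0, p]) f t.
Proof.
move=> p0 cf fp; pose M := `|c| + 2 * p + 1.
have [H hH] := antiderivative M cf.
have cM := ler_norm c; have cM' := ler_norm (- c); rewrite normrN in cM'.
have int d : `|d| <= `|c| -> \int[mu]_(t in `[0, p]) f (t + d) = H (p + d) - H d.
  move=> hd; have dM := ler_norm d; have dM' := ler_norm (- d); rewrite normrN in dM'.
  have hd' x : 0 <= x <= p -> is_derive x (1 : R) (fun y => H (y + d)) (f (x + d)).
    move=> /andP[x0 xp]; apply: is_derive_shift; apply: hH; rewrite /M; lra.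
  have := @continuous_FTC2 R (fun t => f (t + d)) (fun t => H (t + d)) 0 p p0.
  rewrite /Rintegral /= add0r => ->.
  - by rewrite -EFinB.
  - apply: continuous_subspaceT => x; apply: continuous_comp; last exact: cf.
    by apply: cvgD; [exact: cvg_id|exact: cvg_cst].
  - split.
    + move=> x; rewrite in_itv /= => /andP[x0 xp]; have /hd' hx : 0 <= x <= p by rewrite !ltW.
      exact: ex_derive.
    + by apply: cvg_at_right_filter; apply: (is_derive_cont (df := f (0 + d))); apply: hd'; rewrite lexx ltW.
    + by apply: cvg_at_left_filter; apply: (is_derive_cont (df := f (p + d))); apply: hd'; rewrite lexx ltW.
  - move=> x; rewrite in_itv /= => /andP[x0 xp].
    have /hd' hx : 0 <= x <= p by rewrite !ltW.
    by rewrite derive1E (@derive_val _ _ _ _ _ _ _ hx).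
have hG x : - `|c| <= x <= `|c| -> is_derive x (1 : R) (fun x => H (x + p) - H x) 0.
  move=> /andP[x1 x2]; have -> : 0 = f (x + p) - f x by rewrite fp subrr.
  apply: is_deriveB; last by apply: hH; rewrite /M; lra.
  by apply: is_derive_shift; apply: hH; rewrite /M; lra.
have Gcst x y : - `|c| <= x -> x < y -> y <= `|c| -> H (y + p) - H y = H (x + p) - H x.
  move=> x1 xy y1.
  have [z|z|z _] := @MVT R (fun x => H (x + p) - H x) (fun=> 0) x y xy.
  - by rewrite in_itv /= => /andP[z1 z2]; apply: hG; lra.
  - apply: continuous_in_subspaceT => z'; rewrite inE /= in_itv /= => /andP[z1 z2].
    by apply: is_derive_cont; apply: hG; lra.
  - by rewrite mul0r; lra.
have c0 := normr_ge0 c.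
have e : \int[mu]_(t in `[0, p]) f t = \int[mu]_(t in `[0, p]) f (t + 0).
  by apply: eq_Rintegral => t _; rewrite addr0.
rewrite e !int ?normr0 // addr0 ![p + _]addrC ?add0r.
have [h|h|->] := ltgtP c 0; last by rewrite add0r.
- by rewrite -[p in RHS]add0r -(Gcst c 0) // lerNl.
- by rewrite -[p in RHS]add0r -(Gcst 0 c) // lerNl oppr0.
Qed.

Lemma integral_cont_gt0 f a b c : continuous f -> (forall x, 0 <= f x) -> a < b ->
  a <= c <= b -> 0 < f c -> 0 < \int[mu]_(t in `[a, b]) f t.
Proof.
move=> cf f0 ab /andP[ac cb] fc.
have : \forall x \near c, f c / 2 < f x.
  have h : f c / 2 < f c by lra.
  exact: (cvgr_gt _ (cf c) _ h).
move=> /nbhs_ballP[d /= d0 hd].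
pose l := Num.max a (c - d / 2); pose r := Num.min b (c + d / 2).
have lr : l < r.
  rewrite gt_max !lt_min ab /=; lra.
have sub : `[l, r] `<=` (`[a, b] : set R).
  move=> x /=; rewrite !in_itv /= ge_max le_min => /andP[/andP[-> _] /andP[-> _]] //.
have hf x : l <= x <= r -> f c / 2 <= f x.
  rewrite ge_max le_min => /andP[/andP[_ h1] /andP[_ h2]].
  by apply/ltW/hd; rewrite /ball /= ltr_distl; lra.
have h1 : \int[mu]_(t in `[l, r]) (f c / 2) <= \int[mu]_(t in `[l, r]) f t.
  have i1 := @cont_integrable (fun=> f c / 2) l r (@cst_continuous _ _ _).
  have i2 := @cont_integrable f l r cf.
  have := @le_Rintegral _ _ _ _ _ _ _ _ i1 i2; apply; first exact: measurable_itv.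
  by move=> x /=; rewrite in_itv /=; exact: hf.
have h2 : \int[mu]_(t in `[l, r]) f t <= \int[mu]_(t in `[a, b]) f t.
  rewrite /Rintegral; apply: fine_le.
  - exact: (integrable_fin_num _ (cont_integrable l r cf)).
  - exact: (integrable_fin_num _ (cont_integrable a b cf)).
  have /integrableP[mf _] := @cont_integrable f a b cf.
  by apply: ge0_subset_integral => // x _; rewrite lee_fin.
apply: lt_le_trans h2; apply: lt_le_trans h1.
rewrite Rintegral_cst; last exact: measurable_itv.
have e : lebesgue_measure ([set` `[l, r]] : set R) = (r - l)%:E.
  by rewrite lebesgue_measure_itv /= lte_fin lr -EFinB.
apply: (eq_ind_r (fun z => 0 < f c / 2 * fine z) _ e).
by rewrite /= mulr_gt0 // ?subr_gt0 // divr_gt0.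
Qed.

End PeriodicIntegral.

(** * Integrals over the unit circle of directions *)

Section CircleIntegral.
Context {R : realType}.
Notation point := 'rV[R]_2.
Notation mu := (@lebesgue_measure R).
Implicit Types (g h : point -> R) (u v : point) (t : R).

Definition circ t : point := pt (cos t) (sin t).

Lemma continuous_pt (T : topologicalType) (f g : T -> R) : continuous f -> continuous g ->
  continuous (fun x => pt (f x) (g x)).
Proof.
move=> cf cg; have -> : (fun x => pt (f x) (g x)) = (fun x => f x *: pt 1 0 + g x *: pt 0 1).
  by apply/funext => x; apply: pt_eq; rewrite !mxE /=; ring.
move=> x; apply: (@continuousD _ _ _ (fun x => f x *: pt 1 0) (fun x => g x *: pt 0 1)).
  by apply: continuousZr_tmp; exact: cf.
by apply: continuousZr_tmp; exact: cg.
Qed.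

Lemma circ_continuous : continuous circ.
Proof. by apply: continuous_pt; [exact: continuous_cos|exact: continuous_sin]. Qed.

Lemma circ_surj u : dot u u = 1 -> exists2 t, - pi <= t <= pi & u = circ t.
Proof.
rewrite /dot => e; have c1 : -1 <= u 0 0 <= 1 by rewrite -ler_norml -(@ler_pXn2r _ 2) ?nnegrE // real_normK ?num_real //; have := sqr_ge0 (u 0 1); lra.
have s2 : 1 - u 0 0 ^+ 2 = u 0 1 ^+ 2 by lra.
have p0 := pi_ge0 R; have a0 := acos_ge0 c1; have a1 := acos_lepi c1.
have [s0|s0] := lerP 0 (u 0 1).
  exists (acos (u 0 0)); first by lra.
  by apply: pt_eq; rewrite ?pt0 ?pt1 ?acosK // sin_acos // s2 sqrtr_sqr ger0_norm.
exists (- acos (u 0 0)); first by lra.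
apply: pt_eq; rewrite ?pt0 ?pt1 ?cosN ?sinN ?acosK // sin_acos // s2 sqrtr_sqr ltr0_norm // opprK //.
Qed.

Definition circ_int g : R := \int[mu]_(t in `[0, pi *+ 2]) g (circ t).

Lemma circ_integrable g : continuous g -> mu.-integrable `[0, pi *+ 2] (EFin \o (g \o circ)).
Proof.
by move=> cg; apply: cont_integrable => t; apply: continuous_comp; [exact: circ_continuous|exact: cg].
Qed.

Lemma circ_intD g h : continuous g -> continuous h ->
  circ_int (fun u => g u + h u) = circ_int g + circ_int h.
Proof.
move=> cg ch; have := @RintegralD _ _ _ _ _ _ _ _ (circ_integrable cg) (circ_integrable ch).
by apply; exact: measurable_itv.
Qed.

Lemma circ_intZ c g : continuous g -> circ_int (fun u => c * g u) = c * circ_int g.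
Proof.
move=> cg; have := @RintegralZl _ _ _ _ _ _ c _ (circ_integrable cg).
by apply; exact: measurable_itv.
Qed.

Lemma circ_int_le g h : continuous g -> continuous h -> (forall u, g u <= h u) ->
  circ_int g <= circ_int h.
Proof.
move=> cg ch gh; have := @le_Rintegral _ _ _ _ _ _ _ _ (circ_integrable cg) (circ_integrable ch).
by apply => [|t _]; [exact: measurable_itv|exact: gh].
Qed.

Lemma circ_int_eq g h : (forall u, g u = h u) -> circ_int g = circ_int h.
Proof. by move=> gh; apply: eq_Rintegral => t _; exact: gh. Qed.

Lemma circ_periodic t : circ (t + pi *+ 2) = circ t.
Proof. by rewrite /circ cosD2pi sinD2pi. Qed.

Lemma pi2_gt0 : 0 < pi *+ 2 :> R.
Proof. by rewrite pmulrn_lgt0 // pi_gt0. Qed.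

Lemma circ_int_gt0 g u : continuous g -> (forall u, 0 <= g u) -> dot u u = 1 -> 0 < g u ->
  0 < circ_int g.
Proof.
move=> cg g0 /circ_surj[t /andP[t0 t1] ->] gt.
have cgc : continuous (g \o circ).
  by move=> s; apply: continuous_comp; [exact: circ_continuous|exact: cg].
have p0 := pi_gt0 R; have p2 : pi *+ 2 = pi + pi :> R by rewrite mulr2n.
have [h|h] := lerP 0 t.
  apply: (@integral_cont_gt0 _ _ 0 (pi *+ 2) t cgc (fun s => g0 (circ s)) pi2_gt0) => //.
  by rewrite h p2; lra.
apply: (@integral_cont_gt0 _ _ 0 (pi *+ 2) (t + pi *+ 2) cgc (fun s => g0 (circ s)) pi2_gt0).
  by rewrite p2; lra.
by rewrite /= circ_periodic.
Qed.

Definition circ_cst : R := circ_int (fun u => `|dot u (pt 1 0)|).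

Lemma abs_dot_continuous v : continuous (fun u => `|dot u v|).
Proof.
have -> : (fun u => `|dot u v|) = (fun u => `|dot v u|) by apply/funext => u; rewrite dotC.
move=> u; apply: continuous_comp; first exact: dot_continuous.
exact: norm_continuous.
Qed.

Lemma circ_cst_gt0 : 0 < circ_cst.
Proof.
apply: (@circ_int_gt0 _ (pt 1 0)); first exact: abs_dot_continuous.
- by move=> u; exact: normr_ge0.
- by rewrite /dot !pt0 !pt1; ring.
- by rewrite /dot !pt0 !pt1 mulr1 mulr0 addr0 normr1.
Qed.

(* By rotation invariance. *)
Lemma circ_int_abs_dot v : circ_int (fun u => `|dot u v|) = circ_cst * nrm v.
Proof.
have [->|v0] := eqVneq v 0.
  rewrite nrm0 mulr0 -(mul0r (circ_int (fun u => `|dot u 0|))) -circ_intZ; last exact: abs_dot_continuous.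
  by apply: circ_int_eq => u; rewrite dot0r normr0 mul0r.
have n0 : nrm v != 0 by rewrite nrm_eq0.
have [|t _ et] := @circ_surj ((nrm v)^-1 *: v).
  by rewrite dotZl dotZr -sqr_nrm; field.
have ev : v = nrm v *: circ t by rewrite -et scalerA divff // scale1r.
rewrite mulrC {1}ev.
have e u : `|dot u (nrm v *: circ t)| = nrm v * `|dot u (circ t)|.
  by rewrite dotZr normrM ger0_norm ?nrm_ge0.
rewrite (circ_int_eq e) circ_intZ; last exact: abs_dot_continuous.
congr (_ * _); rewrite /circ_cst /circ_int.
have cc : continuous (fun x : R => `|cos x|).
  by move=> x; apply: continuous_comp; [exact: continuous_cos|exact: norm_continuous].
have := @periodic_integral_shift R (fun x => `|cos x|) (pi *+ 2) (- t) pi2_gt0 cc (fun x => congr1 Num.norm (cosD2pi x)).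
have e1 s : `|dot (circ s) (circ t)| = `|cos (s + - t)|.
  by rewrite cosB /dot !pt0 !pt1.
have e2 s : `|dot (circ s) (pt 1 0)| = `|cos s|.
  by rewrite /dot !pt0 !pt1 mulr1 mulr0 addr0.
move=> e3; transitivity (\int[mu]_(t0 in `[0, (pi *+ 2)]) `|cos (t0 + - t)|).
  by apply: eq_Rintegral => s _; exact: e1.
by rewrite e3; apply: eq_Rintegral => s _; rewrite e2.
Qed.

End CircleIntegral.

(** * Support function and width *)

Section Width.
Context {R : realType}.
Notation point := 'rV[R]_2.
Implicit Types (u v w x y z : point) (s : seq point) (r : R).

Lemma nrm_continuous : continuous (@nrm R).
Proof.
have h i : continuous (fun v : point => v 0 i * v 0 i).
  by move=> v; apply: (@continuousM _ _ (fun v : point => v 0 i) (fun v : point => v 0 i)); exact: coord_continuous.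
move=> v; apply: (@continuous_comp _ _ _ (fun v => dot v v) Num.sqrt); last exact: sqrt_continuous.
by apply: (@continuousD _ _ _ (fun v : point => v 0 0 * v 0 0) (fun v : point => v 0 1 * v 0 1)); exact: h.
Qed.

Lemma lipschitz_continuous (g : point -> R) M :
  (forall u v, `|g u - g v| <= M * nrm (u - v)) -> continuous g.
Proof.
move=> h u; have [_ c] := @cvgrPdist_lt R R^o _ (nbhs u) _ g (g u); apply: c => e e0.
have cn : {for u, continuous (fun v => M * nrm (u - v))}.
  apply: (@continuousM _ _ (fun=> M) (fun v => nrm (u - v))); first exact: cst_continuous.
  apply: (@continuous_comp _ _ _ (fun v => u - v) (@nrm R)); last exact: nrm_continuous.
  by apply: (@continuousB _ _ _ (fun=> u) id); [exact: cst_continuous|move=> ?; exact: cvg_id].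
have h0 : M * nrm (u - u) < e by rewrite subrr nrm0 mulr0.
near=> v; apply: le_lt_trans (h u v) _; near: v.
exact: (cvgr_lt _ cn _ h0).
Unshelve. all: by end_near.
Qed.

Variable K : set point.
Hypothesis cK : compact K.
Variables (k0 : point) (Kk0 : K k0).

Definition supp u : R := sup [set dot u k | k in K].

Lemma compact_argmax (g : point -> R) : continuous g ->
  exists2 z, K z & forall z', K z' -> g z' <= g z.
Proof.
move=> cg; have [||z] := @compact_EVT_max _ _ g K _ cK; first by exists k0.
  exact: continuous_subspaceT.
by rewrite inE => Kz h; exists z => // z' Kz'; apply: h; rewrite inE.
Qed.

Lemma suppP u : exists2 k, K k & supp u = dot u k /\ forall k', K k' -> dot u k' <= supp u.
Proof.
have [k Kk hk] := @compact_argmax (dot u) (@dot_continuous _ u).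
suff e : supp u = dot u k by exists k => //; rewrite e.
apply/eqP; rewrite eq_le; apply/andP; split.
  by apply: ge_sup; [exists (dot u k), k|move=> _ [k' Kk' <-]; exact: hk].
by apply: ub_le_sup; [exists (dot u k) => _ [k' Kk' <-]; exact: hk|exists k].
Qed.

Lemma supp_ge u k : K k -> dot u k <= supp u.
Proof. by move=> Kk; have [k' _ [_ ->]] := suppP u. Qed.

Lemma compact_nrm_bound : exists2 M, 0 < M & forall k, K k -> nrm k <= M.
Proof.
have [z Kz hz] := compact_argmax nrm_continuous.
by exists (nrm z + 1) => [|k /hz h]; [rewrite ltr_wpDl ?nrm_ge0|rewrite ler_wpDr].
Qed.

Lemma supp_continuous : continuous supp.
Proof.
have [M M0 hM] := compact_nrm_bound.
have h u v : supp u - supp v <= M * nrm (u - v).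
  have [k Kk [-> _]] := suppP u; apply: le_trans (_ : dot (u - v) k <= _).
    by rewrite dotBl lerD2l lerN2 supp_ge.
  by apply: le_trans (dot_le_nrm _ _) _; rewrite mulrC ler_wpM2r ?nrm_ge0 ?hM.
apply: (@lipschitz_continuous _ M) => u v; rewrite ler_norml h andbT lerNl opprB.
by rewrite -[u - v]opprB nrmN h.
Qed.

Definition width u : R := supp u + supp (- u).

Lemma width_continuous : continuous width.
Proof.
move=> u; apply: (@continuousD _ _ _ supp (fun u => supp (- u))); first exact: supp_continuous.
apply: (@continuous_comp _ _ _ (fun u => - u) supp); last exact: supp_continuous.
by apply: (@continuousN _ _ _ id) => ?; exact: cvg_id.
Qed.

Lemma widthP u : exists k k', [/\ K k, K k' & width u = dot u k - dot u k'].
Proof.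
have [k Kk [e1 _]] := suppP u; have [k' Kk' [e2 _]] := suppP (- u).
by exists k, k'; split => //; rewrite /width e1 e2 dotNl.
Qed.

Lemma width_ge u k k' : K k -> K k' -> dot u k - dot u k' <= width u.
Proof.
by move=> Kk Kk'; apply: lerD; [exact: supp_ge|rewrite -dotNl; exact: supp_ge].
Qed.

(* Cauchy's formula: the perimeter is the integral of the width over half a turn; [circ_cst] is the
   integral of [|cos|] over a period, that is 4. *)
Definition cauchy_per : R := 2 * circ_int width / @circ_cst R.

End Width.

Section CauchyBounds.
Context {R : realType}.
Notation point := 'rV[R]_2.
Notation dist := (@eucl_dist R).
Implicit Types (u v w x y z : point) (s : seq point) (r : R) (L : seq (R * point)).

(** A formal combination of vectors, weight first. Negative weights let distances be subtracted on
    both sides of Cauchy's formula. *)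
Definition dotsum L u : R := \sum_(p <- L) p.1 * `|dot u p.2|.
Definition nrmsum L : R := \sum_(p <- L) p.1 * nrm p.2.

Fixpoint edges x s : seq (R * point) := if s is y :: s' then (1, y - x) :: edges y s' else [::].

Lemma dotsum_cons p L u : dotsum (p :: L) u = p.1 * `|dot u p.2| + dotsum L u.
Proof. by rewrite /dotsum big_cons. Qed.
Lemma nrmsum_cons p L : nrmsum (p :: L) = p.1 * nrm p.2 + nrmsum L.
Proof. by rewrite /nrmsum big_cons. Qed.
Lemma dotsum_nil u : dotsum [::] u = 0. Proof. exact: big_nil. Qed.
Lemma nrmsum_nil : nrmsum [::] = 0. Proof. exact: big_nil. Qed.

Definition fvar u x s : R := tot (@absd R) (dot u x) (map (dot u) s).

Lemma dotsum_edges x s L u : dotsum (edges x s ++ L) u = fvar u x s + dotsum L u.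
Proof.
elim: s x => [|y s ih] x /=; first by rewrite add0r.
by rewrite dotsum_cons ih mul1r addrA dotBr distrC.
Qed.
Lemma nrmsum_edges x s L : nrmsum (edges x s ++ L) = tot dist x s + nrmsum L.
Proof.
elim: s x => [|y s ih] x /=; first by rewrite add0r.
by rewrite nrmsum_cons ih mul1r addrA distC distE.
Qed.

Lemma dotsum_continuous L : continuous (dotsum L).
Proof.
elim: L => [|p L ih] u.
  have -> : dotsum [::] = (fun=> 0) by apply/funext => v; rewrite dotsum_nil.
  exact: cst_continuous.
have -> : dotsum (p :: L) = (fun u => p.1 * `|dot u p.2| + dotsum L u).
  by apply/funext => v; rewrite dotsum_cons.
apply: (@continuousD _ _ _ (fun u => p.1 * `|dot u p.2|) (dotsum L)); last exact: ih.
apply: (@continuousM _ _ (fun=> p.1) (fun u => `|dot u p.2|)); first exact: cst_continuous.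
exact: abs_dot_continuous.
Qed.

Lemma circ_int_dotsum L : circ_int (dotsum L) = circ_cst * nrmsum L.
Proof.
elim: L => [|p L ih].
  rewrite nrmsum_nil mulr0 -(mul0r (circ_int (dotsum [::]))) -circ_intZ; last exact: dotsum_continuous.
  by apply: circ_int_eq => u; rewrite dotsum_nil mul0r.
have e u : dotsum (p :: L) u = p.1 * `|dot u p.2| + dotsum L u by rewrite dotsum_cons.
have c1 : continuous (fun u => p.1 * `|dot u p.2|).
  move=> u; apply: (@continuousM _ _ (fun=> p.1) (fun u => `|dot u p.2|)); first exact: cst_continuous.
  exact: abs_dot_continuous.
rewrite (circ_int_eq e) circ_intD //; last exact: dotsum_continuous.
rewrite ih circ_intZ; last exact: abs_dot_continuous.
by rewrite circ_int_abs_dot nrmsum_cons; ring.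
Qed.

Variable K : set point.
Hypothesis cK : compact K.
Variables (k0 : point) (Kk0 : K k0).

Let w2_continuous : continuous (fun u => 2 * width K u).
Proof.
move=> u; apply: (@continuousM _ _ (fun=> 2) (width K)); first exact: cst_continuous.
exact: (width_continuous cK Kk0).
Qed.

(** Integrate the bound over the circle; [circ_int_dotsum] turns projected lengths into lengths. *)
Lemma cauchy_per_le L : (forall u, 2 * width K u <= dotsum L u) -> cauchy_per K <= nrmsum L.
Proof.
move=> h; rewrite /cauchy_per ler_pdivrMr ?circ_cst_gt0 // mulrC [leRHS]mulrC -circ_int_dotsum mulrC.
rewrite -circ_intZ; last exact: (width_continuous cK Kk0).
by apply: circ_int_le h; [exact: w2_continuous|exact: dotsum_continuous].
Qed.

Lemma cauchy_per_ge L : (forall u, dotsum L u <= 2 * width K u) -> nrmsum L <= cauchy_per K.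
Proof.
move=> h; rewrite /cauchy_per ler_pdivlMr ?circ_cst_gt0 // mulrC -circ_int_dotsum.
rewrite -circ_intZ; last exact: (width_continuous cK Kk0).
by apply: circ_int_le h; [exact: dotsum_continuous|exact: w2_continuous].
Qed.

Lemma cauchy_per_le_path x s L : (forall u, 2 * width K u <= fvar u x s + dotsum L u) ->
  cauchy_per K <= tot dist x s + nrmsum L.
Proof. by rewrite -nrmsum_edges => h; apply: cauchy_per_le => u; rewrite dotsum_edges. Qed.

Lemma fvar_closed u x s v w : v \in x :: s -> w \in x :: s ->
  2 * absd (dot u v) (dot u w) <= fvar u x s + absd (dot u x) (dot u (last x s)).
Proof.
move=> vs ws; rewrite /fvar -[dot u (last x s)](last_map (dot u)).
by apply: closed_tour; rewrite -map_cons map_f.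
Qed.

End CauchyBounds.

(** * Width estimates for minimal polygons *)

Section Tips.
Context {R : realType}.
Notation point := 'rV[R]_2.
Implicit Types (u v w x y z A B P Q X T Y c n : point) (W s : seq point) (r t M kap : R).

(** Distance from the projection of [A] to the interval between the projections of [c] and [Y]. *)
Definition gap A c Y u : R :=
  (absd (dot u A) (dot u c) + absd (dot u A) (dot u Y) - absd (dot u c) (dot u Y)) / 2.

Lemma gap_ge0 A c Y u : 0 <= gap A c Y u.
Proof.
rewrite /gap divr_ge0 // subr_ge0 (absdC (dot u A) (dot u c)); exact: absdT.
Qed.

(* [A] sticks out of [Z] by [gap A c Y u] in direction [u] or [- u]. *)
Definition tip (Z : set point) A c Y := forall u,
  [\/ gap A c Y u = 0, forall z, Z z -> dot u A + gap A c Y u <= dot u z |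
      forall z, Z z -> dot u z + gap A c Y u <= dot u A].

Lemma tip_trivial Z A c : tip Z A c A.
Proof. by move=> u; apply: Or31; rewrite /gap absdxx addr0 absdC subrr mul0r. Qed.

Lemma tip_trivial' Z A Y : tip Z A A Y.
Proof. by move=> u; apply: Or31; rewrite /gap absdxx add0r subrr mul0r. Qed.

Lemma absd_le (x y : R) : x <= y -> absd x y = y - x.
Proof. by move=> h; rewrite absdC /absd ger0_norm // subr_ge0. Qed.

Lemma ortho_decomp e n w : e != 0 -> dot n n = 1 -> dot n e = 0 ->
  w = (dot w e / dot e e) *: e + dot w n *: n.
Proof.
move=> e0 n1 ne; have rn1 : dot (rot n) (rot n) = 1 by rewrite -n1 /dot !rot0 !rot1; ring.
have rn0 : rot n != 0 by apply/eqP => h; move: rn1; rewrite h dot0r => /esym/eqP; rewrite oner_eq0.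
have := cross0_colinear rn0 (w := e); rewrite rn1 divr1; set l := dot (rot n) e => h.
have el : e = l *: rot n by apply: h; rewrite -oppr0 -ne /cross /dot rot0 rot1; ring.
have l0 : l != 0 by apply: contraNneq e0 => l0; rewrite el l0 scale0r.
rewrite el !(dotZl, dotZr) rn1 scalerA.
have -> : l * dot w (rot n) / (l * (l * 1)) * l = dot w (rot n) by field.
clearbody l; move: n1; rewrite /dot rot0 rot1 => n1.
apply: pt_eq; rewrite !mxE /=.
  by rewrite -[LHS]mulr1 -n1; ring.
by rewrite -[LHS]mulr1 -n1; ring.
Qed.

(** [Z] lies in the half-strip with base from [c] to [c + M *: n] that runs in the direction
    [Q - A], while [A] lies behind the base. In each direction the half-strip projects into a ray
    bounded by an end of the projected base, and [A] is either outside that ray by the gap or has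
    gap 0. *)
Lemma tip_slab (Z : set point) A Q c n t M : Q != A -> 0 <= t -> c = mid t A Q ->
  dot n n = 1 -> dot n (Q - A) = 0 -> 0 <= M ->
  (forall z, Z z -> 0 <= dot (z - c) (Q - A) /\ 0 <= dot (z - A) n <= M) ->
  tip Z A c (c + M *: n).
Proof.
move=> QA t0 ec n1 nQ M0 hZ u.
have L0 : 0 < dot (Q - A) (Q - A) by rewrite dot_sq_gt0 // subr_eq0.
have eA : dot u A = dot u c - t * dot u (Q - A) by rewrite ec dot_mid dotBr; ring.
have eY : dot u (c + M *: n) = dot u c + M * dot u n by rewrite !dotE.
have ez z : dot u z = dot u c + dot (z - c) (Q - A) / dot (Q - A) (Q - A) * dot u (Q - A)
    + dot (z - A) n * dot u n.
  have -> : dot (z - A) n = dot (z - c) n.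
    by rewrite ec /mid /dot !mxE; have := nQ; rewrite /dot !mxE; nra.
  have e0 : Q - A != 0 by rewrite subr_eq0.
  by rewrite -addrA -!dotZr -!dotDr -ortho_decomp // addrC subrK.
have g0 := gap_ge0 A c (c + M *: n) u.
have low z : Z z -> 0 <= dot u (Q - A) -> Num.min (dot u c) (dot u (c + M *: n)) <= dot u z.
  move=> /hZ[h1 /andP[h2 h3]] ue; rewrite (ez z) eY ge_min.
  have : 0 <= dot (z - c) (Q - A) / dot (Q - A) (Q - A) * dot u (Q - A).
    by rewrite mulr_ge0 // divr_ge0 // ltW.
  have [un|un] := lerP 0 (dot u n).
    have : 0 <= dot (z - A) n * dot u n by rewrite mulr_ge0.
    by move=> ? ?; apply/orP; left; lra.
  have : 0 <= (M - dot (z - A) n) * - dot u n by rewrite mulr_ge0 //; lra.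
  by move=> ? ?; apply/orP; right; lra.
have high z : Z z -> dot u (Q - A) <= 0 -> dot u z <= Num.max (dot u c) (dot u (c + M *: n)).
  move=> /hZ[h1 /andP[h2 h3]] ue; rewrite (ez z) eY le_max.
  have : 0 <= dot (z - c) (Q - A) / dot (Q - A) (Q - A) * - dot u (Q - A).
    by rewrite mulr_ge0 ?oppr_ge0 // divr_ge0 // ltW.
  have [un|un] := lerP 0 (dot u n).
    have : 0 <= (M - dot (z - A) n) * dot u n by rewrite mulr_ge0 //; lra.
    by move=> ? ?; apply/orP; right; lra.
  have : 0 <= dot (z - A) n * - dot u n by rewrite mulr_ge0 //; lra.
  by move=> ? ?; apply/orP; left; lra.
rewrite /gap; move: low high; set Y := dot u (c + _) => low high.
have [ue|ue] := lerP 0 (dot u (Q - A)).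
  have Ac : dot u A <= dot u c.
    have : 0 <= t * dot u (Q - A) by rewrite mulr_ge0.
    by rewrite eA; lra.
  have [AY|YA] := lerP (dot u A) Y.
    apply: Or32 => z Zz; have := low z Zz ue; rewrite (absd_le Ac) (absd_le AY).
    rewrite ge_min; case: (lerP (dot u c) Y) => h; last by rewrite absdC (absd_le (ltW h)) => /orP[]; lra.
    by rewrite (absd_le h) => /orP[]; lra.
  apply: Or31; have Yc : Y <= dot u c by apply: le_trans (ltW YA) Ac.
  by rewrite (absd_le Ac) absdC (absd_le (ltW YA)) absdC (absd_le Yc); lra.
have Ac : dot u c <= dot u A.
  have : 0 <= t * - dot u (Q - A) by rewrite mulr_ge0 //; lra.
  by rewrite eA; lra.
have [YA|AY] := lerP Y (dot u A).
  apply: Or33 => z Zz; have := high z Zz (ltW ue).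
  rewrite (absdC (dot u A)) (absd_le Ac) (absdC (dot u A)) (absd_le YA).
  rewrite le_max; case: (lerP (dot u c) Y) => h; last by rewrite (absdC _ Y) (absd_le (ltW h)) => /orP[]; lra.
  by rewrite (absd_le h) => /orP[]; lra.
apply: Or31; have cY : dot u c <= Y by apply: le_trans Ac (ltW AY).
by rewrite (absdC (dot u A)) (absd_le Ac) (absd_le (ltW AY)) (absd_le cY); lra.
Qed.

Lemma sqr_half_sum (p q r : R) : 0 <= r -> 2 * r <= p + q -> 2 * r ^+ 2 <= p ^+ 2 + q ^+ 2.
Proof.
move=> r0 h; have : (2 * r) ^+ 2 <= (p + q) ^+ 2 by rewrite ler_pXn2r ?nnegrE //; lra.
by have := sqr_ge0 (p - q); nra.
Qed.

Lemma clamp_lipschitz (p q : R) : p <= q ->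
  Num.max 0 (Num.min 1 q) - Num.max 0 (Num.min 1 p) <= q - p.
Proof. by rewrite /Num.max /Num.min; repeat case: ifP; lra. Qed.

(** Factor [q ^+ 2 - p ^+ 2] and use [q + p <= 3 * M]. *)
Lemma leg_defect (p q r M : R) : 0 < M -> 0 <= p <= M -> 0 <= r -> q <= 2 * M -> 0 <= q -> p ^+ 2 + r ^+ 2 <= q ^+ 2 ->
  r ^+ 2 / (3 * M) <= q - p.
Proof.
move=> M0 /andP[p0 pM] r0 qM q0 h; rewrite ler_pdivrMr ?mulr_gt0 //.
have pq : p <= q by rewrite -(@ler_pXn2r _ 2) ?nnegrE //; have := sqr_ge0 r; lra.
have : 0 <= (q - p) * (3 * M - q - p) by rewrite mulr_ge0; lra.
lra.
Qed.

Variable K : set point.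
Hypothesis cK : compact K.
Variables (k0 : point) (Kk0 : K k0).

Lemma seq_argmax (T' : eqType) (g : T' -> R) (s : seq T') : s != [::] -> exists2 y : T', y \in s & {in s, forall z : T', g z <= g y}.
Proof.
elim: s => // x s ih _; have [->|s0] := eqVneq s [::].
  by exists x; rewrite ?mem_head // => z; rewrite inE => /eqP ->.
have [y ys hy] := ih s0; have [h|h] := lerP (g x) (g y).
  by exists y; rewrite ?in_cons ?ys ?orbT // => z; rewrite in_cons => /orP[/eqP ->|/hy].
exists x; rewrite ?mem_head // => z; rewrite in_cons => /orP[/eqP ->//|/hy hz].
exact: le_trans hz (ltW h).
Qed.

(* The two ends never stick out in the same direction, so both gaps add to the width. *)
Lemma width_tips A B cA YA cB YB (Z Z' : set point) u s :
  K `<=` Z -> K `<=` Z' -> Z B -> Z' A -> tip Z A cA YA -> tip Z' B cB YB -> covers s K ->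
  A \in s -> B \in s ->
  exists v w, [/\ v \in s, w \in s & width K u + gap A cA YA u + gap B cB YB u <= dot u v - dot u w].
Proof.
move=> KZ KZ' ZB ZA tA tB cs As Bs.
have [k [k' [Kk Kk' ->]]] := widthP cK Kk0 u.
have ex x u' : K x -> exists2 y, y \in s & dot u' x <= dot u' y.
  move=> Kx; have [y ys hy] := seq_argmax (dot u') (covers_neq_nil Kk0 cs).
  by exists y => //; apply: cs Kx => v /hy.
have [y ys hy] := ex _ u Kk; have [y' ys' hy'] := ex _ (- u) Kk'.
rewrite !dotNl lerN2 in hy'.
have gA := gap_ge0 A cA YA u; have gB := gap_ge0 B cB YB u.
have hA := tA u; have hB := tB u.
move: (gap A cA YA u) (gap B cB YB u) gA gB hA hB => a b a0 b0 hA hB.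
have aA : [\/ a = 0, (dot u A + a <= dot u k' /\ dot u A + a <= dot u B) |
    (dot u k + a <= dot u A /\ dot u B + a <= dot u A)].
  case: hA => h; [exact: Or31|apply: Or32|apply: Or33]; by split; apply: h => //; exact: KZ.
have aB : [\/ b = 0, (dot u B + b <= dot u k' /\ dot u B + b <= dot u A) |
    (dot u k + b <= dot u B /\ dot u A + b <= dot u B)].
  case: hB => h; [exact: Or31|apply: Or32|apply: Or33]; by split; apply: h => //; exact: KZ'.
case: aA => [a1|[a1 a2]|[a1 a2]]; case: aB => [b1|[b1 b2]|[b1 b2]].
- by exists y, y'; split => //; lra.
- by exists y, B; split => //; lra.
- by exists B, y'; split => //; lra.
- by exists y, A; split => //; lra.
- by exists y, A; split => //; lra.
- by exists B, A; split => //; lra.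
- by exists A, y'; split => //; lra.
- by exists A, B; split => //; lra.
- by exists A, y'; split => //; lra.
Qed.

End Tips.

(** * The gain at one end of a minimal polygon *)

Section BestEnd.
Context {R : realType}.
Notation point := 'rV[R]_2.
Notation dist := (@eucl_dist R).
Implicit Types (u v w x y z A B P Q T Y c n : point) (W s : seq point) (r t M kap : R).

Variable K : set point.
Hypothesis cK : compact K.
Variables (k0 : point) (Kk0 : K k0).
Variable M : R.
Hypothesis M_gt0 : 0 < M.

(** The unit normal of [AQ] on the side of [P]. *)
Definition normal A P Q : point :=
  - (cross (P - A) (Q - A) / (`|cross (P - A) (Q - A)| * nrm (Q - A))) *: rot (Q - A).

Lemma normalP A P Q : cross (P - A) (Q - A) != 0 ->
  [/\ dot (normal A P Q) (normal A P Q) = 1, dot (normal A P Q) (Q - A) = 0 &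
   forall z, dot (z - A) (normal A P Q) =
     al A P Q z * (`|cross (P - A) (Q - A)| / nrm (Q - A))].
Proof.
move=> D; have e0 : nrm (Q - A) != 0.
  by rewrite nrm_eq0; apply: contraNneq D => ->; rewrite crossC cross0l oppr0.
have d0 : `|cross (P - A) (Q - A)| != 0 by rewrite normr_eq0.
have d2 : `|cross (P - A) (Q - A)| ^+ 2 = cross (P - A) (Q - A) ^+ 2 by rewrite real_normK ?num_real.
rewrite /normal /al; move: (Q - A) D e0 d0 d2 => e; set D := cross (P - A) e => D0 e0 d0 d2.
have rr : dot (rot e) (rot e) = nrm e ^+ 2 by rewrite sqr_nrm /dot !rot0 !rot1; ring.
split.
- rewrite dotZl dotZr rr.
  have -> : - (D / (`|D| * nrm e)) * (- (D / (`|D| * nrm e)) * nrm e ^+ 2) = D ^+ 2 / `|D| ^+ 2.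
    by field; rewrite d0 e0.
  by rewrite d2 divff // sqrf_eq0.
- by rewrite dotZl -crossE cross_self mulr0.
- move=> z; rewrite dotZr dotC -crossE crossC.
  transitivity (cross (z - A) e * D / `|D| ^+ 2 * `|D| / nrm e); first by field; rewrite d0 e0.
  rewrite d2; field; by rewrite D0 e0.
Qed.

Lemma unit_height z A n (m : R) : dot n n = 1 -> dist z A <= m -> dot (z - A) n <= m.
Proof.
move=> n1 h; apply: le_trans (dot_le_nrm _ _) _.
by rewrite -distE (_ : nrm n = 1) ?mulr1 // /nrm n1 sqrtr1.
Qed.

Lemma dist_addZ c n : dot n n = 1 -> dist c (c + M *: n) = M.
Proof.
move=> n1; rewrite distC distE addrC addKr nrmZ gtr0_norm // (_ : nrm n = 1) ?mulr1 //.
by rewrite /nrm n1 sqrtr1.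
Qed.

(** The triangle with corners [A], [c] and [c + M *: n] has a right angle at [c], with legs |Ac| and
    [M]. *)
Lemma tip_defect A Q c n t : dot n n = 1 -> dot n (Q - A) = 0 -> c = mid t A Q -> dist A c <= M ->
  dist A c ^+ 2 / (3 * M) <= dist A (c + M *: n) - dist c (c + M *: n).
Proof.
move=> n1 nQ ec hM; apply: leg_defect; rewrite ?dist_ge0 ?dist_addZ ?lexx ?(ltW M_gt0) //.
  by have := dist_triangle c A (c + M *: n); rewrite dist_addZ //; lra.
rewrite -{1}(dist_addZ c n1) !sqr_dist ec /mid /dot !mxE.
have := nQ; rewrite /dot !mxE => h.
have : 0 = t * M * (n 0 0 * (Q 0 0 - A 0 0) + n 0 1 * (Q 0 1 - A 0 1)) by rewrite h mulr0.
lra.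
Qed.

Variable kap : R.
Hypotheses (kap_gt0 : 0 < kap) (kap_le : 10 * kap <= 1).

(** The two differences on the right compare the long with the short sides of two triangles: at [c]
    the angle between [a] and [Q] is not acute and that between [A] and [Y] is right. They control
    the squares of |ac| and |Ac|, hence that of |Aa|; the term in [kap] covers the case of the
    trivial tip. *)
Lemma best_end A0 B0 A P s : is_best K kap A0 B0 (A :: P :: s) -> s != [::] ->
  (forall x y, x \in A :: P :: s \/ K x -> y \in A :: P :: s \/ K y -> dist x y <= M) ->
  exists Q a c Y, [/\ Q \in s, cross (P - A) (Q - A) != 0,
    {in s, forall v, 0 <= al A P Q v},
    [/\ K a, inhull a A P Q & exists2 t, 0 <= t <= 1 & c = mid t A Q] &
    tip [set z | K z \/ z = last P s] A c Y /\
    dist A a ^+ 2 / (6 * M) - 6 * kap * M <= dist a Q - dist c Q + dist A Y - dist c Y].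
Proof.
move=> hb sn hM.
have [Q [r [T [t [Qs D hQ hK [r01 hr KT t01 eT]]]]]] := best_touch cK Kk0 kap_gt0 kap_le hb sn.
have Bs : last P s \in s by case: s sn {hb hM Qs hQ} => // x s _; rewrite /= mem_last.
have [B0' B1 B2] := hQ _ Bs.
have [a [s0 [Ka ha s01 pyth hs0]]] := end_geometry cK Kk0 D r01 hK B0' (ltW B1) B2 KT t01 eT.
set c := mid s0 A Q in pyth hs0.
have inA : A \in A :: P :: s by rewrite mem_head.
have inP : P \in A :: P :: s by rewrite !in_cons eqxx orbT.
have inQ : Q \in A :: P :: s by rewrite !in_cons Qs !orbT.
have AQM : dist A Q <= M by apply: hM; left.
have /andP[s00 s1] := s01.
have Ac : dist A c = s0 * dist A Q by rewrite dist_mid_l.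
have AcM : dist A c <= M by rewrite Ac; apply: le_trans AQM; rewrite ler_piMl ?dist_ge0.
have cQM : dist c Q <= M.
  by rewrite dist_mid_r //; apply: le_trans AQM; rewrite ler_piMl ?dist_ge0 //; lra.
have aQM : dist a Q <= M by apply: hM; [right|left].
have M0 := M_gt0.
have h1 : dist a c ^+ 2 / (3 * M) <= dist a Q - dist c Q.
  by apply: leg_defect; rewrite ?dist_ge0 ?cQM //; lra.
have Aa : dist A a ^+ 2 <= 2 * dist A c ^+ 2 + 2 * dist a c ^+ 2.
  have h : dist A a ^+ 2 <= (dist A c + dist a c) ^+ 2.
    by rewrite ler_pXn2r ?nnegrE ?addr_ge0 ?dist_ge0 // (distC a) dist_triangle.
  have := sqr_ge0 (dist A c - dist a c); nra.
have Aa6 : dist A a ^+ 2 / (6 * M) <= dist A c ^+ 2 / (3 * M) + dist a c ^+ 2 / (3 * M).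
  rewrite -mulrDl ler_pdivrMr ?mulr_gt0 //.
  have -> : (dist A c ^+ 2 + dist a c ^+ 2) / (3 * M) * (6 * M) = 2 * dist A c ^+ 2 + 2 * dist a c ^+ 2.
    by field; lra.
  exact: Aa.
have kM : 0 < kap * M by rewrite mulr_gt0.
(* For [s0 = r] the foot [c] is within [4 * kap * M] of [A]. The trivial tip [Y = A] loses this
   much, and the square of |Ac| that it does not provide is worth at most [4 / 3 * kap * M];
   together this is below [6 * kap * M]. *)
have [rs|hz] := hs0.
  exists Q, a, c, A; split => //; first by move=> v /hQ[].
    by split => //; exists s0.
  split; first exact: tip_trivial.
  rewrite distxx (distC c A).
  have APM : dist A P <= M by apply: hM; left.
  have c1 : dist A c <= 4 * kap * M.
    rewrite Ac rs; apply: le_trans hr _; rewrite ler_pM2l // mulr_gt0 //.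
  have c2 : dist A c ^+ 2 / (3 * M) <= 4 / 3 * kap * M.
    rewrite ler_pdivrMr ?mulr_gt0 // expr2.
    have -> : 4 / 3 * kap * M * (3 * M) = (4 * kap * M) * M by field.
    by apply: ler_pM; rewrite ?dist_ge0.
  lra.
have [n1 nQ nz] := normalP D; set n := normal A P Q in n1 nQ nz.
have hpos z : 0 <= al A P Q z -> 0 <= dot (z - A) n.
  by move=> h; rewrite nz mulr_ge0 // divr_ge0 ?nrm_ge0.
exists Q, a, c, (c + M *: n); split => //; first by move=> v /hQ[].
  by split => //; exists s0.
split.
  apply: (@tip_slab _ _ _ Q _ _ s0) => //.
  - by apply: contraNneq D => ->; rewrite subrr crossC cross0l oppr0.
  - exact: ltW.
  move=> z /= Zz; split; first exact: hz.
  case: Zz => [Kz|->].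
    rewrite hpos ?unit_height //; last by have [] := hK _ Kz.
    by apply: hM; [right|left].
  rewrite hpos // unit_height //; apply: hM; left => //.
  by rewrite !in_cons Bs !orbT.
have h2 := tip_defect n1 nQ (erefl : c = mid s0 A Q) AcM.
lra.
Qed.

End BestEnd.

(** * Polygons on one side of the line through their ends *)

Section OneSided.
Context {R : realType}.
Notation point := 'rV[R]_2.
Notation dist := (@eucl_dist R).
Implicit Types (u v w x y z A B P Q T Y c n : point) (W s : seq point) (r t M kap : R).

Variable K : set point.
Hypothesis cK : compact K.
Variables (k0 : point) (Kk0 : K k0).
Variable M : R.
Hypothesis M_gt0 : 0 < M.

Variable d : R.
Hypothesis hd : forall k k', K k -> K k' -> dist k k' <= d.

(** [c] and [c'] delimit the part of AB that lies under [K]. The overhangs Ac and c'B stick out of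
    the strip over cc', so the gaps cancel them in the closing edge. Since |cc'| is at most [d],
    they have total length at least [2 * r], and the right triangles at [c] and [c'] turn this into
    the gain. *)
Lemma one_sided_bound A s n r : covers (A :: s) K -> A != last A s ->
  (forall x y, x \in A :: s \/ K x -> y \in A :: s \/ K y -> dist x y <= M) ->
  dot n n = 1 -> dot n (last A s - A) = 0 -> {in s, forall v, 0 <= dot (v - A) n} ->
  0 <= r -> d + 2 * r <= dist A (last A s) ->
  cauchy_per K <= tot dist A s + d - r ^+ 2 / (3 * M).
Proof.
set B := last A s => cs AB hM n1 nB hn r0 hr.
have Bs : B \in A :: s by exact: mem_last.
have As : A \in A :: s by exact: mem_head.
pose e := B - A; have e0 : e != 0 by rewrite subr_eq0 eq_sym.
have L0 : 0 < dot e e by exact: dot_sq_gt0.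
have ABM : dist A B <= M by apply: hM; left.
have hnK z : K z -> 0 <= dot (z - A) n.
  pose g z := dot (z - A) n.
  have ag : affine_fun g by exists n, (- dot A n) => v; rewrite /g dotBl (dotC v) addrC.
  by move: z; apply: (covers_affine cs ag) => v; rewrite in_cons => /orP[/eqP ->|/hn //]; rewrite /g subrr dot0l.
have [k1 Kk1 [e1 h1]] := suppP cK Kk0 (- e).
have [k2 Kk2 [e2 h2]] := suppP cK Kk0 e.
pose x z := dot e z - dot e A.
have hx1 z : K z -> x k1 <= x z by move=> /h1; rewrite e1 !dotNl /x; lra.
have hx2 z : K z -> x z <= x k2 by move=> /h2; rewrite e2 /x; lra.
(* Positions on the line AB are clamped to the segment. Clamping does not increase distances, so
   |cc'| is at most the extent of [K] along AB and thus at most [d]. *)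
pose cl (y : R) := Num.max 0 (Num.min 1 (y / dot e e)).
have cl01 (y : R) : 0 <= cl y <= 1.
  by rewrite le_max lexx /= ge_max ler01 ge_min lexx.
have clmono : cl (x k1) <= cl (x k2).
  have h : x k1 / dot e e <= x k2 / dot e e by rewrite ler_pM2r ?invr_gt0 // hx1.
  rewrite /cl ge_max le_max lexx /= le_max; apply/orP; right.
  by rewrite le_min !ge_min lexx h orbT.
have cl_lip : (cl (x k2) - cl (x k1)) * dot e e <= x k2 - x k1.
  have h : x k1 / dot e e <= x k2 / dot e e by rewrite ler_pM2r ?invr_gt0 // hx1.
  rewrite -ler_pdivlMr // mulrBl; exact: clamp_lipschitz.
set t1 := cl (x k1) in clmono cl_lip; set t2 := cl (x k2) in clmono cl_lip.
have /andP[t10 t11] := cl01 (x k1); have /andP[t20 t21] := cl01 (x k2).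
rewrite -/t1 in t10 t11; rewrite -/t2 in t20 t21.
pose c := mid t1 A B; pose c' := mid t2 A B.
have ec' : c' = mid (1 - t2) B A by apply: pt_eq; rewrite !mxE; ring.
have M0 := M_gt0.
have hh z : (K z \/ z = A \/ z = B) -> 0 <= dot (z - A) n <= M.
  move=> hz; have zd : dist z A <= M.
    by case: hz => [Kz|[->|->]]; apply: hM; auto.
  rewrite unit_height // andbT; case: hz => [/hnK //|[->|->]]; first by rewrite subrr dot0l.
  by rewrite dotC nB.
have tA : tip [set z | K z \/ z = B] A c (c + M *: n).
  have [h|tn] := eqVneq t1 0; first by rewrite /c h mid0; exact: tip_trivial'.
  apply: (@tip_slab _ _ _ B _ _ t1) => //; [by rewrite eq_sym|exact: ltW|].
  have tx : t1 <= x k1 / dot e e.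
    have : 0 < t1 by rewrite lt0r tn.
    by rewrite /t1 /cl lt_max ltxx /= => h; rewrite ge_max ge_min lexx orbT andbT; move: h; rewrite lt_min => /andP[_ /ltW].
  rewrite ler_pdivlMr // in tx.
  move=> z /= Zz; split; last by apply: hh; case: Zz => [?|->]; auto.
  have -> : dot (z - c) (B - A) = x z - t1 * dot e e.
    by rewrite /c /mid /x /e /dot !mxE; ring.
  case: Zz => [/hx1|->]; first lra.
  have -> : x B = dot e e by rewrite /x -dotBr.
  have : 0 <= (1 - t1) * dot e e by rewrite mulr_ge0 ?subr_ge0 ?(ltW L0).
  lra.
have nB' : dot n (A - B) = 0 by rewrite -opprB dotNr nB oppr0.
have tB : tip [set z | K z \/ z = A] B c' (c' + M *: n).
  have [h|tn] := eqVneq t2 1; first by rewrite /c' h mid1; exact: tip_trivial'.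
  apply: (@tip_slab _ _ _ A _ _ (1 - t2)) => //; [by rewrite subr_ge0|exact: ltW|].
  have tx : x k2 / dot e e <= t2.
    have : t2 < 1 by rewrite lt_neqAle tn.
    by rewrite /t2 /cl gt_max gt_min ltxx /= => /andP[_ h]; rewrite le_max le_min lexx (ltW h) orbT.
  rewrite ler_pdivrMr // in tx.
  move=> z /= Zz; split.
    have -> : dot (z - c') (A - B) = t2 * dot e e - x z.
      by rewrite /c' /mid /x /e /dot !mxE; ring.
    case: Zz => [/hx2|->]; first lra.
    by rewrite /x subrr subr0 mulr_ge0 // ltW.
  have -> : dot (z - B) n = dot (z - A) n.
    have := nB; rewrite /dot !mxE; lra.
  by apply: hh; case: Zz => [?|->]; auto.
have hfin u : 2 * width K u <= fvar u A s + dotsum [:: (1, c - c'); (1, c - (c + M *: n));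
     (-1, A - (c + M *: n)); (1, c' - (c' + M *: n)); (-1, B - (c' + M *: n))] u.
  have [v [w [vs ws hw]]] := width_tips cK Kk0 u (fun z Kz => or_introl Kz) (fun z Kz => or_introl Kz)
    (or_intror erefl) (or_intror erefl) tA tB cs As Bs.
  have hc := @fvar_closed _ u A s v w vs ws.
  rewrite !dotsum_cons dotsum_nil /= !dotBr.
  have hvw : dot u v - dot u w <= absd (dot u v) (dot u w) by exact: ler_norm.
  have hAB : absd (dot u A) (dot u B) = absd (dot u A) (dot u c) + absd (dot u c) (dot u c') + absd (dot u B) (dot u c').
    rewrite /c /c' !dot_mid /absd; set p := dot u A; set q := dot u B.
    have -> : p - ((1 - t1) * p + t1 * q) = t1 * (p - q) by ring.
    have -> : (1 - t1) * p + t1 * q - ((1 - t2) * p + t2 * q) = (t2 - t1) * (p - q) by ring.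
    have -> : q - ((1 - t2) * p + t2 * q) = - ((1 - t2) * (p - q)) by ring.
    have q1 : 0 <= t2 - t1 by rewrite subr_ge0.
    have q2 : 0 <= 1 - t2 by rewrite subr_ge0.
    by rewrite normrN !normrM (ger0_norm t10) (ger0_norm q1) (ger0_norm q2); ring.
  move: hw hc hvw; rewrite -/B hAB /gap /absd; lra.
have := cauchy_per_le_path cK Kk0 hfin.
rewrite !nrmsum_cons nrmsum_nil /= -!distE.
have eAc : dist A c = t1 * dist A B by rewrite dist_mid_l.
have eBc : dist B c' = (1 - t2) * dist A B by rewrite ec' dist_mid_l ?subr_ge0 // distC.
have ecc : dist c c' = (t2 - t1) * dist A B.
  rewrite /c /c' distE (distC A) distE.
  have -> : mid t1 A B - mid t2 A B = - ((t2 - t1) *: (B - A)) by apply: pt_eq; rewrite !mxE; ring.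
  by rewrite nrmN nrmZ ger0_norm // subr_ge0.
have AcM : dist A c <= M by rewrite eAc; apply: le_trans ABM; rewrite ler_piMl ?dist_ge0.
have BcM : dist B c' <= M by rewrite eBc; apply: le_trans ABM; rewrite ler_piMl ?dist_ge0 //; lra.
have g1 := tip_defect M0 n1 nB (erefl : c = mid t1 A B) AcM.
have g2 := tip_defect M0 n1 nB' ec' BcM.
have ccd : dist c c' <= d.
  rewrite ecc; apply: le_trans (hd Kk2 Kk1).
  have ne : 0 < nrm e by rewrite nrm_gt0.
  have -> : dist A B = nrm e by rewrite distC distE.
  rewrite -(ler_pM2r ne) -mulrA -expr2 sqr_nrm; apply: le_trans cl_lip _.
  have -> : x k2 - x k1 = dot e (k2 - k1) by rewrite dotBr /x; ring.
  by apply: le_trans (dot_le_nrm _ _) _; rewrite -distE mulrC.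
have sq : 2 * r ^+ 2 <= dist A c ^+ 2 + dist B c' ^+ 2.
  by apply: sqr_half_sum => //; rewrite eAc eBc; rewrite ecc in ccd; lra.
have : r ^+ 2 / (3 * M) <= dist A c ^+ 2 / (3 * M) + dist B c' ^+ 2 / (3 * M).
  rewrite -mulrDl ler_pM2r ?invr_gt0 ?mulr_gt0 //; apply: le_trans sq.
  by rewrite ler_peMl ?sqr_ge0 // ler1n.
lra.
Qed.

End OneSided.

(** * The perimeter bound for minimal polygons *)

Section BestBound.
Context {R : realType}.
Notation point := 'rV[R]_2.
Notation dist := (@eucl_dist R).
Implicit Types (u v w x y z A B P Q T Y c n : point) (W s : seq point) (r t M kap : R).

Variable K : set point.
Hypothesis cK : compact K.
Variables (k0 : point) (Kk0 : K k0).
Variable M : R.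
Hypothesis M_gt0 : 0 < M.
Variable kap : R.
Hypotheses (kap_gt0 : 0 < kap) (kap_le : 10 * kap <= 1).
Variable d : R.
Hypothesis hd : forall k k', K k -> K k' -> dist k k' <= d.

Lemma inhull_between u a A P Q : inhull a A P Q ->
  Num.min (dot u A) (Num.min (dot u P) (dot u Q)) <= dot u a <=
  Num.max (dot u A) (Num.max (dot u P) (dot u Q)).
Proof.
move=> [b [c [b0 c0 bc ->]]]; rewrite !dotE.
set p := dot u A; set q := dot u P; set r := dot u Q.
have [m1 m2 m3] : [/\ Num.min p (Num.min q r) <= p, Num.min p (Num.min q r) <= q & Num.min p (Num.min q r) <= r].
  by rewrite !ge_min !lexx !orbT.
have [l1 l2 l3] : [/\ p <= Num.max p (Num.max q r), q <= Num.max p (Num.max q r) & r <= Num.max p (Num.max q r)].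
  by rewrite !le_max !lexx !orbT.
move: (Num.min _ _) (Num.max _ _) m1 m2 m3 l1 l2 l3 => m l m1 m2 m3 l1 l2 l3.
have : 0 <= (1 - b - c) * (p - m) by rewrite mulr_ge0; lra.
have : 0 <= b * (q - m) by rewrite mulr_ge0; lra.
have : 0 <= c * (r - m) by rewrite mulr_ge0; lra.
have : 0 <= (1 - b - c) * (l - p) by rewrite mulr_ge0; lra.
have : 0 <= b * (l - q) by rewrite mulr_ge0; lra.
have : 0 <= c * (l - r) by rewrite mulr_ge0; lra.
lra.
Qed.

Lemma absd_mid u t A Q : 0 <= t <= 1 ->
  absd (dot u A) (dot u Q) = absd (dot u A) (dot u (mid t A Q)) + absd (dot u (mid t A Q)) (dot u Q).
Proof.
move=> /andP[t0 t1]; rewrite dot_mid /absd; set p := dot u A; set q := dot u Q.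
have -> : p - ((1 - t) * p + t * q) = t * (p - q) by ring.
have -> : (1 - t) * p + t * q - q = (1 - t) * (p - q) by ring.
have s1 : 0 <= 1 - t by lra.
by rewrite !normrM (ger0_norm t0) (ger0_norm s1); ring.
Qed.

(** In each direction [diamond] and [width_tips] are added. The foot [cA] splits |AQ| into |A cA|
    and |cA Q|; the first part cancels against the gap at [A]. The same happens at [B]. *)
Lemma two_ended_bound A P F B Q E a b cA cB YA YB mid0 tA tB :
  let s := A :: P :: mid0 ++ [:: F; B] in
  covers s K -> Q \in rcons mid0 F -> E \in P :: mid0 -> inhull a A P Q -> inhull b B F E ->
  0 <= tA <= 1 -> cA = mid tA A Q -> 0 <= tB <= 1 -> cB = mid tB B E ->
  tip [set z | K z \/ z = B] A cA YA -> tip [set z | K z \/ z = A] B cB YB ->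
  cauchy_per K <= plen s + dist a b
    - (dist a Q - dist cA Q + dist A YA - dist cA YA)
    - (dist b E - dist cB E + dist B YB - dist cB YB).
Proof.
move=> s cs hQ hE ha hb tA01 eA tB01 eB tipA tipB.
have As : A \in s by rewrite mem_head.
have Bs : B \in s by rewrite !in_cons mem_cat !in_cons eqxx !orbT.
have hfin u : 2 * width K u <= fvar u A (P :: mid0 ++ [:: F; B]) + dotsum
   [:: (1, a - b); (-1, a - Q); (1, cA - Q); (-1, A - YA); (1, cA - YA);
       (-1, b - E); (1, cB - E); (-1, B - YB); (1, cB - YB)] u.
  have [v [w [vs ws hw]]] := width_tips cK Kk0 u (fun z Kz => or_introl Kz) (fun z Kz => or_introl Kz)
    (or_intror erefl) (or_intror erefl) tipA tipB cs As Bs.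
  rewrite !dotsum_cons dotsum_nil /= !dotBr.
  have hvw : dot u v - dot u w <= absd (dot u v) (dot u w) by exact: ler_norm.
  have fm : map (dot u) (P :: mid0 ++ [:: F; B]) = dot u P :: map (dot u) mid0 ++ [:: dot u F; dot u B].
    by rewrite /= map_cat.
  have hb' : inhull b B E F.
    by case: hb => [x [y [x0 y0 xy e]]]; exists y, x; split => //; [by rewrite addrC|by rewrite addrAC].
  have hQ' : dot u Q \in rcons (map (dot u) mid0) (dot u F) by rewrite -map_rcons map_f.
  have hE' : dot u E \in dot u P :: map (dot u) mid0 by rewrite -map_cons map_f.
  have hv' : dot u v \in dot u A :: dot u P :: map (dot u) mid0 ++ [:: dot u F; dot u B].
    by rewrite -fm -map_cons map_f.
  have hw' : dot u w \in dot u A :: dot u P :: map (dot u) mid0 ++ [:: dot u F; dot u B].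
    by rewrite -fm -map_cons map_f.
  have := diamond hQ' hE' (inhull_between u ha) (inhull_between u hb') hv' hw'.
  rewrite -fm /fvar; set N := tot _ _ _.
  have := absd_mid u A Q tA01; rewrite -eA; have := absd_mid u B E tB01; rewrite -eB.
  move: hw hvw; rewrite /gap /absd; lra.
have := cauchy_per_le_path cK Kk0 hfin.
have -> : plen s = tot dist A (P :: mid0 ++ [:: F; B]) by [].
by rewrite !nrmsum_cons nrmsum_nil -!distE; move: (tot _ _ _) => N /=; lra.
Qed.

(** In the two-ended case [a] and [b] are at most [d] apart, so |Aa| + |Bb| is at least [2 * r]; the
    squares give the gain, and each end contributes an error [6 * kap * M]. *)
Lemma best_bound A0 B0 A s r : is_best K kap A0 B0 (A :: s) ->
  (forall x y, x \in A :: s \/ K x -> y \in A :: s \/ K y -> dist x y <= M) ->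
  0 <= r -> 0 < dist A (last A s) -> d + 2 * r <= dist A (last A s) ->
  cauchy_per K <= tot dist A s + d + 12 * kap * M - r ^+ 2 / (6 * M).
Proof.
move=> hb hM r0; rewrite dist_gt0 => AB hr.
have [hc _] := hb.
have M0 := M_gt0; have k0p := kap_gt0.
have kM : 0 < kap * M by rewrite mulr_gt0.
have rM : r ^+ 2 / (3 * M) = 2 * (r ^+ 2 / (6 * M)) by field; lra.
have rM0 : 0 <= r ^+ 2 / (6 * M) by rewrite divr_ge0 ?sqr_ge0 // mulr_ge0 // ltW.
case: s hb hM AB hr hc => [|P s] hb hM AB hr hc; first by rewrite eqxx in AB.
have one n : dot n n = 1 -> dot n (last P s - A) = 0 -> {in P :: s, forall v, 0 <= dot (v - A) n} ->
    cauchy_per K <= tot dist A (P :: s) + d + 12 * kap * M - r ^+ 2 / (6 * M).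
  move=> n1 nB hn; have := one_sided_bound cK Kk0 M_gt0 hd hc AB hM n1 nB hn r0 hr; lra.
have [s0|sn] := eqVneq s [::].
  subst s; rewrite /= in AB one *.
  have e0 : P - A != 0 by rewrite subr_eq0 eq_sym.
  have ne : nrm (P - A) != 0 by rewrite nrm_eq0.
  pose n := (nrm (P - A))^-1 *: rot (P - A).
  have nP : dot n (P - A) = 0 by rewrite dotZl -crossE cross_self mulr0.
  apply: (one n) => //.
    rewrite dotZl dotZr (_ : dot (rot (P - A)) (rot (P - A)) = nrm (P - A) ^+ 2); first by field.
    by rewrite sqr_nrm /dot !rot0 !rot1; ring.
  by move=> v; rewrite inE => /eqP ->; rewrite dotC nP.
have [Q [a [cA [YA [Qs D alQ [Ka ha [tA tA01 eA]] [tipA defA]]]]]] :=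
  best_end cK Kk0 M_gt0 kap_gt0 kap_le hb sn hM.
(* If [Q] is the other end of the polygon, a side of the cone at [A] runs along AB, so the whole
   polygon is on one side of AB. *)
have [QB|QB] := eqVneq Q (last P s).
  have [n1 nQ nz] := normalP D; apply: (one (normal A P Q)) => //; first by rewrite -QB.
  move=> v vs; rewrite nz mulr_ge0 //; last by rewrite divr_ge0 ?nrm_ge0.
  by move: vs; rewrite in_cons => /orP[/eqP ->|/alQ //]; rewrite al_P // ler01.
case/lastP: s sn hb hM AB hr hc one Qs alQ QB tipA => // s' B _.
case/lastP: s' => [|mid0 F] hb hM AB hr hc one Qs alQ QB tipA.
  by move: Qs QB; rewrite inE /= => /eqP ->; rewrite eqxx.
have lB : last A (P :: rcons (rcons mid0 F) B) = B by rewrite /= last_rcons.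
rewrite lB in AB hr; rewrite last_rcons in QB tipA one.
have eS : A :: P :: rcons (rcons mid0 F) B = A :: P :: mid0 ++ [:: F; B].
  by rewrite -!cats1 -catA.
have Qs' : Q \in rcons mid0 F.
  by move: Qs; rewrite mem_rcons in_cons (negbTE QB).
have eR : rev (A :: P :: rcons (rcons mid0 F) B) = B :: F :: rcons (rcons (rev mid0) P) A.
  by rewrite 2!rev_cons !rev_rcons.
have hbR := best_rev hb; rewrite eR in hbR.
have memR z : (z \in B :: F :: rcons (rcons (rev mid0) P) A) = (z \in A :: P :: rcons (rcons mid0 F) B).
  by rewrite -eR mem_rev.
have hMR x y : x \in B :: F :: rcons (rcons (rev mid0) P) A \/ K x ->
    y \in B :: F :: rcons (rcons (rev mid0) P) A \/ K y -> dist x y <= M.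
  by rewrite !memR; exact: hM.
have snR : rcons (rcons (rev mid0) P) A != [::] by case: (rcons (rev mid0) P).
have [E [b [cB [YB [Es DR alE [Kb hb' [tB tB01 eB]] [tipB defB]]]]]] :=
  best_end cK Kk0 M_gt0 kap_gt0 kap_le hbR snR hMR.
have [EA|EA] := eqVneq E A.
  have [n1 nQ nz] := normalP DR.
  have hcR := covers_rev hc; rewrite eR in hcR.
  have lastR : last B (F :: rcons (rcons (rev mid0) P) A) = A by rewrite /= last_rcons.
  have ABR : B != last B (F :: rcons (rcons (rev mid0) P) A) by rewrite lastR eq_sym.
  have hn : {in F :: rcons (rcons (rev mid0) P) A, forall v, 0 <= dot (v - B) (normal B F E)}.
    move=> v vs; rewrite nz mulr_ge0 //; last by rewrite divr_ge0 ?nrm_ge0.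
    by move: vs; rewrite in_cons => /orP[/eqP ->|/alE //]; rewrite al_P // ler01.
  have := one_sided_bound cK Kk0 M_gt0 hd hcR ABR hMR n1.
  rewrite lastR -{1}EA => /(_ r nQ hn r0); rewrite distC => /(_ hr).
  have -> : tot dist B (F :: rcons (rcons (rev mid0) P) A) = tot dist A (P :: rcons (rcons mid0 F) B).
    by have := plen_rev (A :: P :: rcons (rcons mid0 F) B); rewrite eR.
  lra.
have Es' : E \in P :: mid0.
  by move: Es; rewrite mem_rcons in_cons (negbTE EA) mem_rcons !in_cons mem_rev.
rewrite eS in hc; rewrite last_rcons in tipB.
have := two_ended_bound hc Qs' Es' ha hb' tA01 eA tB01 eB tipA tipB.
rewrite -eS /plen => hfin.
have ab := hd Ka Kb.
have sq : 2 * r ^+ 2 <= dist A a ^+ 2 + dist B b ^+ 2.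
  have t1 := dist_triangle a A B; have t2 := dist_triangle b a B; rewrite (distC b B) in t2.
  by apply: sqr_half_sum => //; lra.
have : 2 * (r ^+ 2 / (6 * M)) <= dist A a ^+ 2 / (6 * M) + dist B b ^+ 2 / (6 * M).
  rewrite -mulrDl mulrA ler_pM2r ?invr_gt0 ?mulr_gt0 //.
lra.
Qed.

End BestBound.

(** * The inequality for polygons *)

Section Minimizer.
Context {R : realType}.
Notation point := 'rV[R]_2.
Notation dist := (@eucl_dist R).
Implicit Types (u v w x y z A B P Q : point) (s t : seq point).

Lemma plen_dist s x y : x \in s -> y \in s -> dist x y <= plen s.
Proof.
have tl := @tot_last R point (@eucl_dist R) (@distxx R) (@dist_triangle R).
have main s1 s2 z y0 : y0 \in z :: s2 -> dist z y0 <= plen (s1 ++ z :: s2).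
  move=> h; case: (splitPl h) => t1 t2 e.
  have h1 := tl z t1; rewrite e in h1; rewrite plen_cat tot_cat.
  have := plen_ge0 (rcons s1 z); have := @tot_ge0 _ _ _ (@dist_ge0 R) (last z t1) t2; lra.
move=> xs ys; case/splitPr: xs ys => s1 s2; rewrite mem_cat => /orP[h|]; last exact: main.
case/splitPr: h => t1 t2; rewrite distC -catA; apply: main.
by rewrite in_cons mem_cat mem_head !orbT.
Qed.

(** In the direction [k - v] some vertex reaches at least as far as [k], and the polygon joins it to
    [v]. *)
Lemma covers_vertex_dist s (K : set point) k v : covers s K -> K k -> v \in s -> dist k v <= plen s.
Proof.
move=> cs Kk vs; have sn := covers_neq_nil Kk cs.
have [y ys hy] := seq_argmax (dot (k - v)) sn.
have h : dot (k - v) k <= dot (k - v) y by apply: cs Kk => z /hy.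
have [e|e] := eqVneq k v; first by rewrite e distxx plen_ge0.
have kv : 0 < nrm (k - v) by rewrite nrm_gt0 subr_eq0.
apply: le_trans (plen_dist ys vs); rewrite !distE -(ler_pM2l kv) -expr2 sqr_nrm.
by apply: le_trans (dot_le_nrm _ _); rewrite !dotBr lerD2r.
Qed.

Lemma coversP s (K : set point) k0 : K k0 -> s != [::] -> covers s K <->
  forall u k, K k -> exists2 v, v \in s & dot u k <= dot u v.
Proof.
move=> Kk0 sn; split=> [cs u k Kk|h u c hc k Kk].
  have [y ys hy] := seq_argmax (dot u) sn.
  by exists y => //; apply: cs Kk => v /hy.
by have [v vs hv] := h u k Kk; apply: le_trans hv (hc _ vs).
Qed.

Lemma dist_continuous (T : topologicalType) (f g : T -> point) : continuous f -> continuous g ->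
  continuous (fun p => dist (f p) (g p)).
Proof.
move=> cf cg p; have -> : (fun p => dist (f p) (g p)) = (@nrm R \o (fun p => f p - g p)).
  by apply/funext => q; rewrite /= distE.
apply: continuous_comp; last exact: nrm_continuous.
by apply: continuousB; [exact: cf|exact: cg].
Qed.

Lemma tot_continuous (T : topologicalType) (I : Type) (f : I -> T -> point) i l :
  (forall i, continuous (f i)) -> continuous (fun X => tot dist (f i X) [seq f j X | j <- l]).
Proof.
move=> cf; elim: l i => [|j l ih] i /= X; first exact: cst_continuous.
apply: (@continuousD _ _ _ (fun X => dist (f i X) (f j X))
   (fun X => tot dist (f j X) [seq f j X | j <- l])); first exact: dist_continuous.
exact: ih.
Qed.

Variable K : set point.
Variables (k0 : point) (Kk0 : K k0).
Variable kap : R.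
Hypotheses (kap_ge0 : 0 <= kap).
Variables A0 B0 : point.

Section FixedSize.
Variable n : nat.
Notation N := n.+1.

(** A polygon with [N] vertices is one row vector, all first coordinates before all second ones, so
    that compactness of boxes applies. *)
Let vertex (i : 'I_N) (X : 'rV[R]_(N + N)) : point := pt (X 0 (lshift N i)) (X 0 (rshift N i)).
Let path_of (X : 'rV[R]_(N + N)) : seq point := [seq vertex i X | i <- enum 'I_N].

Let vertex_continuous i : continuous (vertex i).
Proof. by apply: continuous_pt; exact: coord_continuous. Qed.

Let path_of_surj s : size s = N -> exists X, path_of X = s.
Proof.
move=> ss; exists (\row_j match fintype.split j with inl i => nth 0 s i 0 0 | inr i => nth 0 s i 0 1 end).
transitivity [seq nth 0 s (val i) | i <- enum 'I_N].
  apply: eq_map => i; rewrite /vertex !mxE.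
  rewrite (unsplitK (inl i : 'I_N + 'I_N)) (unsplitK (inr i : 'I_N + 'I_N)).
  by apply: pt_eq; rewrite ?pt0 ?pt1.
by rewrite (map_comp (nth 0 s)) val_enum_ord -ss -/(mkseq _ _) mkseq_nth.
Qed.

Let size_path_of X : size (path_of X) = N.
Proof. by rewrite size_map size_enum_ord. Qed.

Let enum_cons : exists i l, enum 'I_N = i :: l.
Proof.
case e : (enum 'I_N) => [|i l]; last by exists i, l.
by have := size_enum_ord N; rewrite e.
Qed.

Let J_continuous : continuous (fun X => Jcost kap A0 B0 (path_of X)).
Proof.
have [i [l e]] := enum_cons.
have eJ X : Jcost kap A0 B0 (path_of X) = tot dist (vertex i X) [seq vertex j X | j <- l] +
    kap * dist (vertex i X) A0 + kap * dist (vertex (last i l) X) B0.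
  by rewrite /Jcost /path_of e /= (last_map (fun j => vertex j X)).
have -> : (fun X => Jcost kap A0 B0 (path_of X)) = (fun X => tot dist (vertex i X) [seq vertex j X | j <- l] +
    kap * dist (vertex i X) A0 + kap * dist (vertex (last i l) X) B0) by apply/funext.
have kc j C : continuous (fun X => kap * dist (vertex j X) C).
  move=> X; apply: (@continuousM _ _ (fun=> kap) (fun X => dist (vertex j X) C)); first exact: cst_continuous.
  by apply: dist_continuous; [exact: vertex_continuous|exact: cst_continuous].
move=> X; apply: (@continuousD _ _ _ (fun X => tot dist (vertex i X) [seq vertex j X | j <- l] +
    kap * dist (vertex i X) A0) (fun X => kap * dist (vertex (last i l) X) B0)); last exact: kc.
apply: (@continuousD _ _ _ (fun X => tot dist (vertex i X) [seq vertex j X | j <- l])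
   (fun X => kap * dist (vertex i X) A0)); last exact: kc.
by apply: tot_continuous; exact: vertex_continuous.
Qed.

(** For fixed [u] and [k] the condition that some vertex reaches as far as [k] is a finite union of
    closed conditions. *)
Let covers_closed : closed [set X | covers (path_of X) K].
Proof.
have -> : [set X | covers (path_of X) K] = \bigcap_(p in [set p : point * point | K p.2])
    [set X | exists2 i, i \in enum 'I_N & dot p.1 p.2 <= dot p.1 (vertex i X)].
  apply/seteqP; split=> X /=.
    move=> /(coversP Kk0) h [u k] /= Kk.
    have [|v /mapP[i hi ->] hv] := h _ u k Kk; last by exists i.
    by rewrite -size_eq0 size_path_of.
  move=> h; apply/(coversP Kk0); first by rewrite -size_eq0 size_path_of.
  move=> u k Kk; have [i hi hv] := h (u, k) Kk.
  by exists (vertex i X) => //; apply: map_f.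
apply: closed_bigI => -[u k] /= Kk; elim: (enum 'I_N) => [|i l ih].
  have -> : [set X | exists2 i, i \in [::] & dot u k <= dot u (vertex i X)] = set0.
    by apply/seteqP; split=> X // [].
  exact: closed0.
have -> : [set X | exists2 j, j \in i :: l & dot u k <= dot u (vertex j X)] =
   [set X | dot u k <= dot u (vertex i X)] `|` [set X | exists2 i, i \in l & dot u k <= dot u (vertex i X)].
  apply/seteqP; split=> X /=.
    by move=> [j]; rewrite in_cons => /orP[/eqP ->|jl] h; [left|right; exists j].
  by move=> [h|[j jl h]]; [exists i; rewrite ?mem_head|exists j; rewrite ?in_cons ?jl ?orbT].
apply: closedU => //.
have c : continuous (fun X => dot u (vertex i X)).
  by move=> X; apply: (@continuous_comp _ _ _ (vertex i) (dot u)); [exact: vertex_continuous|exact: dot_continuous].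
exact: (proj1 (continuous_closedP _) c _ (@closed_ge _ _)).
Qed.

Lemma minimizer_fixed_size s : size s = N -> covers s K -> exists t,
  [/\ size t = N, covers t K, Jcost kap A0 B0 t <= Jcost kap A0 B0 s &
   forall r, size r = N -> covers r K -> Jcost kap A0 B0 t <= Jcost kap A0 B0 r].
Proof.
move=> ss cs; have [X0 eX0] := path_of_surj ss.
pose S := [set X | covers (path_of X) K] `&` [set X | Jcost kap A0 B0 (path_of X) <= Jcost kap A0 B0 s].
have S0 : S X0 by split; rewrite /= eX0.
have Scl : closed S.
  apply: closedI; first exact: covers_closed.
  exact: (proj1 (continuous_closedP _) J_continuous _ (@closed_le _ _)).
(* The vertices of a competitor are within its length of [k0], and its length is at most its
   cost. *)
pose C := nrm k0 + Jcost kap A0 B0 s.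
have box : compact [set X : 'rV[R]_(N + N) | forall i, X ord0 i \in `[- C, C]].
  by apply: (@rV_compact _ _ (fun=> `[- C, C]%classic)) => _; exact: segment_compact.
have Scpt : compact S.
  apply: subclosed_compact Scl box _ => X [/= cX JX].
  have vC i : nrm (vertex i X) <= C.
    have vi : vertex i X \in path_of X by apply: map_f; rewrite mem_enum.
    have := covers_vertex_dist cX Kk0 vi; rewrite distC distE => h.
    have : nrm (vertex i X) <= nrm (vertex i X - k0) + nrm k0 by rewrite -{1}(subrK k0 (vertex i X)) nrmD.
    have : plen (path_of X) <= Jcost kap A0 B0 (path_of X).
      by rewrite /Jcost -addrA lerDl addr_ge0 // mulr_ge0 ?dist_ge0.
    rewrite /C; lra.
  have coord v : `|v 0 0| <= nrm v /\ `|v 0 1| <= nrm v.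
    split; rewrite -(@ler_pXn2r _ 2) ?nnegrE ?nrm_ge0 // sqr_nrm real_normK ?num_real // /dot -!expr2.
      by rewrite lerDl sqr_ge0.
    by rewrite lerDr sqr_ge0.
  move=> j; rewrite in_itv /= -ler_norml.
  case: (splitP j) => i ei; have [c0 c1] := coord (vertex i X); have vi := vC i.
    have -> : j = lshift N i by apply: val_inj.
    by apply: le_trans vi; apply: le_trans c0; rewrite /vertex pt0.
  have -> : j = rshift N i by apply: val_inj.
  by apply: le_trans vi; apply: le_trans c1; rewrite /vertex pt1.
have [||X] := @compact_EVT_min _ _ (fun X => Jcost kap A0 B0 (path_of X)) S _ Scpt.
- by exists X0.
- exact: continuous_subspaceT.
rewrite inE => -[/= cX JX] hX; exists (path_of X); split; rewrite ?size_path_of //.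
move=> r sr cr; have [Xr eXr] := path_of_surj sr.
have [h|h] := lerP (Jcost kap A0 B0 r) (Jcost kap A0 B0 s).
  by rewrite -eXr; apply: hX; rewrite inE; split; rewrite /= eXr.
exact: le_trans JX (ltW h).
Qed.

End FixedSize.

(** If a polygon with fewer vertices costs no more than the minimiser for the given number, restart
    from it; otherwise that minimiser has the strictness required of [is_best]. *)
Lemma minimizer s : covers s K -> exists t, is_best K kap A0 B0 t /\ Jcost kap A0 B0 t <= Jcost kap A0 B0 s.
Proof.
have [m] := ubnP (size s); elim: m s => // m ih s sm cs.
have sn := covers_neq_nil Kk0 cs.
have [|t [st ct Jt ht]] := @minimizer_fixed_size (size s).-1 s _ cs.
  by rewrite prednK // lt0n size_eq0.
have ss : (size s).-1.+1 = size s by rewrite prednK // lt0n size_eq0.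
rewrite ss in st ht.
have [[r [sr cr Jr]]|nr] := pselect (exists r, [/\ (size r < size s)%N, covers r K & Jcost kap A0 B0 r <= Jcost kap A0 B0 t]).
  have [|r' [br' Jr']] := ih r _ cr; first exact: leq_trans sr _.
  by exists r'; split => //; apply: le_trans Jr' (le_trans Jr Jt).
exists t; split => //; split => // r cr; rewrite st.
have lt : (size r < size s)%N -> Jcost kap A0 B0 t < Jcost kap A0 B0 r.
  by move=> sr; rewrite ltNge; apply/negP => h; apply: nr; exists r.
split => //; rewrite leq_eqVlt => /orP[/eqP sr|/lt/ltW //].
exact: ht.
Qed.

End Minimizer.

(** * The inequality and its uniform strict form *)

Section PathInequality.
Context {R : realType}.
Notation point := 'rV[R]_2.
Notation dist := (@eucl_dist R).
Implicit Types (u v w x y z A B P Q : point) (s t : seq point) (r kap L : R).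

Variable K : set point.
Hypothesis cK : compact K.
Variables (k0 : point) (Kk0 : K k0).
Variable d : R.
Hypothesis hd : forall k k', K k -> K k' -> dist k k' <= d.

Lemma covers_width s u : covers s K ->
  exists v w, [/\ v \in s, w \in s & width K u <= dot u v - dot u w].
Proof.
move=> cs; have [k [k' [Kk Kk' ->]]] := widthP cK Kk0 u.
have sn := covers_neq_nil Kk0 cs.
have [v vs hv] := seq_argmax (dot u) sn; have [w ws hw] := seq_argmax (dot (- u)) sn.
exists v, w; split => //; apply: lerB; first by apply: cs Kk => z /hv.
have : dot (- u) k' <= dot (- u) w by apply: cs Kk' => z /hw.
by rewrite !dotNl lerN2.
Qed.

Lemma closed_tour_bound A s : covers (A :: s) K -> cauchy_per K <= tot dist A s + dist A (last A s).
Proof.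
move=> cs; have -> : dist A (last A s) = nrmsum [:: (1, A - last A s)].
  by rewrite nrmsum_cons nrmsum_nil /= mul1r addr0 distE.
apply: (cauchy_per_le_path cK Kk0) => u.
have [v [w [vs ws hw]]] := covers_width u cs.
have := @fvar_closed _ u A s v w vs ws.
have : dot u v - dot u w <= absd (dot u v) (dot u w) by exact: ler_norm.
by rewrite dotsum_cons dotsum_nil /= dotBr /absd; lra.
Qed.

Let d_ge0 : 0 <= d.
Proof. by apply: le_trans (hd Kk0 Kk0); exact: dist_ge0. Qed.

Lemma minimizer_bound kap L A0 s : 0 < kap -> 10 * kap <= 1 -> 0 < L ->
  covers (A0 :: s) K -> tot dist A0 s <= L ->
  exists A t, [/\ covers (A :: t) K,
    tot dist A t + kap * dist A A0 + kap * dist (last A t) (last A0 s) <= tot dist A0 s &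
    forall r, 0 <= r -> 0 < dist A (last A t) -> d + 2 * r <= dist A (last A t) ->
      cauchy_per K <= tot dist A t + d + 24 * kap * L - r ^+ 2 / (12 * L)].
Proof.
move=> k0' k1 L0 cs sL.
have [[|A t] [bt Jt]] := @minimizer _ K k0 Kk0 kap (ltW k0') A0 (last A0 s) (A0 :: s) cs.
  by have [ct _] := bt; have := covers_neq_nil Kk0 ct; rewrite eqxx.
have Jt' : tot dist A t + kap * dist A A0 + kap * dist (last A t) (last A0 s) <= tot dist A0 s.
  by move: Jt; rewrite /Jcost /= !distxx !mulr0 !addr0.
have [ct _] := bt; exists A, t; split => // r r0 AB hr.
have tL : plen (A :: t) <= L.
  apply: le_trans sL; apply: le_trans Jt'; rewrite -addrA lerDl addr_ge0 // mulr_ge0 ?dist_ge0 ?ltW //.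
(* Points of [K] are within [L] of each vertex, so [2 * L] bounds all distances among vertices and
   points of [K]. *)
have M0 : 0 < 2 * L by rewrite mulr_gt0.
have hM x y : x \in A :: t \/ K x -> y \in A :: t \/ K y -> dist x y <= 2 * L.
  move=> [xt|Kx] [yt|Ky].
  - by have := plen_dist xt yt; lra.
  - by have := covers_vertex_dist ct Ky xt; rewrite distC; lra.
  - by have := covers_vertex_dist ct Kx yt; lra.
  - have h1 := covers_vertex_dist ct Kx (mem_head A t); have h2 := covers_vertex_dist ct Ky (mem_head A t).
    have := dist_triangle A x y; rewrite (distC A y); lra.
have := best_bound cK Kk0 M0 k0' k1 hd bt hM r0 AB hr.
have -> : 12 * kap * (2 * L) = 24 * kap * L by ring.
by have -> : r ^+ 2 / (6 * (2 * L)) = r ^+ 2 / (12 * L) by congr (_ / _); ring.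
Qed.

Lemma path_inequality A0 s : covers (A0 :: s) K -> cauchy_per K <= tot dist A0 s + d.
Proof.
move=> cs; rewrite leNgt; apply/negP => lt.
pose e := cauchy_per K - (tot dist A0 s + d).
have e0 : 0 < e by rewrite subr_gt0.
have d0 := d_ge0.
pose L := tot dist A0 s + 1.
have s0 : 0 <= tot dist A0 s by apply: tot_ge0; exact: dist_ge0.
have L0 : 0 < L by rewrite ltr_wpDl.
(* This makes the error [24 * kap * L] at most half of the supposed violation [e]. *)
pose kap := Num.min (10^-1) (e / (48 * L)).
have kp : 0 < kap by rewrite lt_min invr_gt0 ltr0n /= divr_gt0 // mulr_gt0.
have k1 : 10 * kap <= 1.
  have : kap <= 10^-1 by rewrite ge_min lexx.
  lra.
have k2 : kap * (48 * L) <= e by rewrite -ler_pdivlMr ?mulr_gt0 // ge_min lexx orbT.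
have sL : tot dist A0 s <= L by rewrite lerDl.
have [A [t [ct Jt ht]]] := minimizer_bound kp k1 L0 cs sL.
have g1 : 0 <= kap * dist A A0 by rewrite mulr_ge0 ?dist_ge0 // ltW.
have g2 : 0 <= kap * dist (last A t) (last A0 s) by rewrite mulr_ge0 ?dist_ge0 // ltW.
have [h|h] := lerP (dist A (last A t)) d.
  have := closed_tour_bound ct; rewrite /e in k2 e0; lra.
have := ht 0 (lexx 0); rewrite mulr0 addr0 expr0n /= mul0r subr0.
have h' : 0 < dist A (last A t) by lra.
move=> /(_ h' (ltW h)); rewrite /e in k2 e0; lra.
Qed.

(** [eta] must not depend on the polygon, since it has to survive the approximation of a curve. If
    the minimiser has moved an end by [r], the penalty yields [kap * r]; otherwise its ends are
    still [d + 2 * r] apart and the quadratic gain remains. *)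
Lemma path_inequality_strict r L : 0 < r -> 0 < L -> exists2 eta : R, 0 < eta &
  forall A0 s, covers (A0 :: s) K -> tot dist A0 s <= L -> d + 4 * r <= dist A0 (last A0 s) ->
    cauchy_per K <= tot dist A0 s + d - eta.
Proof.
move=> r0 L0; have d0 := d_ge0.
(* The error [24 * kap * L] thereby takes at most half of the gain [r ^+ 2 / (12 * L)]. *)
pose kap := Num.min (10^-1) (r ^+ 2 / (24 * L) / (24 * L)).
have L24 : 0 < 24 * L by rewrite mulr_gt0.
have kp : 0 < kap by rewrite lt_min invr_gt0 ltr0n /= !divr_gt0 // exprn_gt0.
have k1 : 10 * kap <= 1.
  have : kap <= 10^-1 by rewrite ge_min lexx.
  lra.
have k2 : kap * (24 * L) <= r ^+ 2 / (24 * L) by rewrite -ler_pdivlMr // ge_min lexx orbT.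
have q0 : 0 < r ^+ 2 / (24 * L) by rewrite divr_gt0 // exprn_gt0.
have kr : 0 < kap * r by rewrite mulr_gt0.
have q2 : r ^+ 2 / (12 * L) = 2 * (r ^+ 2 / (24 * L)) by field; lra.
exists (Num.min (kap * r) (r ^+ 2 / (24 * L))); first by rewrite lt_min kr.
have [m1 m2] : Num.min (kap * r) (r ^+ 2 / (24 * L)) <= kap * r /\
  Num.min (kap * r) (r ^+ 2 / (24 * L)) <= r ^+ 2 / (24 * L) by rewrite !ge_min !lexx orbT.
move: (Num.min (kap * r) _) m1 m2 => eta m1 m2 A0 s cs sL hr.
have [A [t [ct Jt ht]]] := minimizer_bound kp k1 L0 cs sL.
have weak := path_inequality ct.
have g1 : 0 <= kap * dist A A0 by rewrite mulr_ge0 ?dist_ge0 // ltW.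
have g2 : 0 <= kap * dist (last A t) (last A0 s) by rewrite mulr_ge0 ?dist_ge0 // ltW.
have [h|h] := lerP r (dist A A0).
  have : kap * r <= kap * dist A A0 by rewrite ler_pM2l.
  lra.
have [h'|h'] := lerP r (dist (last A t) (last A0 s)).
  have : kap * r <= kap * dist (last A t) (last A0 s) by rewrite ler_pM2l.
  lra.
have AB : d + 2 * r <= dist A (last A t).
  have t1 := dist_triangle A A0 (last A0 s); have t2 := dist_triangle (last A t) A (last A0 s).
  rewrite (distC A0 A) in t1; lra.
have AB0 : 0 < dist A (last A t) by lra.
have := ht r (ltW r0) AB0 AB; lra.
Qed.

End PathInequality.

(** * Convex sets and curves *)

Section ConvexSets.
Context {R : realType}.
Notation point := 'rV[R]_2.
Notation dist := (@eucl_dist R).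
Implicit Types (u v w x y z p q k c : point) (a b r l e : R) (K X : set point).

Lemma convex_mid K x y r : convex_set K -> K x -> K y -> 0 <= r <= 1 -> K (mid r x y).
Proof.
move=> cK Kx Ky /andP[r0 r1].
have h0 : 0 <= 1 - r by rewrite subr_ge0.
have h1 : 1 - r <= 1 by rewrite gerBl.
have := cK x y (Itv01 h0 h1); rewrite !inE => /(_ Kx Ky).
have -> // : conv (Itv01 h0 h1) (x : convex_lmodType _) y = mid r x y.
by rewrite /conv /= /unstable.onem; apply: pt_eq; rewrite !mxE /=; ring.
Qed.

Lemma mid_convex K : (forall x y r, K x -> K y -> 0 <= r <= 1 -> K (mid r x y)) -> convex_set K.
Proof.
move=> h x y l; rewrite !inE => Kx Ky.
have -> : conv l x y = mid (1 - l%:num) x y.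
  by rewrite /conv /= /unstable.onem; apply: pt_eq; rewrite !mxE /=; ring.
by apply: h => //; rewrite subr_ge0 gerBl ge0 le1.
Qed.

Lemma convex_inhull K x y z v : convex_set K -> K x -> K y -> K z -> inhull v x y z -> K v.
Proof.
move=> cK Kx Ky Kz [a [b [a0 b0 ab ->]]].
have [s0|s0] := eqVneq (a + b) 0.
  have [-> ->] : a = 0 /\ b = 0 by split; lra.
  by rewrite !scale0r !addr0.
have sp : 0 < a + b by rewrite lt0r s0 addr_ge0.
have -> : x + a *: (y - x) + b *: (z - x) = mid (a + b) x (mid (b / (a + b)) y z).
  by apply/rowP => i; rewrite !mxE; field.
apply: convex_mid => //; last by rewrite ab ltW.
by apply: convex_mid => //; rewrite (divr_ge0 b0 (ltW sp)) /= ler_pdivrMr // mul1r lerDr.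
Qed.

Lemma hull_sub X K : convex_set K -> X `<=` K -> convex_hull X `<=` K.
Proof. by move=> cK XK; apply: smallest_sub. Qed.

Lemma halfplane_convex u a : convex_set [set z | dot u z < a].
Proof.
apply: mid_convex => x y r /= hx hy /andP[r0 r1]; rewrite dot_mid.
have [->|rn] := eqVneq r 0; first by rewrite mul0r subr0 mul1r addr0.
have rp : 0 < r by rewrite lt0r rn.
have : r * dot u y < r * a by rewrite ltr_pM2l.
have : 0 <= (1 - r) * (a - dot u x) by rewrite mulr_ge0 // subr_ge0 // ltW.
lra.
Qed.

(* Support version of [K `<=` convex_hull X] for compact [X]. *)
Definition dominates X K := forall u k, K k -> exists2 x, X x & dot u k <= dot u x.

(** Otherwise the open half-plane [dot u z < dot u k] would contain [X], hence its hull, hence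
    [k]. *)
Lemma hull_dominates X K : K `<=` convex_hull X -> dominates X K.
Proof.
move=> KX u k Kk; apply: contrapT => nx.
suff : dot u k < dot u k by rewrite ltxx.
by apply: (hull_sub (@halfplane_convex u (dot u k)) _ (KX _ Kk)) => x Xx /=; rewrite ltNge; apply/negP => le; apply: nx; exists x.
Qed.

Lemma compact_is_closed K : compact K -> closed K.
Proof. by apply: compact_closed; exact: norm_hausdorff. Qed.

(** [m] is the point of [K] nearest to [z]. If some [k] were not behind the perpendicular at [m], a
    small step from [m] towards [k] would come closer to [z]. *)
Lemma separation K z : compact K -> convex_set K -> K !=set0 -> ~ K z ->
  exists u, forall k, K k -> dot u k < dot u z.
Proof.
move=> cK vK [k0 Kk0] nz.
have [|m Km hm] := @compact_argmin _ K cK k0 Kk0 (fun x => dist z x).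
  by apply: dist_continuous; [exact: cst_continuous|move=> ?; exact: cvg_id].
exists (z - m) => k Kk.
have zm : 0 < dot (z - m) (z - m).
  by rewrite dot_sq_gt0 // subr_eq0; apply: contra_notN nz => /eqP ->.
suff h : dot (z - m) (k - m) <= 0 by move: zm h; rewrite !dotBr; lra.
rewrite leNgt; apply/negP => h.
have km : 0 < dot (k - m) (k - m).
  by rewrite dot_sq_gt0 //; apply: contraTneq h => ->; rewrite dot0r ltxx.
pose s := Num.min 1 (dot (z - m) (k - m) / dot (k - m) (k - m)).
have s0 : 0 < s by rewrite lt_min ltr01 divr_gt0.
have s1 : s <= 1 by rewrite ge_min lexx.
have s2 : s * dot (k - m) (k - m) <= dot (z - m) (k - m).
  by rewrite -ler_pdivlMr // ge_min lexx orbT.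
have Ks : K (mid s m k) by apply: convex_mid => //; rewrite s1 ltW.
have := hm _ Ks; rewrite -(@ler_pXn2r _ 2) ?nnegrE ?dist_ge0 // !sqr_dist.
have -> : dot (z - mid s m k) (z - mid s m k) =
   dot (z - m) (z - m) - 2 * s * dot (z - m) (k - m) + s * (s * dot (k - m) (k - m)).
  by rewrite /mid /dot !mxE; ring.
have : s * (s * dot (k - m) (k - m)) <= s * dot (z - m) (k - m) by rewrite ler_pM2l.
have : 0 < s * dot (z - m) (k - m) by rewrite mulr_gt0.
lra.
Qed.

Lemma near_gt (g : point -> R) p a : continuous g -> a < g p -> \forall z \near p, a < g z.
Proof. by move=> cg h; exact: (cvgr_gt _ (cg p) _ h). Qed.
Lemma near_lt (g : point -> R) p a : continuous g -> g p < a -> \forall z \near p, g z < a.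
Proof. by move=> cg h; exact: (cvgr_lt _ (cg p) _ h). Qed.

Lemma near_triangle x y z p : cross (y - x) (z - x) != 0 ->
  0 < al x y z p -> al x y z p + be x y z p < 1 ->
  \forall q \near p, 0 < al x y z q /\ al x y z q + be x y z q < 1.
Proof.
move=> D h1 h2; near=> q; split; near: q.
  by apply: near_gt => //; apply: affine_continuous; exact: al_affine.
apply: (@near_lt (fun q => al x y z q + be x y z q)) => //; apply: affine_continuous.
by apply: affine_funD; [exact: al_affine|exact: be_affine].
Unshelve. all: by end_near.
Qed.

Lemma triangle_interior K x y z : convex_set K -> K x -> K y -> K z ->
  cross (y - x) (z - x) != 0 -> K° !=set0.
Proof.
move=> cK Kx Ky Kz D; pose p := x + 3^-1 *: (y - x) + 3^-1 *: (z - x).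
have [ea eb] := coord_uniq D (erefl p).
exists p; rewrite /interior.
have h1 : 0 < al x y z p by rewrite ea.
have h2 : al x y z p + be x y z p < 1 by rewrite ea eb; lra.
have h3 : 0 < be x y z p by rewrite eb.
near=> q.
have [q1 q2] : 0 < al x y z q /\ al x y z q + be x y z q < 1 by near: q; exact: near_triangle.
have q3 : 0 < be x y z q by near: q; apply: near_gt => //; apply: affine_continuous; exact: be_affine.
apply: (convex_inhull cK Kx Ky Kz); exists (al x y z q), (be x y z q).
by split; [exact: ltW|exact: ltW|exact: ltW|exact: coordE].
Unshelve. all: by end_near.
Qed.

(** The triangles over the chord with apices [k] and [k'] together cover a neighbourhood of each
    inner point of the chord. *)
Lemma chord_interior K u p q k k' l : convex_set K -> K p -> K q -> K k -> K k' -> p != q ->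
  dot u p = dot u q -> dot u k < dot u p -> dot u p < dot u k' -> 0 < l < 1 -> K° (mid l p q).
Proof.
move=> cK Kp Kq Kk Kk' pq e hk hk' /andP[l0 l1].
have Dk x : dot u x != dot u p -> cross (q - p) (x - p) != 0.
  move=> h; apply: contraNneq h => c; have qp : q - p != 0 by rewrite subr_eq0 eq_sym.
  have ex := cross0_colinear qp c.
  have e0 : dot u (q - p) = 0 by rewrite dotBr e subrr.
  by rewrite -subr_eq0 -dotBr ex dotZr e0 mulr0.
have D := Dk k (negbT (lt_eqF hk)); have D' := Dk k' (negbT (gt_eqF hk')).
have co x : cross (q - p) (x - p) != 0 -> al p q x (mid l p q) = l /\ be p q x (mid l p q) = 0.
  by move=> Dx; apply: coord_uniq => //; rewrite scale0r addr0.
have fe x z : cross (q - p) (x - p) != 0 -> dot u z - dot u p = be p q x z * (dot u x - dot u p).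
  move=> Dx; have h := congr1 (dot u) (coordE z Dx).
  by rewrite h 2!dotDr 2!dotZr 2!dotBr e; ring.
have [a1 b1] := co _ D; have [a2 b2] := co _ D'.
have h1 : 0 < al p q k (mid l p q) by rewrite a1.
have h2 : al p q k (mid l p q) + be p q k (mid l p q) < 1 by rewrite a1 b1 addr0.
have h3 : 0 < al p q k' (mid l p q) by rewrite a2.
have h4 : al p q k' (mid l p q) + be p q k' (mid l p q) < 1 by rewrite a2 b2 addr0.
rewrite /interior; near=> z.
have [z1 z2] : 0 < al p q k z /\ al p q k z + be p q k z < 1 by near: z; exact: near_triangle.
have [z3 z4] : 0 < al p q k' z /\ al p q k' z + be p q k' z < 1 by near: z; exact: near_triangle.
have [h|h] := lerP (dot u p) (dot u z).
  apply: (convex_inhull cK Kp Kq Kk'); exists (al p q k' z), (be p q k' z).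
  split; [exact: ltW| |exact: ltW|exact: coordE].
  have : 0 <= be p q k' z * (dot u k' - dot u p) by rewrite -fe // subr_ge0.
  by rewrite pmulr_lge0 ?subr_gt0.
apply: (convex_inhull cK Kp Kq Kk); exists (al p q k z), (be p q k z).
split; [exact: ltW| |exact: ltW|exact: coordE].
have : be p q k z * (dot u k - dot u p) <= 0 by rewrite -fe // subr_le0 ltW.
by rewrite nmulr_lle0 ?subr_lt0.
Unshelve. all: by end_near.
Qed.

Lemma interior_ball K c : K° c -> exists2 r, 0 < r & forall z, dist c z <= r -> K z.
Proof.
move=> /nbhs_ballP[e /= e0 he]; exists (e / 2); first by rewrite divr_gt0.
move=> z hz; apply: he; split => // i j; rewrite !ord1 /ball /=.
apply: le_lt_trans (_ : nrm (c - z) < e); last by rewrite -distE; lra.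
rewrite -(@ler_pXn2r _ 2) ?nnegrE ?nrm_ge0 // sqr_nrm real_normK ?num_real // /dot !mxE -!expr2.
case: j => -[|[|//]] hj.
  by rewrite (_ : Ordinal hj = 0) ?lerDl ?sqr_ge0 //; apply: val_inj.
by rewrite (_ : Ordinal hj = 1) ?lerDr ?sqr_ge0 //; apply: val_inj.
Qed.

Lemma near_dist c r : 0 < r -> \forall z \near c, dist c z < r.
Proof.
move=> r0; apply: near_lt; last by rewrite distxx.
by apply: dist_continuous; [exact: cst_continuous|move=> ?; exact: cvg_id].
Qed.

Lemma supp_ball K c r u : compact K -> (forall z, dist c z <= r -> K z) -> 0 <= r ->
  dot u c + r * nrm u <= supp K u.
Proof.
move=> cK hB r0; have Kc : K c by apply: hB; rewrite distxx.
have [->|u0] := eqVneq u 0.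
  by rewrite nrm0 mulr0 addr0; exact: (supp_ge cK Kc).
have nu : 0 < nrm u by rewrite nrm_gt0.
have Kz : K (c + (r / nrm u) *: u).
  apply: hB; rewrite distC distE addrC addKr nrmZ ger0_norm; last by rewrite divr_ge0 // ltW.
  by rewrite divfK // gt_eqF.
have := supp_ge cK Kc u Kz; rewrite dotDr dotZr -sqr_nrm.
by have -> : r / nrm u * nrm u ^+ 2 = r * nrm u by field; rewrite gt_eqF.
Qed.

Lemma interior_supp K p u : compact K -> K° p -> u != 0 -> dot u p < supp K u.
Proof.
move=> cK /interior_ball[r r0 hB] u0; apply: lt_le_trans (supp_ball u cK hB (ltW r0)).
by rewrite ltrDl mulr_gt0 // nrm_gt0.
Qed.

Lemma boundaryE K : compact K -> boundary K = K `\` K°.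
Proof. by move=> cK; rewrite /boundary -(proj1 (closure_id K) (compact_is_closed cK)). Qed.

(** Of three distinct points on the line the middle one would be interior by [chord_interior]. *)
Lemma boundary_line K u p q x k k' : compact K -> convex_set K -> boundary K p -> boundary K q -> boundary K x ->
  K k -> K k' -> dot u k < dot u p -> dot u p < dot u k' -> dot u q = dot u p -> dot u x = dot u p ->
  [\/ p = q, p = x | q = x].
Proof.
move=> cK vK; rewrite boundaryE // => -[Kp nKp] [Kq nKq] [Kx nKx] Kk Kk' hk hk' eq ex.
have [->|pq] := eqVneq p q; first by apply: Or31.
have [->|px] := eqVneq p x; first by apply: Or32.
have [->|qx] := eqVneq q x; first by apply: Or33.
exfalso.
have qp0 : q - p != 0 by rewrite subr_eq0 eq_sym.
have c0 : cross (q - p) (x - p) = 0.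
  have u0 : u != 0 by apply: contraTneq hk => ->; rewrite !dot0l ltxx.
  have e1 : dot u (q - p) = 0 by rewrite dotBr eq subrr.
  have e2 : dot u (x - p) = 0 by rewrite dotBr ex subrr.
  have := lagrange u (q - p); rewrite e1 expr0n add0r.
  move=> l1; have cu : cross u (q - p) != 0.
    by rewrite -sqrf_eq0 l1 mulf_neq0 ?dot_sq_eq0.
  have := cramer (x - p) cu; set a := _ / _; set b := _ / _ => e3.
  have : dot u (x - p) = a * dot u u by rewrite e3 dotDr !dotZr e1 mulr0 addr0.
  rewrite e2 => /esym/eqP; rewrite mulf_eq0 dot_sq_eq0 (negbTE u0) orbF => /eqP a0.
  by rewrite e3 a0 scale0r add0r crossZr cross_self mulr0.
have ch := chord_interior vK.
have px' := cross0_colinear qp0 c0; move: (_ / _) px' => l hl.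
have xi i : x 0 i = p 0 i + l * (q 0 i - p 0 i).
  by have /rowP /(_ i) := hl; rewrite !mxE => h; lra.
have [l0|l0|l0] := ltgtP l 0; last by move/eqP: hl; rewrite l0 scale0r subr_eq0 eq_sym (negbTE px).
  apply: nKp; have -> : p = mid (- l / (1 - l)) x q.
    have l1 : 1 - l != 0 by lra.
    by apply/rowP => i; rewrite !mxE xi; field.
  apply: (ch u x q k k') => //; rewrite ?ex ?eq //; first by rewrite eq_sym.
  by rewrite divr_gt0 ?oppr_gt0 //= ?ltr_pdivrMr; lra.
have [l1|l1|l1] := ltgtP l 1; last by move/eqP: hl; rewrite l1 scale1r (inj_eq (addIr _)) eq_sym (negbTE qx).
  apply: nKx; have -> : x = mid l p q by apply/rowP => i; rewrite !mxE xi.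
  by apply: (ch u p q k k'); rewrite ?eq ?l0.
apply: nKq; have -> : q = mid l^-1 p x.
  have ln : l != 0 by lra.
  by apply/rowP => i; rewrite !mxE xi; field.
apply: (ch u p x k k') => //; rewrite ?ex ?eq // invr_gt0 l0 invf_lt1 //.
Qed.

End ConvexSets.

(** * From polygons to curves *)

Section Curves.
Context {R : realType}.
Notation point := 'rV[R]_2.
Notation dist := (@eucl_dist R).
Implicit Types (u v w x y z p q k c : point) (a b r e : R) (K X : set point).
Implicit Types (phi psi : R -> point) (s ts : seq R).

Lemma polygonal_lengthE a b phi s : polygonal_length a b phi s = tot dist (phi a) (map phi s).
Proof.
rewrite /polygonal_length; elim: s a => [|y s ih] a; first by rewrite big_nil.
rewrite /= -ih big_nat_recl //=.
Qed.

Lemma curve_length_ge a b phi s : path <=%R a s -> last a s <= b ->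
  ((tot dist (phi a) (map phi s) + dist (phi (last a s)) (phi b))%:E <= curve_length a b phi)%E.
Proof.
move=> ps lb.
suff [s' ps' e] : exists2 s', itv_partition a b s' & tot dist (phi a) (map phi s') =
    tot dist (phi a) (map phi s) + dist (phi (last a s)) (phi b).
  by rewrite -e -(polygonal_lengthE a b); apply: ereal_sup_ubound; exists s'.
elim: s a ps lb => [|y s ih] a /=.
  move=> _ ab; have [e|ne] := eqVneq a b.
    by exists [::]; [split => //=; apply/eqP|rewrite /= e distxx addr0].
  exists [:: b]; first by split => //=; rewrite lt_neqAle ne ab.
  by rewrite /= addr0 add0r.
move=> /andP[ay ps] lb; have [s' [ps' ls'] e] := ih y ps lb.
have [ey|ne] := eqVneq a y.
  by exists s'; [split; rewrite ?ey|rewrite ey distxx add0r].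
exists (y :: s'); last by rewrite /= e addrA.
by split => //=; rewrite lt_neqAle ne ay.
Qed.

Lemma curve_length_le a b phi r :
  (forall s, path <%R a s -> last a s = b -> tot dist (phi a) (map phi s) <= r) ->
  (curve_length a b phi <= r%:E)%E.
Proof.
move=> h; apply: ge_ereal_sup => _ [s [ps /eqP ls] <-].
by rewrite lee_fin polygonal_lengthE h.
Qed.

Lemma curve_length_ge0 a b phi : a <= b -> (0 <= curve_length a b phi)%E.
Proof.
move=> ab; have := @curve_length_ge a b phi [::] isT ab.
by apply: le_trans; rewrite /= add0r lee_fin dist_ge0.
Qed.

Lemma image_compact a b phi : {within `[a, b], continuous phi} -> compact (phi @` `[a, b]).
Proof. by move=> h; apply: continuous_compact => //; exact: segment_compact. Qed.

Lemma finite_net a b phi r : {within `[a, b], continuous phi} -> 0 < r ->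
  exists ts : seq R, {in ts, forall t, a <= t <= b} /\
    forall t, a <= t <= b -> exists2 t', t' \in ts & dist (phi t') (phi t) < r.
Proof.
move=> h r0; have := image_compact h; rewrite compact_cover => hc.
have [t _|z [t tab <-]|D DS cov] := hc R `[a, b]%classic (fun t => [set z | dist (phi t) z < r]).
- have c : continuous (dist (phi t)).
    by apply: dist_continuous; [exact: cst_continuous|move=> ?; exact: cvg_id].
  exact: (proj1 (continuousP _) c _ (@open_lt _ _)).
- by exists t => //=; rewrite distxx.
exists (finmap.enum_fset D); split.
  by move=> t tD; have /set_mem := DS _ tD; rewrite /= in_itv.
move=> t tab; have : (phi @` `[a, b]) (phi t) by exists t; rewrite //= in_itv.
by move=> /cov[t' t'D hd]; exists t'.
Qed.

Variables (K : set point) (c : point) (r : R).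
Hypotheses (cK : compact K) (r_gt0 : 0 < r) (hB : forall z, dist c z <= r -> K z).
Let Kc : K c. Proof. by apply: hB; rewrite distxx ltW. Qed.

(** The dilation about [c] that undoes the shrinking of [K] in [sample]. *)
Let scale e z := c + (1 - e)^-1 *: (z - c).

(* Fine samples of a curve that surrounds [K] surround a slightly shrunken copy of [K]. *)
Lemma sample a b phi e (ts : seq R) : a <= b -> {within `[a, b], continuous phi} ->
  dominates (phi @` `[a, b]) K -> 0 < e -> {in ts, forall t, a <= t <= b} ->
  exists s, [/\ path <=%R a s, last a s = b, {subset ts <= a :: s} &
    forall u, exists2 t, t \in a :: s & (1 - e) * (supp K u - dot u c) <= dot u (phi t) - dot u c].
Proof.
move=> ab h dom e0 tsab; have er : 0 < e * r by rewrite mulr_gt0.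
have [ts' [ts'ab net]] := finite_net h er.
pose s := sort <=%R (ts ++ ts').
have sab : {in s, forall t, a <= t <= b}.
  by move=> t; rewrite mem_sort mem_cat => /orP[/tsab|/ts'ab].
have ss : sorted <=%R s by apply: sort_sorted; exact: le_total.
exists (rcons s b); split; rewrite ?last_rcons //.
- rewrite rcons_path; apply/andP; split.
    by rewrite path_sortedE ?ss ?andbT; [apply/allP => t /sab /andP[]|exact: le_trans].
  by have := mem_last a s; rewrite in_cons => /orP[/eqP ->//|/sab/andP[]].
- by move=> t tts; rewrite in_cons mem_rcons in_cons mem_sort mem_cat tts !orbT.
move=> u; have [k Kk [ek _]] := suppP cK Kc u.
have [_ [t /= tab <-] hk] := dom u k Kk; rewrite in_itv /= in tab.
have [t' t'in ht'] := net t tab.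
exists t'; first by rewrite in_cons mem_rcons in_cons mem_sort mem_cat t'in !orbT.
have hr := supp_ball u cK hB (ltW r_gt0).
have h1 : dot u (phi t) - dot u (phi t') <= e * r * nrm u.
  rewrite -dotBr; apply: le_trans (dot_le_nrm _ _) _.
  by rewrite mulrC ler_wpM2r ?nrm_ge0 // -distE distC ltW.
have h2 : e * r * nrm u <= e * (supp K u - dot u c) by rewrite -mulrA ler_pM2l //; lra.
rewrite ek in h2 *; lra.
Qed.

Lemma sample_width a phi e s u : 
  (forall u, exists2 t, t \in a :: s & (1 - e) * (supp K u - dot u c) <= dot u (phi t) - dot u c) ->
  exists t t', [/\ t \in a :: s, t' \in a :: s & (1 - e) * width K u <= dot u (phi t) - dot u (phi t')].
Proof.
move=> h; have [t ts ht] := h u; have [t' t's ht'] := h (- u).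
exists t, t'; split => //; move: ht'; rewrite !dotNl /width; lra.
Qed.

Lemma scaled_covers a phi e s : e < 1 ->
  (forall u, exists2 t, t \in a :: s & (1 - e) * (supp K u - dot u c) <= dot u (phi t) - dot u c) ->
  covers (map (scale e \o phi) (a :: s)) K.
Proof.
move=> e1 h u m hm k Kk; have [t ts ht] := h u.
have e1' : 0 < 1 - e by rewrite subr_gt0.
apply: le_trans (hm _ (map_f (scale e \o phi) ts)).
rewrite /scale /= dotDr dotZr dotBr -lerBlDl mulrC ler_pdivlMr // mulrC.
apply: le_trans ht; rewrite ler_pM2l // lerD2r; exact: (supp_ge cK Kc).
Qed.

Lemma dist_scale e x y : e < 1 -> dist (scale e x) (scale e y) = (1 - e)^-1 * dist x y.
Proof.
move=> e1; rewrite !distE (_ : scale e x - scale e y = (1 - e)^-1 *: (x - y)).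
  by rewrite nrmZ ger0_norm // invr_ge0 subr_ge0 ltW.
by apply: pt_eq; rewrite !mxE; ring.
Qed.

Lemma tot_scale e phi a s : e < 1 ->
  tot dist (scale e (phi a)) (map (scale e \o phi) s) = (1 - e)^-1 * tot dist (phi a) (map phi s).
Proof.
move=> e1; elim: s a => [|t s ih] a /=; first by rewrite mulr0.
by rewrite ih dist_scale //; ring.
Qed.

Variables (a b : R) (phi : R -> point) (d l : R).
Hypotheses (ab : a <= b) (hphi : {within `[a, b], continuous phi}).
Hypothesis dom : dominates (phi @` `[a, b]) K.
Hypothesis hd : forall k k', K k -> K k' -> dist k k' <= d.
Hypothesis hl : curve_length a b phi = l%:E.

Let tot_le s : path <=%R a s -> last a s = b -> tot dist (phi a) (map phi s) <= l.
Proof.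
move=> ps ls; have lb : last a s <= b by rewrite ls.
by have := curve_length_ge phi ps lb; rewrite hl lee_fin ls distxx addr0.
Qed.

Let nil_ab : {in [::] : seq R, forall t, a <= t <= b}. Proof. by []. Qed.

Let shrink (x y : R) : (forall e, 0 < e < 2^-1 -> (1 - e) * x <= y) -> x <= y.
Proof.
move=> h; have [x0|x0] := lerP x 0.
  by apply: le_trans (h (3^-1) _); lra.
rewrite leNgt; apply/negP => yx.
pose e := Num.min (3^-1) ((x - y) / (2 * x)).
have e0 : 0 < e by rewrite lt_min invr_gt0 ltr0n divr_gt0 ?subr_gt0 // mulr_gt0.
have e1 : e <= 3^-1 by rewrite ge_min lexx.
have e2 : e * (2 * x) <= x - y by rewrite -ler_pdivlMr ?mulr_gt0 // ge_min lexx orbT.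
have := h e; rewrite e0 /= => /(_ ltac:(lra)); lra.
Qed.

(** A dilated sample surrounds [K] and obeys [path_inequality]; the dilation factor tends to 1. *)
Lemma curve_inequality : cauchy_per K - d <= l.
Proof.
apply: shrink => e /andP[e0 e2]; have e1 : e < 1 by lra.
have [s [ps ls _ hs]] := sample ab hphi dom e0 nil_ab.
have h : cauchy_per K <= tot dist (scale e (phi a)) (map (scale e \o phi) s) + d.
  exact: (path_inequality cK Kc hd (scaled_covers e1 hs)).
rewrite tot_scale // in h.
have := tot_le ps ls; move: (tot _ _ _) h => T h TL.
have e1' : 0 < 1 - e by rewrite subr_gt0.
have : (1 - e) * (cauchy_per K - d) <= T.
  by rewrite mulrC -ler_pdivlMr // mulrC; lra.
lra.
Qed.

(** If the closed samples through the parameters [ts] all vary by [g u] more than (shrunken) [K]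
    demands, the integral of [g] is a gain independent of the sample. *)
Lemma curve_excess (g : point -> R) (ts : seq R) u0 : continuous g -> (forall u, 0 <= g u) ->
  dot u0 u0 = 1 -> 0 < g u0 -> {in ts, forall t, a <= t <= b} ->
  (forall e s u, 0 < e < 2^-1 -> path <=%R a s -> last a s = b -> {subset ts <= a :: s} ->
    (forall u, exists2 t, t \in a :: s & (1 - e) * (supp K u - dot u c) <= dot u (phi t) - dot u c) ->
    2 * ((1 - e) * width K u) + g u <= fvar u (phi a) (map phi s) + absd (dot u (phi a)) (dot u (phi b))) ->
  cauchy_per K < l + dist (phi a) (phi b).
Proof.
move=> cg g0 u1 gu tsab h; pose G := circ_int g / @circ_cst R.
have G0 : 0 < G by rewrite divr_gt0 ?circ_cst_gt0 // (circ_int_gt0 cg g0 u1).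
suff : cauchy_per K <= l + dist (phi a) (phi b) - G by lra.
apply: shrink => e /andP[e0 e2].
have [s [ps ls sub hs]] := sample ab hphi dom e0 tsab.
have := tot_le ps ls.
pose L := edges (phi a) (map phi s) ++ [:: (1, phi a - phi b)].
have hL u : 2 * ((1 - e) * width K u) + g u <= dotsum L u.
  rewrite dotsum_edges dotsum_cons dotsum_nil /= mul1r addr0 dotBr.
  by apply: h => //; rewrite e0 e2.
have eL : nrmsum L = tot dist (phi a) (map phi s) + dist (phi a) (phi b).
  by rewrite nrmsum_edges nrmsum_cons nrmsum_nil /= mul1r addr0 distE.
have cw := width_continuous cK Kc.
have c1 : continuous (fun u => 2 * ((1 - e) * width K u)).
  move=> u; apply: (@continuousM _ _ (fun=> 2) (fun u => (1 - e) * width K u)); first exact: cst_continuous.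
  by apply: (@continuousM _ _ (fun=> 1 - e) (width K)); [exact: cst_continuous|exact: cw].
have c3 : continuous (fun u => (1 - e) * width K u).
  by move=> u; apply: (@continuousM _ _ (fun=> 1 - e) (width K)); [exact: cst_continuous|exact: cw].
have c2 : continuous (fun u => 2 * ((1 - e) * width K u) + g u).
  by move=> u; apply: (@continuousD _ _ _ (fun u => 2 * ((1 - e) * width K u)) g); [exact: c1|exact: cg].
have := circ_int_le c2 (@dotsum_continuous _ L) hL.
rewrite circ_int_dotsum eL circ_intD // circ_intZ // circ_intZ //.
rewrite [leRHS]mulrC -ler_pdivrMr ?circ_cst_gt0 // => hI.
have e3 : (1 - e) * cauchy_per K + G = (2 * ((1 - e) * circ_int (width K)) + circ_int g) / circ_cst.
  by rewrite /cauchy_per /G; field; rewrite gt_eqF // circ_cst_gt0.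
lra.
Qed.

Lemma closed_curve_inequality : cauchy_per K <= l + dist (phi a) (phi b).
Proof.
apply: shrink => e /andP[e0 e2]; have e1 : e < 1 by lra.
have [s [ps ls _ hs]] := sample ab hphi dom e0 nil_ab.
have h : cauchy_per K <= tot dist (scale e (phi a)) (map (scale e \o phi) s) +
    dist (scale e (phi a)) (last (scale e (phi a)) (map (scale e \o phi) s)).
  exact: (closed_tour_bound cK Kc (scaled_covers e1 hs)).
rewrite tot_scale // -[last _ _]/(last ((scale e \o phi) a) _) last_map ls dist_scale // in h.
have := tot_le ps ls; move: (tot _ _ _) h => T h TL.
have e1' : 0 < 1 - e by rewrite subr_gt0.
have : (1 - e) * cauchy_per K <= T + dist (phi a) (phi b).
  by rewrite mulrC -ler_pdivlMr // mulrC; lra.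
lra.
Qed.

Lemma curve_inequality_strict : d < dist (phi a) (phi b) -> cauchy_per K - d < l.
Proof.
move=> dAB; pose r' := (dist (phi a) (phi b) - d) / 4.
have r'0 : 0 < r' by rewrite divr_gt0 ?subr_gt0.
have l0 : 0 <= l by have := curve_length_ge0 phi ab; rewrite hl.
(* For [e < 2^-1] the dilation factor is at most 2, so all dilated samples have length at most
   [2 * l + 1]. *)
have L0 : 0 < 2 * l + 1 by lra.
have [eta eta0 heta] := path_inequality_strict cK Kc hd r'0 L0.
suff : cauchy_per K - d + eta <= l by lra.
apply: shrink => e /andP[e0 e2]; have e1 : e < 1 by lra.
have e1' : 0 < 1 - e by rewrite subr_gt0.
have einv : 1 <= (1 - e)^-1 <= 2 by rewrite invf_ge1 //; apply/andP; split; first lra; rewrite -[2]invrK lef_pV2 ?posrE //; lra.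
have [s [ps ls _ hs]] := sample ab hphi dom e0 nil_ab.
have TL := tot_le ps ls.
have T0 : 0 <= tot dist (phi a) (map phi s) by apply: tot_ge0; exact: dist_ge0.
have h : tot dist (scale e (phi a)) (map (scale e \o phi) s) <= 2 * l + 1 ->
    d + 4 * r' <= dist (scale e (phi a)) (last (scale e (phi a)) (map (scale e \o phi) s)) ->
    cauchy_per K <= tot dist (scale e (phi a)) (map (scale e \o phi) s) + d - eta.
  exact: (heta _ _ (scaled_covers e1 hs)).
move: h; rewrite tot_scale // -[last _ _]/(last ((scale e \o phi) a) _) last_map ls dist_scale // => h.
have {}h : cauchy_per K <= (1 - e)^-1 * tot dist (phi a) (map phi s) + d - eta.
  apply: h.
    have : (1 - e)^-1 * tot dist (phi a) (map phi s) <= 2 * tot dist (phi a) (map phi s).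
      by rewrite ler_wpM2r //; case/andP: einv.
    lra.
  have : 1 * dist (phi a) (phi b) <= (1 - e)^-1 * dist (phi a) (phi b).
    by rewrite ler_wpM2r ?dist_ge0 //; case/andP: einv.
  rewrite /r'; lra.
have : (1 - e) * (cauchy_per K - d + eta) <= tot dist (phi a) (map phi s).
  by rewrite mulrC -ler_pdivlMr // mulrC; lra.
lra.
Qed.

End Curves.

(** * Curves along the boundary *)

Section BoundaryCurve.
Context {R : realType}.
Notation point := 'rV[R]_2.
Notation dist := (@eucl_dist R).
Implicit Types (u p q k : point) (a b c r s t x y : R) (K : set point) (phi : R -> point).

Lemma dot_curve_continuous (A : set R) phi u : {within A, continuous phi} ->
  {within A, continuous (fun t => dot u (phi t))}.
Proof.
move=> h x.
exact: (@continuous_comp (subspace A) point R phi (dot u) x (h x) (@dot_continuous R u (phi x))).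
Qed.

Lemma ivt_cross (f : R -> R) a b c x y : {within `[a, b], continuous f} -> a <= x -> x < y -> y <= b ->
  (f x - c) * (f y - c) < 0 -> exists2 s, x < s < y & f s = c.
Proof.
move=> cf ax xy yb h.
have sub : `[x, y] `<=` (`[a, b] : set R).
  move=> t /=; rewrite !in_itv /= => /andP[xt ty].
  by rewrite (le_trans ax xt) (le_trans ty yb).
have [||s] := @IVT R f x y c (ltW xy).
- exact: continuous_subspaceW sub cf.
- by rewrite ge_min le_max; apply/andP; split; apply/orP; case: (lerP (f x) c) => h1; case: (lerP (f y) c) => h2; try (by left); try (by right); try (by left; lra); try (by right; lra); exfalso; nra.
rewrite in_itv /= => /andP[xs sy] fs; exists s => //.
rewrite !lt_neqAle xs sy !andbT; apply/andP; split; apply/eqP => e.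
  by move: h; rewrite e fs subrr mul0r ltxx.
by move: h; rewrite -e fs subrr mulr0 ltxx.
Qed.

Lemma supp_bounds K k0 k u : compact K -> K k0 -> K k -> - supp K (- u) <= dot u k <= supp K u.
Proof.
move=> cK Kk0 Kk; rewrite (supp_ge cK Kk0) // andbT lerNl -dotNl.
exact: (supp_ge cK Kk0).
Qed.

Lemma level_between (x1 x2 y1 y2 : R) : x1 < y1 -> x1 < y2 -> x2 < y1 -> x2 < y2 ->
  exists h, [/\ x1 < h, x2 < h, h < y1 & h < y2].
Proof.
move=> h11 h12 h21 h22; have : Num.max x1 x2 < Num.min y1 y2 by rewrite gt_max !lt_min h11 h12 h21.
move=> /midf_lt[]; set h := _ / _; rewrite gt_max lt_min => /andP[? ?] /andP[? ?].
by exists h.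
Qed.

(** An oscillation would cross some line through [K] three times. By [boundary_line] two crossings
    coincide, and then the curve would have to rest there in between. Returns are excluded for inner
    parameters only, which admits closed curves. *)
Lemma boundary_curve_le K k0 a b phi (ts : seq R) : compact K -> convex_set K -> K k0 ->
  {within `[a, b], continuous phi} ->
  (forall t, a <= t <= b -> boundary K (phi t)) ->
  (forall s r t, a < s -> s < r -> r < t -> t < b -> phi s = phi t -> phi r = phi s) ->
  path <%R a ts -> last a ts = b ->
  tot dist (phi a) (map phi ts) + dist (phi a) (phi b) <= cauchy_per K.
Proof.
move=> cK vK Kk0 cphi bphi norev pts lts.
have bdK p : boundary K p -> K p by rewrite boundaryE // => -[].
pose L := edges (phi a) (map phi ts) ++ [:: (1, phi a - phi b)].
have -> : tot dist (phi a) (map phi ts) + dist (phi a) (phi b) = nrmsum L.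
  by rewrite nrmsum_edges nrmsum_cons nrmsum_nil /= mul1r addr0 distE.
apply: (cauchy_per_ge cK Kk0) => u.
rewrite dotsum_edges dotsum_cons dotsum_nil /= mul1r addr0 dotBr.
have tab : {in a :: ts, forall t, a <= t <= b}.
  move=> t; have s1 : sorted <=%R (a :: ts) by apply: (sub_path _ pts) => ? ?; exact: ltW.
  move=> tin; rewrite -lts; apply/andP; split.
    move: tin; rewrite in_cons => /orP[/eqP ->//|]; move: s1; rewrite /= path_sortedE; last exact: le_trans.
    by move=> /andP[/allP h _] /h.
  case/splitPl: tin s1 => p1 p2 e; rewrite last_cat e /= cat_path e => /andP[_ h].
  have := mem_last t p2; rewrite in_cons => /orP[/eqP ->//|].
  by move: h; rewrite path_sortedE; [move=> /andP[/allP h _] /h|exact: le_trans].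
have := @closed_unimodal R R (fun t => dot u (phi t)) a ts (supp K u) (- supp K (- u)).
rewrite lts => um; have -> : fvar u (phi a) (map phi ts) = tot (@absd R) (dot u (phi a)) (map (fun t => dot u (phi t)) ts).
  by rewrite /fvar -map_comp.
have absw : absd (supp K u) (- supp K (- u)) = width K u.
  rewrite /absd opprK ger0_norm //; have := width_ge cK Kk0 u Kk0 Kk0; rewrite subrr //.
rewrite -absw; apply: um; last first.
  by move=> t /tab/bphi/bdK; exact: supp_bounds cK Kk0.
move=> c b0 t1 t2 t3 t4 sub; apply/negP => /and5P[/eqP a1 /eqP a2 /eqP a3 /eqP a4 _].
have : sorted <%R [:: t1; t2; t3; t4] by apply: subseq_sorted sub pts; exact: lt_trans.
move=> /and4P[t12 t23 t34 _].
have in1 : t1 \in a :: ts by apply: (mem_subseq sub); rewrite !in_cons eqxx.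
have in2 : t2 \in a :: ts by apply: (mem_subseq sub); rewrite !in_cons eqxx !orbT.
have in3 : t3 \in a :: ts by apply: (mem_subseq sub); rewrite !in_cons eqxx !orbT.
have in4 : t4 \in a :: ts by apply: (mem_subseq sub); rewrite !in_cons eqxx !orbT.
have /andP[t1a t1b] := tab _ in1; have /andP[t2a t2b] := tab _ in2.
have /andP[t3a t3b] := tab _ in3; have /andP[t4a t4b] := tab _ in4.
have cf := @dot_curve_continuous `[a, b]%classic phi u cphi; set f := fun t => dot u (phi t) in a1 a2 a3 a4 cf.
(* Low values may equal [c], so [c'] is taken strictly between the low and the high values. *)
have [c' [h1 h2 h3]] : exists c', [/\ (f t1 - c') * (f t2 - c') < 0, (f t2 - c') * (f t3 - c') < 0 &
    (f t3 - c') * (f t4 - c') < 0].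
  case: b0 a1 a2 a3 a4 => /= a1 a2 a3 a4.
    move/negbT: a2; rewrite -leNgt => a2; move/negbT: a4; rewrite -leNgt => a4.
    have [c' [l2 l4 l1 l3]] := level_between (le_lt_trans a2 a1) (le_lt_trans a2 a3) (le_lt_trans a4 a1) (le_lt_trans a4 a3).
    by exists c'; split; [rewrite pmulr_rlt0|rewrite nmulr_rlt0|rewrite pmulr_rlt0]; rewrite ?subr_gt0 ?subr_lt0.
  move/negbT: a1; rewrite -leNgt => a1; move/negbT: a3; rewrite -leNgt => a3.
  have [c' [l1 l3 l2 l4]] := level_between (le_lt_trans a1 a2) (le_lt_trans a1 a4) (le_lt_trans a3 a2) (le_lt_trans a3 a4).
  by exists c'; split; [rewrite nmulr_rlt0|rewrite pmulr_rlt0|rewrite nmulr_rlt0]; rewrite ?subr_gt0 ?subr_lt0.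
have [s1 /andP[s11 s12] e1] := ivt_cross cf t1a t12 t2b h1.
have [s2 /andP[s21 s22] e2] := ivt_cross cf t2a t23 t3b h2.
have [s3 /andP[s31 s32] e3] := ivt_cross cf t3a t34 t4b h3.
have f2n : f t2 != c' by apply: contraTneq h1 => ->; rewrite subrr mulr0 ltxx.
have f3n : f t3 != c' by apply: contraTneq h2 => ->; rewrite subrr mulr0 ltxx.
have t13 := lt_trans t12 t23; have t24 := lt_trans t23 t34.
have bd s : t1 < s -> s < t4 -> boundary K (phi s).
  by move=> l r; apply: bphi; rewrite (le_trans t1a (ltW l)) (le_trans (ltW r) t4b).
have Kt t : a <= t <= b -> K (phi t) by move=> /bphi/bdK.
have line k k' : K k -> K k' -> dot u k < c' -> c' < dot u k' ->
    [\/ phi s1 = phi s2, phi s1 = phi s3 | phi s2 = phi s3].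
  move=> Kk Kk' hk hk'; apply: (@boundary_line _ K u (phi s1) (phi s2) (phi s3) k k') => //.
  - exact: bd s11 (lt_trans s12 t24).
  - exact: bd (lt_trans t12 s21) (lt_trans s22 t34).
  - exact: bd (lt_trans t13 s31) s32.
  - by rewrite -[dot u (phi s1)]/(f s1) e1.
  - by rewrite -[dot u (phi s1)]/(f s1) e1.
  - by rewrite -[LHS]/(f s2) -[RHS]/(f s1) e1.
  - by rewrite -[LHS]/(f s3) -[RHS]/(f s1) e1.
have K2 : K (phi t2) by apply: Kt; rewrite t2a t2b.
have K3 : K (phi t3) by apply: Kt; rewrite t3a t3b.
have {line} line : [\/ phi s1 = phi s2, phi s1 = phi s3 | phi s2 = phi s3].
  have [l2|l2] := ltrP (f t2) c'.
    by apply: (line (phi t2) (phi t3)) => //; rewrite -/(f t3); move: h2; rewrite nmulr_rlt0 ?subr_lt0 // subr_gt0.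
  have l2' : c' < f t2 by rewrite lt_neqAle eq_sym f2n.
  by apply: (line (phi t3) (phi t2)) => //; rewrite -/(f t3); move: h2; rewrite pmulr_rlt0 ?subr_gt0 // subr_lt0.
case: line => e.
- have E : phi t2 = phi s1 by apply: (norev s1 t2 s2) => //; [exact: le_lt_trans t1a s11|exact: lt_le_trans s22 t3b].
  by move: f2n; rewrite -e1 /f E eqxx.
- have E : phi t2 = phi s1 by apply: (norev s1 t2 s3) => //;
    [exact: le_lt_trans t1a s11|exact: lt_trans t23 s31|exact: lt_le_trans s32 t4b].
  by move: f2n; rewrite -e1 /f E eqxx.
- have E : phi t3 = phi s2 by apply: (norev s2 t3 s3) => //; [exact: le_lt_trans t2a s21|exact: lt_le_trans s32 t4b].
  by move: f3n; rewrite -e2 /f E eqxx.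
Qed.

End BoundaryCurve.

(** * The perimeter of a convex figure *)

Section Gauge.
Context {R : realType}.
Notation point := 'rV[R]_2.
Notation dist := (@eucl_dist R).
Implicit Types (u v w z k : point) (s t x y e : R).

Lemma circ_inj x y : `|x - y| < pi *+ 2 -> circ x = circ y -> x = y.
Proof.
move=> h e; pose z := (x - y) / 2.
have exy : x - y = z + z by rewrite /z; field.
have e0 := congr1 (fun v : point => v 0 0) e; have e1 := congr1 (fun v : point => v 0 1) e.
rewrite /circ !pt0 in e0; rewrite /circ !pt1 in e1.
have : cos (x - y) = 1 by rewrite cosB e0 e1 -!expr2 cos2Dsin2.
rewrite exy cosD -!expr2 => c2; have := cos2Dsin2 z => s2.
have sz : sin z = 0 by apply/eqP; rewrite -sqrf_eq0; apply/eqP; lra.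
have {h} : `|z + z| < pi + pi by rewrite -exy -mulr2n.
rewrite ltr_norml => /andP[z1 z2].
have [z0|z0|z0] := ltgtP z 0; last by apply/eqP; rewrite -subr_eq0 exy z0 addr0.
  have : 0 < sin (- z) by apply: sin_gt0_pi; apply/andP; split; lra.
  by rewrite sinN sz oppr0 ltxx.
have : 0 < sin z by apply: sin_gt0_pi; apply/andP; split; lra.
by rewrite sz ltxx.
Qed.

Variable K : set point.
Hypotheses (cK : compact K) (vK : convex_set K).
Variables (c : point) (r : R).
Hypotheses (r_gt0 : 0 < r) (hB : forall z, dist c z <= r -> K z).
Let Kc : K c. Proof. by apply: hB; rewrite distxx ltW. Qed.

Let h u := supp K u - dot u c.
Let h_ge u : r * nrm u <= h u.
Proof. by rewrite lerBrDl; apply: supp_ball; rewrite // ltW. Qed.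
Let h_gt0 u : u != 0 -> 0 < h u.
Proof. by move=> u0; apply: lt_le_trans (h_ge u); rewrite mulr_gt0 // nrm_gt0. Qed.

(** The Minkowski gauge of [K] about [c], written through the support function [h] of the translate
    of [K] by [- c]. *)
Definition gauge v : R := sup [set dot u v / h u | u in [set u | u != 0]].

Let e1_neq0 : pt 1 0 != 0 :> point.
Proof. by apply/eqP => /(congr1 (fun v : point => v 0 0)); rewrite pt0 mxE => /eqP; rewrite oner_eq0. Qed.

Let ratio_le u v : u != 0 -> dot u v / h u <= nrm v / r.
Proof.
move=> u0; rewrite ler_pdivrMr ?h_gt0 // mulrAC ler_pdivlMr //.
apply: le_trans (_ : nrm u * nrm v * r <= _); first by rewrite ler_pM2r // dot_le_nrm.
have : nrm v * (r * nrm u) <= nrm v * h u by rewrite ler_wpM2l ?nrm_ge0.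
lra.
Qed.

Lemma gauge_ge u v : u != 0 -> dot u v <= gauge v * h u.
Proof.
move=> u0; rewrite -ler_pdivrMr ?h_gt0 //; apply: ub_le_sup; last by exists u.
by exists (nrm v / r) => _ [w /= w0 <-]; exact: ratio_le.
Qed.

Lemma gauge_le v x : (forall u, u != 0 -> dot u v <= x * h u) -> gauge v <= x.
Proof.
move=> hx; apply: ge_sup; first by exists (dot (pt 1 0) v / h (pt 1 0)), (pt 1 0).
by move=> _ [u /= u0 <-]; rewrite ler_pdivrMr ?h_gt0 // hx.
Qed.

Lemma gauge_nrm v : gauge v <= nrm v / r.
Proof. by apply: gauge_le => u u0; rewrite -ler_pdivrMr ?h_gt0 // ratio_le. Qed.

Lemma gaugeD v w : gauge (v + w) <= gauge v + gauge w.
Proof. by apply: gauge_le => u u0; rewrite dotDr mulrDl lerD // gauge_ge. Qed.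

Lemma gaugeZ t v : 0 < t -> gauge (t *: v) = t * gauge v.
Proof.
move=> t0; apply/eqP; rewrite eq_le; apply/andP; split.
  by apply: gauge_le => u u0; rewrite dotZr -mulrA ler_pM2l // gauge_ge.
rewrite -ler_pdivlMl //; apply: gauge_le => u u0.
by rewrite -mulrA ler_pdivlMl // -dotZr gauge_ge.
Qed.

Lemma gauge_continuous : continuous gauge.
Proof.
have hl v w : gauge v - gauge w <= r^-1 * nrm (v - w).
  have e : w + (v - w) = v by rewrite addrC subrK.
  by have := gaugeD w (v - w); have := gauge_nrm (v - w); rewrite e mulrC; lra.
apply: (@lipschitz_continuous _ _ r^-1) => v w; rewrite ler_norml hl andbT lerNl opprB.
by rewrite -[v - w]opprB nrmN hl.
Qed.

Lemma gauge_gt0 v : v != 0 -> 0 < gauge v.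
Proof.
move=> v0; have := gauge_ge v v0 => hv.
by rewrite -(pmulr_lgt0 _ (h_gt0 v0)); apply: lt_le_trans hv; exact: dot_sq_gt0.
Qed.

Lemma gauge_mem v : K (c + v) <-> gauge v <= 1.
Proof.
split=> [Kv|gv].
  apply: gauge_le => u u0; rewrite mul1r lerBrDl -dotDr; exact: (supp_ge cK Kc).
apply: contrapT => nK; have [|u hu] := separation cK vK _ nK; first by exists c.
have [k Kk [ek _]] := suppP cK Kc u; have := hu _ Kk; rewrite -ek dotDr => hs.
have u0 : u != 0 by apply: contraTneq hs => u0; rewrite ek u0 !dot0l addr0 ltxx.
have := gauge_ge v u0.
have : gauge v * h u <= h u by rewrite ler_piMl // ltW // h_gt0.
rewrite /h; lra.
Qed.

Lemma gauge_boundary v : boundary K (c + v) <-> gauge v = 1.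
Proof.
rewrite boundaryE //; split=> [[Kv nKv]|gv].
  apply/eqP; rewrite eq_le; move/gauge_mem: Kv => -> /=; rewrite leNgt; apply/negP => g1.
  apply: nKv; rewrite /interior; near=> z.
  have -> : z = c + (z - c) by rewrite addrC subrK.
  apply/gauge_mem/ltW; near: z; apply: (@near_lt _ (fun z => gauge (z - c))).
    move=> z; apply: (@continuous_comp _ _ _ (fun z => z - c) gauge); last exact: gauge_continuous.
    by apply: (@continuousB _ _ _ id (fun=> c)); [exact: cvg_id|exact: cst_continuous].
  by rewrite addrC addKr.
have v0 : v != 0.
  apply: contra_eq_neq gv => ->; rewrite lt_eqF // (le_lt_trans (gauge_nrm 0)) //.
  by rewrite nrm0 mul0r ltr01.
split; first by apply/gauge_mem; rewrite gv.
move=> /interior_ball[e e0 he].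
have nv : 0 < nrm v by rewrite nrm_gt0.
have : K (c + (1 + e / nrm v) *: v).
  apply: he; rewrite distC distE.
  have -> : c + (1 + e / nrm v) *: v - (c + v) = (e / nrm v) *: v.
    by apply: pt_eq; rewrite !mxE; ring.
  by rewrite nrmZ ger0_norm ?divfK ?gt_eqF // divr_ge0 // ltW.
move/gauge_mem; rewrite gaugeZ; last by rewrite addr_gt0 // divr_gt0.
rewrite gv mulr1 gerDl leNgt => /negP; apply; exact: divr_gt0.
Unshelve. all: by end_near.
Qed.

(** The unit circle is projected radially from [c] onto the boundary. *)
Lemma boundary_param : exists psi, simple_closed_param psi (boundary K).
Proof.
pose w t := circ (t * (pi *+ 2)) : point.
have w1 t : dot (w t) (w t) = 1 by rewrite /w /circ /dot !pt0 !pt1 -!expr2 cos2Dsin2.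
have w0 t : w t != 0 by rewrite -dot_sq_eq0 w1 oner_eq0.
have wn t : nrm (w t) = 1 by rewrite /nrm w1 sqrtr1.
have p2 := @pi2_gt0 R.
pose psi t := c + (gauge (w t))^-1 *: w t.
have bd t : boundary K (psi t).
  by apply/gauge_boundary; rewrite gaugeZ ?invr_gt0 ?gauge_gt0 // mulVf // gt_eqF ?gauge_gt0.
have cw : continuous w.
  move=> t; apply: (@continuous_comp _ _ _ (fun t => t * (pi *+ 2)) (@circ R)); last exact: circ_continuous.
  by apply: (@continuousM _ _ id (fun=> pi *+ 2)); [exact: cvg_id|exact: cst_continuous].
have cpsi : continuous psi.
  move=> t; apply: (@continuousD _ _ _ (fun=> c) (fun t => (gauge (w t))^-1 *: w t)).
    exact: cst_continuous.
  apply: (@continuousZ _ _ _ (fun t => (gauge (w t))^-1) w); last exact: cw.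
  apply: (@continuousV _ _ (fun t => gauge (w t))); first by rewrite gt_eqF ?gauge_gt0.
  by apply: (@continuous_comp _ _ _ w gauge); [exact: cw|exact: gauge_continuous].
exists psi; split.
- exact: continuous_subspaceT.
- have e : circ (pi *+ 2) = circ 0 :> point by rewrite -{1}[pi *+ 2]add0r circ_periodic.
  by rewrite /psi /w mul0r mul1r e.
- move=> s t; rewrite !in_itv /= => /andP[s0 s1] /andP[t0 t1] /addrI e.
  have gs := gauge_gt0 (w0 s); have gt := gauge_gt0 (w0 t).
  have := congr1 (@nrm R) e; rewrite !nrmZ !wn !mulr1 !gtr0_norm ?invr_gt0 // => /invr_inj ge.
  move: e; rewrite ge => /(scalerI _); rewrite invr_neq0 ?gt_eqF // => /(_ isT) e.
  have : s * (pi *+ 2) = t * (pi *+ 2).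
    apply: circ_inj => //; rewrite -mulrBl normrM (gtr0_norm p2) -[ltRHS]mul1r ltr_pM2r //.
    by rewrite ltr_norml; apply/andP; split; lra.
  by move=> /mulIf; apply; rewrite gt_eqF.
- apply/seteqP; split=> [_ [t _ <-]//|z bz].
  have ez : z = c + (z - c) by rewrite addrC subrK.
  have gz : gauge (z - c) = 1 by apply/gauge_boundary; rewrite -ez.
  have z0 : z - c != 0.
    apply: contra_eq_neq gz => ->; rewrite lt_eqF // (le_lt_trans (gauge_nrm 0)) //.
    by rewrite nrm0 mul0r ltr01.
  have nz : 0 < nrm (z - c) by rewrite nrm_gt0.
  have [|t /andP[t0 t1] et] := @circ_surj R ((nrm (z - c))^-1 *: (z - c)).
    by rewrite dotZl dotZr -sqr_nrm; field; rewrite gt_eqF.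
  suff [t' [t'01 wt']] : exists t', 0 <= t' <= 1 /\ w t' = circ t.
    exists t'; rewrite /= ?in_itv //= /psi wt' -et gaugeZ ?invr_gt0 // gz mulr1 invrK scalerA.
    by rewrite divff ?gt_eqF // scale1r addrC subrK.
  have p2' : pi *+ 2 = pi + pi :> R by rewrite mulr2n.
  have p0 := pi_gt0 R.
  have [h0|h0] := lerP 0 t.
    exists (t / (pi *+ 2)); split; last by rewrite /w divfK // gt_eqF.
    by rewrite divr_ge0 ?(ltW p2) //= ler_pdivrMr // p2'; lra.
  exists ((t + pi *+ 2) / (pi *+ 2)); split; last by rewrite /w divfK ?gt_eqF // circ_periodic.
  by rewrite divr_ge0 ?(ltW p2) ?p2' //= ?ler_pdivrMr -?p2' // p2'; lra.
Qed.

End Gauge.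

Section Perimeter.
Context {R : realType}.
Notation point := 'rV[R]_2.
Notation dist := (@eucl_dist R).
Implicit Types (u v w x y z k : point) (s t : R) (K : set point).

Lemma segment_l x y : line_segment x y x.
Proof. by apply/line_segmentP; exists 0; rewrite ?lexx ?ler01 ?mid0. Qed.
Lemma segment_r x y : line_segment x y y.
Proof. by apply/line_segmentP; exists 1; rewrite ?lexx ?ler01 ?mid1. Qed.

Lemma segment_cauchy_per x y : compact (line_segment x y) ->
  cauchy_per (line_segment x y) = 2 * dist x y.
Proof.
move=> cK; have Kx := segment_l x y; have Ky := segment_r x y.
have eL : 2 * dist x y = nrmsum [:: (2, x - y)] by rewrite nrmsum_cons nrmsum_nil addr0 distE.
rewrite eL; apply/eqP; rewrite eq_le; apply/andP; split.
  apply: (cauchy_per_le cK Kx) => u; rewrite dotsum_cons dotsum_nil addr0 /= ler_pM2l //.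
  have [k [k' [/line_segmentP[s /andP[s0 s1] ->] /line_segmentP[t /andP[t0 t1] ->] ->]]] := widthP cK Kx u.
  rewrite !dot_mid dotBr; set p := dot u x; set q := dot u y.
  have -> : (1 - s) * p + s * q - ((1 - t) * p + t * q) = (t - s) * (p - q) by ring.
  apply: le_trans (ler_norm _) _; rewrite normrM ler_piMl // ler_norml; lra.
apply: (cauchy_per_ge cK Kx) => u; rewrite dotsum_cons dotsum_nil addr0 /= ler_pM2l //.
rewrite dotBr ler_norml.
by have := width_ge cK Kx u Kx Ky; have := width_ge cK Kx u Ky Kx; lra.
Qed.

(** By [triangle_interior] all of [K] lies on one line; [x] and [y] are its extreme points there. *)
Lemma empty_interior_segment K : compact K -> convex_set K -> K !=set0 -> ~ (K° !=set0) ->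
  exists x y, K = line_segment x y.
Proof.
move=> cK vK [k0 Kk0] nK.
have sub x y : K x -> K y -> line_segment x y `<=` K.
  by move=> Kx Ky z /line_segmentP[t t01 ->]; apply: convex_mid.
have [[k [Kk kk0]]|all] := pselect (exists k, K k /\ k != k0); last first.
  exists k0, k0; apply/seteqP; split=> [z Kz|]; last exact: sub.
  have -> : z = k0 by apply: contrapT => /eqP h; apply: all; exists z.
  exact: segment_l.
pose e := k - k0; have e0 : e != 0 by rewrite subr_eq0.
have line z : K z -> z - k0 = (dot e (z - k0) / dot e e) *: e.
  move=> Kz; apply: cross0_colinear => //; apply/eqP/negPn/negP => h.
  by apply: nK; exact: (triangle_interior vK Kk0 Kk Kz h).
have [y Ky [ey hy]] := suppP cK Kk0 e; have [x Kx [ex hx]] := suppP cK Kk0 (- e).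
exists x, y; apply/seteqP; split=> [z Kz|]; last exact: sub.
have ee : 0 < dot e e by exact: dot_sq_gt0.
have hz1 := hy _ Kz; have hz2 := hx _ Kz; rewrite ey in hz1; rewrite ex !dotNl in hz2.
have onl p q : K p -> K q -> q - p = ((dot e q - dot e p) / dot e e) *: e.
  move=> Kp Kq; have -> : q - p = (q - k0) - (p - k0) by apply: pt_eq; rewrite !mxE; ring.
  rewrite (line p Kp) (line q Kq) -scalerBl -mulrBl; congr (_ / _ *: _).
  by rewrite !dotBr; ring.
have [xy|xy] := eqVneq (dot e x) (dot e y).
  have -> : z = x.
    apply/eqP; rewrite -subr_eq0 (onl _ _ Kx Kz) (_ : dot e z - dot e x = 0) ?mul0r ?scale0r //.
    lra.
  exact: segment_l.
have d0 : dot e y - dot e x != 0 by rewrite subr_eq0 eq_sym.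
have dp : 0 < dot e y - dot e x by rewrite lt0r d0; lra.
apply/line_segmentP; exists ((dot e z - dot e x) / (dot e y - dot e x)).
  by rewrite divr_ge0 ?ler_pdivrMr //=; lra.
apply/eqP; rewrite -subr_eq0 /mid opprD addrA (onl _ _ Kx Kz) (onl _ _ Kx Ky) scalerA -scalerBl.
have -> : (dot e z - dot e x) / dot e e -
    (dot e z - dot e x) / (dot e y - dot e x) * ((dot e y - dot e x) / dot e e) = 0.
  by field; rewrite d0 gt_eqF.
by rewrite scale0r.
Qed.

Lemma boundary_dominates K k0 : compact K -> K k0 -> dominates (boundary K) K.
Proof.
move=> cK Kk0; have bd u : u != 0 -> exists2 x, boundary K x & forall k, K k -> dot u k <= dot u x.
  move=> u0; have [x Kx [ex hx]] := suppP cK Kk0 u.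
  exists x; last by move=> k /hx; rewrite ex.
  rewrite boundaryE //; split => // ix.
  by have := interior_supp cK ix u0; rewrite ex ltxx.
move=> u k Kk; have [->|/bd[x bx hx]] := eqVneq u 0; last by exists x => //; apply: hx.
have [|x bx _] := bd (pt 1 0); last by exists x; rewrite ?dot0l.
by apply/eqP => /(congr1 (fun v : point => v 0 0)); rewrite pt0 mxE => /eqP; rewrite oner_eq0.
Qed.

Lemma simple_closed_length K c psi : compact K -> convex_set K -> K° c ->
  simple_closed_param psi (boundary K) -> curve_length 0 1 psi = (cauchy_per K)%:E.
Proof.
move=> cK vK Kc [cpsi e01 inj im].
have Kc' : K c by exact: interior_subset Kc.
have up : (curve_length 0 1 psi <= (cauchy_per K)%:E)%E.
  apply: curve_length_le => s ps ls.
  have := @boundary_curve_le R K c 0 1 psi s cK vK Kc' cpsi _ _ ps ls.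
  rewrite e01 distxx addr0; apply.
    by move=> t t01; rewrite -im; exists t => //=; rewrite in_itv.
  move=> s' r t s0 sr rt t1 e; exfalso.
  have : s' = t by apply: inj e; rewrite in_itv /=; apply/andP; split; lra.
  lra.
have lo := @curve_length_ge0 R 0 1 psi ler01.
have fin : curve_length 0 1 psi \is a fin_num.
  by rewrite ge0_fin_numE //; apply: le_lt_trans up _; rewrite ltry.
have el : curve_length 0 1 psi = (fine (curve_length 0 1 psi))%:E by rewrite fineK.
have [r r0 hB] := interior_ball Kc.
have dom : dominates (psi @` `[0, 1]) K by rewrite im; exact: boundary_dominates Kc'.
have := closed_curve_inequality cK r0 hB ler01 cpsi dom el.
rewrite e01 distxx addr0 => h; apply/eqP; rewrite eq_le up /=.
by rewrite el lee_fin.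
Qed.

Lemma perimeterE K : convex_figure K -> perimeter K = (cauchy_per K)%:E.
Proof.
move=> [K0 cK vK].
have all l : perimeter_values K l -> l = (cauchy_per K)%:E.
  move=> [[[c Kc] [psi hpsi ->]]|[x [y [eK ->]]]].
    exact: (simple_closed_length cK vK Kc).
  by rewrite eK segment_cauchy_per // -eK.
have [l hl] : perimeter_values K !=set0.
  have [[c Kc]|nK] := pselect (K° !=set0); last first.
    have [x [y eK]] := empty_interior_segment cK vK K0 nK.
    by exists (2 * dist x y)%:E; right; exists x, y.
  have [r r0 hB] := interior_ball Kc.
  have [psi hpsi] := boundary_param cK vK r0 hB.
  by exists (curve_length 0 1 psi); left; split; [exists c|exists psi].
have eV : perimeter_values K = [set (cauchy_per K)%:E].
  by apply/seteqP; split=> [x /all -> //|_ ->]; rewrite -(all _ hl).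
by rewrite /perimeter eV ereal_inf1.
Qed.

End Perimeter.

(** * The equality case *)

Section EqualityCase.
Context {R : realType}.
Notation point := 'rV[R]_2.
Notation dist := (@eucl_dist R).
Lemma sorted_subseq (l s : seq R) : sorted <=%R s -> sorted <%R l -> {subset l <= s} -> subseq l s.
Proof.
elim: s l => [|x s ih] [|y l] // ss sl sub; first by have := sub y (mem_head _ _).
have xmin z : z \in s -> x <= z.
  by move: ss; rewrite /= path_sortedE; [move=> /andP[/allP h _] /h|exact: le_trans].
have ymin z : z \in l -> y < z.
  by move: sl; rewrite /= path_sortedE; [move=> /andP[/allP h _] /h|exact: lt_trans].
rewrite /=; case: eqP => [e|/eqP ne].
  apply: ih; [exact: path_sorted ss|exact: path_sorted sl|] => z zl.
  have := sub z; rewrite !in_cons zl orbT => /(_ isT) /orP[/eqP ez|//].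
  by have := ymin _ zl; rewrite e ez ltxx.
apply: ih => //; first exact: path_sorted ss.
have ys : y \in s by have := sub y; rewrite !in_cons eqxx (negbTE ne) => /(_ isT).
move=> z; rewrite in_cons => /orP[/eqP ->//|zl].
have := sub z; rewrite !in_cons zl orbT => /(_ isT) /orP[/eqP ez|//].
by have := lt_le_trans (ymin _ zl) _; rewrite ez => /(_ _ (xmin _ ys)); rewrite ltxx.
Qed.

Implicit Types (u v w p q z k : point) (s t x y : R).

Variable K : set point.
Hypotheses (cK : compact K) (vK : convex_set K).
Variables (c : point) (r : R).
Hypotheses (r_gt0 : 0 < r) (hB : forall z, dist c z <= r -> K z).
Let Kc : K c. Proof. by apply: hB; rewrite distxx ltW. Qed.
Variables (a b : R) (phi : R -> point) (l : R).
Hypotheses (ab : a <= b) (hphi : {within `[a, b], continuous phi}).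
Hypothesis dom : dominates (phi @` `[a, b]) K.
Hypothesis hl : curve_length a b phi = l%:E.
Hypothesis len_eq : l + dist (phi a) (phi b) = cauchy_per K.

Let T t := a <= t <= b.
Let Ta : T a. Proof. by rewrite /T lexx. Qed.
Let Tb : T b. Proof. by rewrite /T lexx andbT. Qed.

Let normalized u : u != 0 -> exists2 m : R, 0 < m & dot (m *: u) (m *: u) = 1.
Proof.
rewrite -nrm_gt0 => u0; exists (nrm u)^-1; first by rewrite invr_gt0.
by rewrite dotZl dotZr -sqr_nrm; field; rewrite gt_eqF.
Qed.

Let max0_continuous (g : point -> R) : continuous g -> continuous (fun u => 2 * Num.max 0 (g u)).
Proof.
move=> cg u; apply: (@continuousM _ _ (fun=> 2) (fun u => Num.max 0 (g u))); first exact: cst_continuous.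
by apply: (@continuous_max _ _ (fun=> 0) g); [exact: cst_continuous|exact: cg].
Qed.

Let dotl_continuous p : continuous (fun u => dot u p).
Proof.
have -> : (fun u => dot u p) = dot p by apply/funext => u; rewrite dotC.
exact: dot_continuous.
Qed.

(** A point of the curve outside [K] would force the closed curve to vary by more than twice the
    width of [K] in some direction. *)
Lemma curve_sub t : T t -> K (phi t).
Proof.
move=> Tt; apply: contrapT => nK; have [|u hu] := separation cK vK _ nK; first by exists c.
have u0 : u != 0 by apply: contraTneq (hu _ Kc) => ->; rewrite !dot0l ltxx.
have [m m0 um] := normalized u0.
(* The factor 2 counts the way out to [phi t] and the way back. *)
pose g v := 2 * Num.max 0 (dot v (phi t) - supp K v).
have cg : continuous g.
  apply: max0_continuous => v; apply: (@continuousB _ _ _ (fun v => dot v (phi t)) (supp K)).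
    exact: dotl_continuous.
  exact: (supp_continuous cK Kc).
have g0 v : 0 <= g v by rewrite mulr_ge0 // le_max lexx.
have gm : 0 < g (m *: u).
  rewrite mulr_gt0 // lt_max subr_gt0; apply/orP; right.
  have [k Kk [-> _]] := suppP cK Kc (m *: u).
  by rewrite !dotZl ltr_pM2l // hu.
have tsT : {in [:: t], forall t, a <= t <= b} by move=> t'; rewrite inE => /eqP ->.
suff : cauchy_per K < l + dist (phi a) (phi b) by rewrite len_eq ltxx.
apply: (curve_excess cK r_gt0 hB ab hphi dom hl cg g0 um gm tsT) => e s v /andP[e0 e1] ps ls sub hs.
rewrite -[b]ls -(last_map phi).
have [t1 t1s ht1] := hs (- v).
have ts : t \in a :: s by apply: sub; rewrite mem_head.
have m1 t' : t' \in a :: s -> phi t' \in phi a :: map phi s by move=> h; rewrite -map_cons map_f.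
rewrite /g; have [h|h] := lerP (dot v (phi t) - supp K v) 0.
  have [t2 [t3 [h2 h3 h4]]] := sample_width v hs.
  have := @fvar_closed R v _ _ _ _ (m1 _ h2) (m1 _ h3).
  have := ler_norm (dot v (phi t2) - dot v (phi t3)); rewrite /absd.
  by lra.
have := @fvar_closed R v _ _ _ _ (m1 _ ts) (m1 _ t1s).
have := ler_norm (dot v (phi t) - dot v (phi t1)); rewrite /absd.
have hc : 0 <= e * (supp K v - dot v c) by rewrite mulr_ge0 ?(ltW e0) // subr_ge0 (supp_ge cK Kc).
rewrite !dotNl in ht1; rewrite /width; lra.
Qed.

(* An oscillation across a line would make the curve strictly longer than necessary. *)
Lemma no_oscillation u (h t1 t2 t3 t4 : R) : T t1 -> T t4 -> t1 < t2 -> t2 < t3 -> t3 < t4 ->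
  dot u (phi t1) < h -> h < dot u (phi t2) -> dot u (phi t3) < h -> h < dot u (phi t4) -> False.
Proof.
move=> T1 T4 t12 t23 t34 h1 h2 h3 h4.
have u0 : u != 0 by apply: contraTneq (lt_trans h1 h2) => ->; rewrite !dot0l ltxx.
have [n n0 un] := normalized u0.
(* [M v - m v] is the gap across which the four points alternate in the direction [v]. It is
   continuous in [v] and positive for [u]. *)
pose m v := Num.max (dot v (phi t1)) (dot v (phi t3)).
pose M v := Num.min (dot v (phi t2)) (dot v (phi t4)).
have cg : continuous (fun v => 2 * Num.max 0 (M v - m v)).
  apply: max0_continuous => v; apply: (@continuousB _ _ _ M m).
    by apply: (@continuous_min _ _ (fun v => dot v (phi t2)) (fun v => dot v (phi t4))); exact: dotl_continuous.
  by apply: (@continuous_max _ _ (fun v => dot v (phi t1)) (fun v => dot v (phi t3))); exact: dotl_continuous.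
have g0 v : 0 <= 2 * Num.max 0 (M v - m v) by rewrite mulr_ge0 // le_max lexx.
have gn : 0 < 2 * Num.max 0 (M (n *: u) - m (n *: u)).
  rewrite mulr_gt0 // lt_max subr_gt0; apply/orP; right.
  rewrite /m /M !dotZl gt_max !lt_min !ltr_pM2l //.
  by rewrite (lt_trans h1 h2) (lt_trans h1 h4) (lt_trans h3 h2) (lt_trans h3 h4).
have tsT : {in [:: t1; t2; t3; t4], forall t, a <= t <= b}.
  have /andP[a1 b1] := T1; have /andP[a4 b4] := T4.
  by move=> t; rewrite !inE => /or4P[] /eqP ->; apply/andP; split; lra.
suff : cauchy_per K < l + dist (phi a) (phi b) by rewrite len_eq ltxx.
apply: (curve_excess cK r_gt0 hB ab hphi dom hl cg g0 un gn tsT) => e s v _ ps ls sub hs.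
rewrite -[b]ls -(last_map phi).
have m1 t' : t' \in a :: s -> phi t' \in phi a :: map phi s by move=> ht; rewrite -map_cons map_f.
have [t5 [t6 [ht5 ht6 hw]]] := sample_width v hs.
have nw := ler_norm (dot v (phi t5) - dot v (phi t6)).
have [mM|mM] := lerP (M v - m v) 0.
  have := @fvar_closed R v _ _ _ _ (m1 _ ht5) (m1 _ ht6); rewrite /absd.
  by lra.
have sub4 : subseq [:: t1; t2; t3; t4] (a :: s).
  by apply: sorted_subseq => //; rewrite /= t12 t23 t34.
have := @closed_tour_excess _ (dot v (phi a)) (map (dot v) (map phi s)) (dot v (phi t5)) (dot v (phi t6))
  (dot v (phi t1)) (dot v (phi t2)) (dot v (phi t3)) (dot v (phi t4)) (m v) (M v).
rewrite -!map_cons !map_f // !last_map => /(_ isT isT).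
rewrite -map_comp => /(_ (map_subseq (dot v \o phi) sub4)).
have e1 : dot v (phi t1) <= m v by rewrite le_max lexx.
have e3 : dot v (phi t3) <= m v by rewrite le_max lexx orbT.
have e2 : M v <= dot v (phi t2) by rewrite ge_min lexx.
have e4 : M v <= dot v (phi t4) by rewrite ge_min lexx orbT.
have mM' : m v <= M v by rewrite -subr_ge0 ltW.
move=> /(_ e1 e3 mM' e2 e4); rewrite /fvar -map_comp /absd; lra.
Qed.

Lemma no_oscillation' u (h t1 t2 t3 t4 : R) : T t1 -> T t4 -> t1 < t2 -> t2 < t3 -> t3 < t4 ->
  h < dot u (phi t1) -> dot u (phi t2) < h -> h < dot u (phi t3) -> dot u (phi t4) < h -> False.
Proof.
move=> T1 T4 t12 t23 t34 h1 h2 h3 h4.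
by apply: (@no_oscillation (- u) (- h) t1 t2 t3 t4) => //; rewrite dotNl ltrN2.
Qed.

End EqualityCase.

(** * A curve without oscillation and its chord cover the boundary *)

Section NoOscillation.
Context {R : realType}.
Notation point := 'rV[R]_2.
Notation dist := (@eucl_dist R).
Implicit Types (u v w p q z k e : point) (s t x y h : R).

Variable K : set point.
Hypotheses (cK : compact K) (vK : convex_set K).
Variables (k0 : point) (Kk0 : K k0).
Variables (a b : R) (phi : R -> point).
Hypotheses (ab : a <= b) (hphi : {within `[a, b], continuous phi}).
Hypothesis dom : dominates (phi @` `[a, b]) K.
Hypothesis subK : forall t, a <= t <= b -> K (phi t).
Hypothesis osc : forall u h t1 t2 t3 t4, a <= t1 <= b -> a <= t4 <= b -> t1 < t2 -> t2 < t3 -> t3 < t4 ->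
  dot u (phi t1) < h -> h < dot u (phi t2) -> dot u (phi t3) < h -> h < dot u (phi t4) -> False.
Hypothesis osc' : forall u h t1 t2 t3 t4, a <= t1 <= b -> a <= t4 <= b -> t1 < t2 -> t2 < t3 -> t3 < t4 ->
  h < dot u (phi t1) -> dot u (phi t2) < h -> h < dot u (phi t3) -> dot u (phi t4) < h -> False.

Let dominated u k : K k -> exists2 t, a <= t <= b & dot u k <= dot u (phi t).
Proof. by move=> /(dom u)[_ [t /= tab <-] hk]; exists t => //; rewrite in_itv in tab. Qed.

(** Without a supporting line at [p], the difference [supp K u - dot u p] would have a positive
    minimum over the unit circle, and a disc of that radius around [p] would lie in [K]. *)
Lemma supporting_line p : boundary K p -> exists2 u, u != 0 & forall k, K k -> dot u k <= dot u p.
Proof.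
rewrite boundaryE // => -[Kp nip]; apply: contrapT => nsupp; apply: nip.
pose g t := supp K (circ t) - dot (circ t) p.
have cg : continuous g.
  move=> t; apply: (@continuousB _ _ _ (fun t => supp K (circ t)) (fun t => dot (circ t) p)).
    apply: (@continuous_comp _ _ _ (@circ R) (supp K)); first exact: circ_continuous.
    exact: (supp_continuous cK Kk0).
  have -> : (fun t => dot (circ t) p) = (dot p \o circ) by apply/funext => s; rewrite /= dotC.
  by apply: continuous_comp; [exact: circ_continuous|exact: dot_continuous].
have [||t0] := @compact_EVT_min _ _ g `[- pi, pi]%classic _ (@segment_compact _ _ _).
- by exists 0; rewrite /= in_itv /= oppr_le0 pi_ge0.
- exact: continuous_subspaceT.
move=> _ hmin.
have g0 : 0 < g t0.
  rewrite subr_gt0; have [k Kk [ek hk]] := suppP cK Kk0 (circ t0).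
  rewrite ltNge; apply/negP => le; apply: nsupp; exists (circ t0).
    by rewrite -dot_sq_eq0 /circ /dot !pt0 !pt1 -!expr2 cos2Dsin2 oner_eq0.
  by move=> k' /hk h; apply: le_trans h le.
have gu u : dot u u = 1 -> g t0 <= supp K u - dot u p.
  by move=> /circ_surj[t tpi ->]; apply: hmin; rewrite inE /= in_itv.
rewrite /interior; near=> z.
have zp : dist p z < g t0 by near: z; exact: near_dist.
apply: contrapT => nKz; have [|u hu] := separation cK vK _ nKz; first by exists k0.
have u0 : u != 0 by apply: contraTneq (hu _ Kk0) => ->; rewrite !dot0l ltxx.
have un : 0 < nrm u by rewrite nrm_gt0.
have := gu ((nrm u)^-1 *: u).
rewrite dotZl dotZr -sqr_nrm => /(_ ltac:(by field; rewrite gt_eqF)).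
have [k Kk [-> _]] := suppP cK Kk0 ((nrm u)^-1 *: u).
rewrite !dotZl -mulrBr mulrC ler_pdivlMr //.
have := hu _ Kk; have := dot_le_nrm u (z - p); rewrite dotBr.
have : nrm u * nrm (z - p) < nrm u * g t0 by rewrite ltr_pM2l // -distE distC.
lra.
Unshelve. all: by end_near.
Qed.

(** Otherwise [u] could be tilted slightly towards [e] so that [p] exceeds the whole curve, although
    the curve dominates [K]. *)
Lemma support_both_sides p u e : boundary K p -> (forall t, a <= t <= b -> phi t != p) ->
  (forall k, K k -> dot u k <= dot u p) ->
  (forall z, dot u z = dot u p -> dot e z = dot e p -> z = p) ->
  exists2 t, a <= t <= b & dot u (phi t) = dot u p /\ dot e p < dot e (phi t).
Proof.
move=> bp np hu ue; apply: contrapT => nt.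
have Kp : K p by move: bp; rewrite boundaryE // => -[].
have cG := image_compact hphi.
have Ga : (phi @` `[a, b]) (phi a) by exists a => //=; rewrite in_itv /= lexx.
have [||z [t /= tab <-]|m m0 hm] := @compact_max_pos _ _ cG _ Ga (fun z => dot (- u) z + dot u p) (fun z => dot (- e) z + dot e p).
- exact: affine_fun_dot.
- exact: affine_fun_dot.
- rewrite in_itv /= in tab; rewrite !dotNl.
  have := hu _ (subK tab); rewrite le_eqVlt => /orP[/eqP h|h]; [right|left; lra].
  have [l|l] := ltrP (dot e (phi t)) (dot e p); first by lra.
  exfalso; move: l; rewrite le_eqVlt => /orP[/eqP l|l]; last by apply: nt; exists t.
  by have := np t tab; rewrite (ue (phi t) h (esym l)) eqxx.
have [y [ty /= tyab <-] hy] := @compact_argmax _ _ cG _ Ga (dot e) (@dot_continuous _ e).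
(* [N] exceeds the advance of the curve beyond [p] along [e], so tilting by [m / N] raises no point
   by [m] relative to [p]. *)
pose N := 1 + `|dot e (phi ty) - dot e p|.
have N0 : 0 < N by rewrite ltr_wpDr.
have [t tab] := dominated (u + (m / N) *: e) Kp.
rewrite !dotDl !dotZl => ht.
have Gt : (phi @` `[a, b]) (phi t) by exists t => //=; rewrite in_itv.
have hN : dot e (phi t) - dot e p < N.
  apply: le_lt_trans (_ : dot e (phi ty) - dot e p < N); first by rewrite lerD2r hy.
  by rewrite /N; have := ler_norm (dot e (phi ty) - dot e p); lra.
have mN : 0 < m / N by rewrite divr_gt0.
have := hu _ (subK tab); case: (hm _ Gt); rewrite !dotNl => h1 h2.
  have : m / N * (dot e (phi t) - dot e p) < m / N * N by rewrite ltr_pM2l.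
  by rewrite divfK ?gt_eqF //; lra.
have : m / N * (dot e (phi t) - dot e p) < 0 by rewrite pmulr_rlt0 //; lra.
lra.
Qed.

Let strict_below p u : (forall t, a <= t <= b -> phi t != p) -> (forall k, K k -> dot u k <= dot u p) ->
  forall e, (forall z, dot u z = dot u p -> dot e z = dot e p -> z = p) ->
  forall t, a <= t <= b -> dot e (phi t) = dot e p -> dot u (phi t) < dot u p.
Proof.
move=> np hu e ue t tab et; rewrite lt_neqAle (hu _ (subK tab)) andbT.
by apply: contraNneq (np t tab) => h; apply/eqP; exact: ue.
Qed.

Lemma boundary_sub p : boundary K p -> (exists2 t, a <= t <= b & phi t = p) \/ line_segment (phi a) (phi b) p.
Proof.
move=> bp; apply: contrapT => /not_orP[nt nAB].
have np t : a <= t <= b -> phi t != p by move=> tab; apply/eqP => h; apply: nt; exists t.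
have [u u0 hu] := supporting_line bp.
have uniq0 e : dot u e = 0 -> e != 0 -> forall z, dot u z = dot u p -> dot e z = dot e p -> z = p.
  move=> ue e0 z h1 h2; apply/eqP; rewrite -subr_eq0 -dot_sq_eq0; apply/eqP.
  have D : cross u e != 0.
    by rewrite -sqrf_eq0; have := lagrange u e; rewrite ue expr0n add0r => ->; rewrite mulf_neq0 ?dot_sq_eq0.
  rewrite {1}(cramer (z - p) D) dotDl !dotZl !dotBr h1 h2 !subrr !mulr0 addr0 //.
have e0 : rot u != 0.
  by rewrite -dot_sq_eq0 (_ : dot (rot u) (rot u) = dot u u) ?dot_sq_eq0 // /dot !rot0 !rot1; ring.
have ue : dot u (rot u) = 0 by rewrite dotC -crossE cross_self.
have ub := uniq0 _ ue e0.
have un : forall z, dot u z = dot u p -> dot (- rot u) z = dot (- rot u) p -> z = p.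
  by apply: uniq0; rewrite ?oppr_eq0 // dotNr ue oppr0.
(* Along the support line the curve visits both sides of [p], so it must dive below the line twice. *)
have main e s s' : (forall z, dot u z = dot u p -> dot e z = dot e p -> z = p) -> a <= s -> s' <= b -> s < s' ->
    dot u (phi s) = dot u p -> dot u (phi s') = dot u p -> dot e (phi s) < dot e p -> dot e p < dot e (phi s') -> False.
  move=> ue' sa sb' ss us us' es es'.
  have ce := @dot_curve_continuous _ `[a, b]%classic phi e hphi.
  have below := strict_below np hu ue'.
  have [t1 /andP[st1 t1s] et1] : exists2 t, s < t < s' & dot e (phi t) = dot e p.
    by apply: (ivt_cross ce) => //; rewrite nmulr_rlt0 ?subr_gt0 ?subr_lt0.
  have u1 : dot u (phi t1) < dot u p by apply: below et1; lra.
  (* Either the curve meets the level of [p] along [e] again outside the interval from [s] to [s'],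
     or the chord of its ends does. The chord meets it strictly below the support line, so one end
     of the curve lies below. *)
  have [t2 [t2ab u2 t2o]] : exists t2, [/\ a <= t2 <= b, dot u (phi t2) < dot u p & t2 < s \/ s' < t2].
    have ua : a <= a <= b by rewrite lexx.
    have ubb : a <= b <= b by rewrite lexx andbT.
    have [eb|eb] := lerP (dot e (phi b)) (dot e p).
      have sb : s' < b.
        by rewrite lt_neqAle sb' andbT; apply: contraTneq es' => ->; rewrite -leNgt.
      move: eb; rewrite le_eqVlt => /orP[/eqP eb|eb].
        by exists b; split => //; [exact: below|right].
      have [|t /andP[h1 h2] et] := ivt_cross ce (le_trans sa (ltW ss)) sb (lexx b) (c := dot e p).
        by rewrite pmulr_rlt0 ?subr_gt0 ?subr_lt0.
      have tab : a <= t <= b by rewrite (le_trans (le_trans sa (ltW ss)) (ltW h1)) ltW.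
      by exists t; split => //; [exact: below|right].
    have [ea|ea] := lerP (dot e p) (dot e (phi a)).
      have sa' : a < s.
        by rewrite lt_neqAle sa andbT; apply: contraTneq es => <-; rewrite -leNgt.
      move: ea; rewrite le_eqVlt => /orP[/eqP ea|ea].
        by exists a; split => //; [exact: below|left].
      have [|t /andP[h1 h2] et] := ivt_cross ce (lexx a) sa' (le_trans (ltW ss) sb') (c := dot e p).
        by rewrite pmulr_rlt0 ?subr_gt0 ?subr_lt0.
      have tab : a <= t <= b by rewrite ltW //= (le_trans (ltW h2)) // (le_trans (ltW ss)).
      by exists t; split => //; [exact: below|left].
    pose m := (dot e p - dot e (phi a)) / (dot e (phi b) - dot e (phi a)).
    have d0 : 0 < dot e (phi b) - dot e (phi a) by rewrite subr_gt0 (lt_trans ea eb).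
    have m01 : 0 <= m <= 1 by rewrite (divr_ge0 _ (ltW d0)) ?subr_ge0 ?(ltW ea) //= ler_pdivrMr // mul1r lerD2r ltW.
    have ez : dot e (mid m (phi a) (phi b)) = dot e p.
      by rewrite dot_mid /m; field; rewrite gt_eqF.
    have Kz : K (mid m (phi a) (phi b)) by apply: convex_mid => //; apply: subK.
    have uz : dot u (mid m (phi a) (phi b)) < dot u p.
      rewrite lt_neqAle (hu _ Kz) andbT; apply/eqP => h; apply: nAB.
      by apply/line_segmentP; exists m => //; rewrite (ue' _ h ez).
    have [h|h] := ltrP (dot u (phi a)) (dot u p).
      exists a; split => //; left; rewrite lt_neqAle sa andbT.
      by apply: contraTneq h => ->; rewrite us ltxx.
    have [h'|h'] := ltrP (dot u (phi b)) (dot u p).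
      exists b; split => //; right; rewrite lt_neqAle sb' andbT.
      by apply: contraTneq h' => <-; rewrite us' ltxx.
    move: uz; rewrite dot_mid; have /andP[m0 m1] := m01.
    have : 0 <= (1 - m) * (dot u (phi a) - dot u p) by rewrite mulr_ge0 ?subr_ge0.
    have : 0 <= m * (dot u (phi b) - dot u p) by rewrite mulr_ge0 ?subr_ge0.
    lra.
  have [h [h1 h2 h3 _]] := level_between u1 u1 u2 u2.
  have sab : a <= s <= b by rewrite sa (le_trans (ltW ss)).
  have s'ab : a <= s' <= b by rewrite sb' (le_trans sa (ltW ss)).
  case: t2o => t2o.
    by apply: (@osc u h t2 s t1 s') => //; rewrite ?us ?us'.
  by apply: (@osc' u h s t1 s' t2) => //; rewrite ?us ?us'.
have [s /andP[sa sb] [us es]] := support_both_sides bp np hu ub.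
have [s' /andP[s'a s'b] [us' es']] := support_both_sides bp np hu un.
rewrite !dotNl ltrN2 in es'.
have [ss|ss|ss] := ltgtP s s'.
- apply: (main (- rot u) s s') => //; rewrite !dotNl ltrN2 //.
- exact: (main (rot u) s' s).
- by move: es; rewrite ss => /lt_trans /(_ es'); rewrite ltxx.
Qed.

End NoOscillation.

(** * The curve and its chord lie on the boundary, and the curve does not return *)

Section TypeArgument.
Context {R : realType}.
Notation point := 'rV[R]_2.
Implicit Types (u v w p q z k e : point) (s t x y h : R).

Variable K : set point.
Hypotheses (cK : compact K) (vK : convex_set K).
Variables (k0 : point) (Kk0 : K k0).
Variables (a b : R) (phi : R -> point).
Hypotheses (ab : a <= b) (hphi : {within `[a, b], continuous phi}).
Hypothesis dom : dominates (phi @` `[a, b]) K.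
Hypothesis subK : forall t, a <= t <= b -> K (phi t).
Hypothesis osc : forall u h t1 t2 t3 t4, a <= t1 <= b -> a <= t4 <= b -> t1 < t2 -> t2 < t3 -> t3 < t4 ->
  dot u (phi t1) < h -> h < dot u (phi t2) -> dot u (phi t3) < h -> h < dot u (phi t4) -> False.
Hypothesis osc' : forall u h t1 t2 t3 t4, a <= t1 <= b -> a <= t4 <= b -> t1 < t2 -> t2 < t3 -> t3 < t4 ->
  h < dot u (phi t1) -> dot u (phi t2) < h -> h < dot u (phi t3) -> dot u (phi t4) < h -> False.

Let dominated u k : K k -> exists2 t, a <= t <= b & dot u k <= dot u (phi t).
Proof. by move=> /(dom u)[_ [t /= tab <-] hk]; exists t => //; rewrite in_itv in tab. Qed.

(** [plus u] says that, in the order of [key], a point on the positive side of [p] precedes one on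
    the negative side. As [p] is interior, [u] or [- u] has this property, and by the hypothesis on
    triples never both. Since [plus] is an open condition on the direction and the parameter line of
    the circle is connected, it holds always or never, although a half turn exchanges [u] and
    [- u]. *)
Lemma type_argument p (key : R -> R) :
  (forall x y, a <= x <= b -> a <= y <= b -> key x = key y -> x = y) -> K° p ->
  (forall u x1 x2 x3, a <= x1 <= b -> a <= x2 <= b -> a <= x3 <= b -> key x1 < key x2 -> key x2 < key x3 ->
     dot u p < dot u (phi x1) -> dot u (phi x2) < dot u p -> dot u p < dot u (phi x3) -> False) -> False.
Proof.
move=> kinj ip H.
pose plus u := exists x1 x2, [/\ a <= x1 <= b, a <= x2 <= b, key x1 < key x2,
  dot u p < dot u (phi x1) & dot u (phi x2) < dot u p].
have pos u : u != 0 -> exists2 t, a <= t <= b & dot u p < dot u (phi t).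
  move=> u0; have [k Kk [ek _]] := suppP cK Kk0 u; have [t tab ht] := dominated u Kk.
  by exists t => //; apply: lt_le_trans ht; rewrite -ek; exact: interior_supp.
have cover u : u != 0 -> plus u \/ plus (- u).
  move=> u0; have [t tab ht] := pos u u0; have [|s sab hs] := pos (- u); first by rewrite oppr_eq0.
  rewrite !dotNl ltrN2 in hs.
  have [h|h|h] := ltgtP (key t) (key s).
  - by left; exists t, s.
  - by right; exists s, t; rewrite !dotNl !ltrN2.
  - by move: ht; rewrite (kinj _ _ tab sab h) => /lt_trans /(_ hs); rewrite ltxx.
have disj u : plus u -> plus (- u) -> False.
  move=> [x1 [x2 [x1ab x2ab x12 h1 h2]]] [y1 [y2 [y1ab y2ab y12]]].
  rewrite !dotNl !ltrN2 => h3 h4.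
  have [h|h|h] := ltgtP (key x2) (key y2).
  - exact: (@H u x1 x2 y2).
  - by apply: (@H (- u) y1 y2 x2) => //; rewrite !dotNl ltrN2.
  - by move: h2; rewrite (kinj _ _ x2ab y2ab h) => /(lt_trans h4); rewrite ltxx.
have circ0 t : circ t != 0 :> point.
  by rewrite -dot_sq_eq0 /circ /dot !pt0 !pt1 -!expr2 cos2Dsin2 oner_eq0.
have openS (sg : R) : open [set t | plus (sg *: circ t)].
  rewrite openE => t /= [x1 [x2 [x1ab x2ab x12 h1 h2]]]; rewrite /interior.
  have cd q : continuous (fun t => dot (sg *: circ t) q).
    have -> : (fun t => dot (sg *: circ t) q) = (dot (sg *: q) \o circ).
      by apply/funext => s; rewrite /= dotZl dotC dotZl.
    by move=> s; apply: continuous_comp; [exact: circ_continuous|exact: dot_continuous].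
  have cdd q q' : continuous (fun t => dot (sg *: circ t) q - dot (sg *: circ t) q').
    by move=> s; apply: (@continuousB _ _ _ (fun t => dot (sg *: circ t) q) (fun t => dot (sg *: circ t) q')); exact: cd.
  have g1 : 0 < dot (sg *: circ t) (phi x1) - dot (sg *: circ t) p by rewrite subr_gt0.
  have g2 : 0 < dot (sg *: circ t) p - dot (sg *: circ t) (phi x2) by rewrite subr_gt0.
  near=> s; exists x1, x2; split => //; rewrite -subr_gt0; near: s.
    exact: (cvgr_gt _ (cdd (phi x1) p t) _ g1).
  exact: (cvgr_gt _ (cdd p (phi x2) t) _ g2).
have circpi t : circ (t + pi) = - circ t :> point.
  by rewrite /circ cosD sinD cospi sinpi; apply: pt_eq; rewrite !mxE /=; ring.
have [t0 pt0'] : exists t, plus (circ t).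
  have [h|h] := cover (circ 0) (circ0 0); first by exists 0.
  by exists (0 + pi); rewrite circpi.
have conn : connected [set: R] by apply/connected_intervalP.
have S1 : [set t | plus (circ t)] = [set: R].
  apply: conn.
  - by exists t0.
  - exists [set t | plus (1 *: circ t)]; first exact: openS.
    by apply/seteqP; split=> t /=; rewrite scale1r; [split|case].
  - exists (~` [set t | plus (-1 *: circ t)]); first by apply: open_closedC; exact: openS.
    apply/seteqP; split=> t /=; rewrite scaleN1r.
      by move=> h; split => // h'; exact: disj h h'.
    by move=> [_ h]; case: (cover (circ t) (circ0 t)).
have : plus (circ (t0 + pi)) by have : [set: R] (t0 + pi) by []; rewrite -S1.
by rewrite circpi; exact: disj.
Unshelve. all: by end_near.
Qed.

Lemma curve_on_boundary t : a <= t <= b -> boundary K (phi t).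
Proof.
move=> tab; rewrite boundaryE //; split; first exact: subK.
(* The cyclic order of the parameters is cut open at [t]: adding [b - a + 1] puts the earlier
   parameters after all others. *)
move=> it; pose key x := if x < t then x + (b - a + 1) else x.
have key_inj x y : a <= x <= b -> a <= y <= b -> key x = key y -> x = y.
  rewrite /key => /andP[xa xb] /andP[ya yb].
  by have [h1|h1] := ltP x t; have [h2|h2] := ltP y t => e; lra.
apply: (type_argument key_inj it) => u x1 x2 x3 /andP[a1 b1] /andP[a2 b2] /andP[a3 b3].
(* At the level [h], slightly above [phi t], the parameter [t] is a low point and alternates
   cyclically with [x1], [x2], [x3]. Whatever the rotation, [osc] or [osc'] applies. *)
pose h := dot u (phi t) + Num.min (dot u (phi x1) - dot u (phi t)) (dot u (phi x3) - dot u (phi t)) / 2.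
move=> k12 k23 h1 h2 h3; have /andP[ta tb] := tab.
have [g0 g1 g3] : [/\ dot u (phi t) < h, h < dot u (phi x1) & h < dot u (phi x3)].
  have m0 : 0 < Num.min (dot u (phi x1) - dot u (phi t)) (dot u (phi x3) - dot u (phi t)) by rewrite lt_min !subr_gt0 h1.
  have m1 : Num.min (dot u (phi x1) - dot u (phi t)) (dot u (phi x3) - dot u (phi t)) <= dot u (phi x1) - dot u (phi t) by rewrite ge_min lexx.
  have m3 : Num.min (dot u (phi x1) - dot u (phi t)) (dot u (phi x3) - dot u (phi t)) <= dot u (phi x3) - dot u (phi t) by rewrite ge_min lexx orbT.
  by split; rewrite /h; lra.
have g2 := lt_trans h2 g0.
have n1 : x1 != t by apply: contraTneq h1 => ->; rewrite ltxx.
have n2 : x2 != t by apply: contraTneq h2 => ->; rewrite ltxx.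
have n3 : x3 != t by apply: contraTneq h3 => ->; rewrite ltxx.
have gt1 x : t <= x -> x != t -> t < x by move=> ? ?; rewrite lt_neqAle eq_sym; apply/andP.
move: k12 k23; rewrite /key.
have [l1|l1] := ltP x1 t; have [l2|l2] := ltP x2 t; have [l3|l3] := ltP x3 t => k12 k23; try by (exfalso; lra).
- by apply: (@osc' u h x1 x2 x3 t) => //; rewrite ?a1 ?b1 //; lra.
- by apply: (@osc u h x2 x3 t x1) => //; rewrite ?a2 ?a1 ?b1 ?b2 //; first [lra|exact: gt1].
- by apply: (@osc' u h x3 t x1 x2) => //; rewrite ?a2 ?a3 ?b3 ?b2 //; first [lra|exact: gt1].
- by apply: (@osc u h t x1 x2 x3) => //; rewrite ?a3 ?b3 //; first [lra|exact: gt1].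
Qed.

Lemma chord_on_boundary z : line_segment (phi a) (phi b) z -> boundary K z.
Proof.
move=> /line_segmentP[m m01 ez].
have Ta : a <= a <= b by rewrite lexx.
have Tb : a <= b <= b by rewrite lexx andbT.
rewrite boundaryE //; split; first by rewrite ez; apply: convex_mid => //; exact: subK.
move=> iz; apply: (@type_argument z id) => // u x1 x2 x3 /andP[a1 b1] /andP[a2 b2] /andP[a3 b3] k12 k23 h1 h2 h3.
pose h := dot u z + Num.min (dot u (phi x1) - dot u z) (dot u (phi x3) - dot u z) / 2.
have [g0 g1 g3] : [/\ dot u z < h, h < dot u (phi x1) & h < dot u (phi x3)].
  have m0 : 0 < Num.min (dot u (phi x1) - dot u z) (dot u (phi x3) - dot u z) by rewrite lt_min !subr_gt0 h1.
  have m1 : Num.min (dot u (phi x1) - dot u z) (dot u (phi x3) - dot u z) <= dot u (phi x1) - dot u z by rewrite ge_min lexx.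
  have m3 : Num.min (dot u (phi x1) - dot u z) (dot u (phi x3) - dot u z) <= dot u (phi x3) - dot u z by rewrite ge_min lexx orbT.
  by split; rewrite /h; lra.
have g2 := lt_trans h2 g0.
have /andP[m0 m1] := m01.
have ez' := congr1 (dot u) ez; rewrite dot_mid in ez'.
(* An end of the chord that is not above [z] supplies the fourth alternating point. *)
have [hA|hA] := lerP (dot u (phi a)) (dot u z).
  apply: (@osc u h a x1 x2 x3) => //; rewrite ?a3 //; last exact: le_lt_trans hA g0.
  by rewrite lt_neqAle a1 andbT; apply: contraTneq h1 => <-; rewrite -leNgt.
have [hb|hb] := lerP (dot u (phi b)) (dot u z).
  apply: (@osc' u h x1 x2 x3 b) => //; rewrite ?a1 //; last exact: le_lt_trans hb g0.
  by rewrite lt_neqAle b3 andbT; apply: contraTneq h3 => ->; rewrite -leNgt.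
have : 0 <= (1 - m) * (dot u (phi a) - dot u z) by rewrite mulr_ge0; lra.
have : 0 <= m * (dot u (phi b) - dot u z) by rewrite mulr_ge0; lra.
have [e0|e0] := eqVneq m 0; first by move: ez'; rewrite e0; lra.
have mp : 0 < m by rewrite lt0r e0.
have : 0 < m * (dot u (phi b) - dot u z) by rewrite mulr_gt0 // subr_gt0.
lra.
Qed.

(** The bisector of two independent vectors has positive product with both. *)
Lemma cross_parallel w1 w2 : ~ (exists u, 0 < dot u w1 /\ 0 < dot u w2) -> cross w1 w2 = 0.
Proof.
move=> nu; apply/eqP/negPn/negP => D; apply: nu.
have n1 : 0 < nrm w1 by rewrite nrm_gt0; apply: contraNneq D => ->; rewrite cross0l.
have n2 : 0 < nrm w2 by rewrite nrm_gt0; apply: contraNneq D => ->; rewrite crossC cross0l oppr0.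
have h : - dot w1 w2 < nrm w1 * nrm w2.
  apply: le_lt_trans (ler_norm _) _; rewrite normrN.
  rewrite -(@ltr_pXn2r _ 2) ?nnegrE ?mulr_ge0 ?nrm_ge0 // real_normK ?num_real // exprMn !sqr_nrm.
  by rewrite -lagrange ltrDl lt0r sqrf_eq0 D sqr_ge0.
exists (nrm w2 *: w1 + nrm w1 *: w2); rewrite !dotDl !dotZl -!sqr_nrm (dotC w2 w1).
have -> : nrm w2 * nrm w1 ^+ 2 + nrm w1 * dot w1 w2 = nrm w1 * (nrm w1 * nrm w2 + dot w1 w2) by ring.
have -> : nrm w2 * dot w1 w2 + nrm w1 * nrm w2 ^+ 2 = nrm w2 * (nrm w1 * nrm w2 + dot w1 w2) by ring.
by rewrite !mulr_gt0 //; lra.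
Qed.

(** For [x] between [s] and [t] and [y] outside, no direction can have both [phi x] and [phi y]
    above [p], as the curve would alternate between [p] and these points. So the vectors from [p]
    are parallel, the whole curve lies on one line, and [K] has no interior. The distinct ends
    provide a [y] with [phi y] different from [p]. *)
Lemma no_revisit c (s q t : R) : K° c -> phi a != phi b -> a <= s -> s < q -> q < t -> t <= b ->
  phi s = phi t -> phi q = phi s.
Proof.
move=> ic AB sa sq qt tb est; apply: contrapT => /eqP qp; set p := phi s in est qp.
have opp x y : s < x < t -> a <= y < s \/ t < y <= b -> cross (phi x - p) (phi y - p) = 0.
  move=> /andP[sx xt] hy; apply: cross_parallel => -[u]; rewrite !dotBr => -[hx hy'].
  pose h := dot u p + Num.min (dot u (phi x) - dot u p) (dot u (phi y) - dot u p) / 2.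
  have [g0 g1 g3] : [/\ dot u p < h, h < dot u (phi x) & h < dot u (phi y)].
    have m0 : 0 < Num.min (dot u (phi x) - dot u p) (dot u (phi y) - dot u p) by rewrite lt_min hx.
    have m1 : Num.min (dot u (phi x) - dot u p) (dot u (phi y) - dot u p) <= dot u (phi x) - dot u p by rewrite ge_min lexx.
    have m3 : Num.min (dot u (phi x) - dot u p) (dot u (phi y) - dot u p) <= dot u (phi y) - dot u p by rewrite ge_min lexx orbT.
    by split; rewrite /h; lra.
  case: hy => /andP[y1 y2].
    by apply: (@osc' u h y s x t) => //; rewrite -?est -/p //; lra.
  by apply: (@osc u h s x t y) => //; rewrite -?est -/p //; lra.
have [y0 y0o y0p] : exists2 y, a <= y < s \/ t < y <= b & phi y != p.
  have [ea|ea] := eqVneq (phi a) p.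
    exists b; last by apply: contraNneq AB => ->; rewrite ea.
    right; rewrite lexx andbT lt_neqAle tb andbT; apply: contraNneq AB => tb'.
    by rewrite ea -tb' est.
  exists a => //; left; rewrite lexx lt_neqAle sa andbT /=.
  by apply: contraNneq ea => ->.
pose w := phi q - p; have w0 : w != 0 by rewrite subr_eq0.
have sqt : s < q < t by rewrite sq.
have y00 : phi y0 - p != 0 by rewrite subr_eq0.
have ey0 := cross0_colinear w0 (opp _ _ sqt y0o); move: (_ / _) ey0 => l el.
have l0 : l != 0 by apply: contraNneq y00 => l0; rewrite el l0 scale0r.
have line x : a <= x <= b -> cross w (phi x - p) = 0.
  move=> /andP[xa xb].
  have [h1|h1] := ltP x s; first by apply: opp => //; left; rewrite xa.
  have [h2|h2] := ltP t x; first by apply: opp => //; right; rewrite h2.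
  have [->|n1] := eqVneq x s; first by rewrite -/p subrr crossC cross0l oppr0.
  have [->|n2] := eqVneq x t; first by rewrite -est subrr crossC cross0l oppr0.
  have xst : s < x < t by rewrite !lt_neqAle eq_sym n1 h1 n2 h2.
  have := opp _ _ xst y0o; rewrite el crossZr => /eqP; rewrite mulf_eq0 (negbTE l0) /= => /eqP h.
  by rewrite crossC h oppr0.
have flat u k : (forall x, a <= x <= b -> dot u (phi x - p) = 0) -> K k -> dot u k <= dot u p.
  by move=> hu Kk; have [x xab hx] := dominated u Kk; have := hu _ xab; rewrite dotBr; lra.
have r0 : rot w != 0.
  by rewrite -dot_sq_eq0 (_ : dot (rot w) (rot w) = dot w w) ?dot_sq_eq0 // /dot !rot0 !rot1; ring.
have rl x : a <= x <= b -> dot (rot w) (phi x - p) = 0 by move=> xab; rewrite -crossE line.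
have rl' x : a <= x <= b -> dot (- rot w) (phi x - p) = 0 by move=> xab; rewrite dotNl rl ?oppr0.
have Kc : K c by exact: interior_subset ic.
have := interior_supp cK ic r0; have [k Kk [-> _]] := suppP cK Kk0 (rot w).
by have := flat _ _ rl Kk; have := flat _ _ rl' Kc; rewrite !dotNl; lra.
Qed.

End TypeArgument.

(** * Degenerate figures *)

Section SegmentCase.
Context {R : realType}.
Notation point := 'rV[R]_2.
Notation dist := (@eucl_dist R).
Implicit Types (u v w x y z k A B : point) (s t : R) (K : set point).

Lemma diam_ge K k k' : compact K -> K k -> K k' -> dist k k' <= diam K.
Proof.
move=> cK Kk Kk'; apply: ub_le_sup; last by exists k => //; exists k'.
have [M M0 hM] := compact_nrm_bound cK Kk.
exists (M + M) => _ [x Kx [y Ky <-]].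
by have := nrmD x (- y); have := hM _ Kx; have := hM _ Ky; rewrite distE nrmN; lra.
Qed.

Lemma diam_le K (m : R) : K !=set0 -> (forall k k', K k -> K k' -> dist k k' <= m) -> diam K <= m.
Proof.
move=> [k Kk] h; apply: ge_sup; first by exists (dist k k), k => //; exists k.
by move=> _ [x Kx [y Ky <-]]; exact: h.
Qed.

Lemma dist_mids A B s t : dist (mid s A B) (mid t A B) = `|s - t| * dist A B.
Proof.
rewrite !distE (_ : mid s A B - mid t A B = (t - s) *: (A - B)).
  by rewrite nrmZ distrC.
by apply: pt_eq; rewrite !mxE; ring.
Qed.

Lemma diam_segment x y : compact (line_segment x y) -> diam (line_segment x y) = dist x y.
Proof.
move=> cK; apply/eqP; rewrite eq_le; apply/andP; split; last first.
  by apply: diam_ge => //; [exact: segment_l|exact: segment_r].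
apply: diam_le; first by exists x; exact: segment_l.
move=> _ _ /line_segmentP[s /andP[s0 s1] ->] /line_segmentP[t /andP[t0 t1] ->].
by rewrite dist_mids ler_piMl ?dist_ge0 // ler_norml; lra.
Qed.

Lemma between_segment A B z : dist A z + dist z B <= dist A B -> line_segment A B z.
Proof.
move=> h; have [AB|AB] := eqVneq A B.
  have : dist A z == 0.
    by have := dist_ge0 A z; have := dist_ge0 z B; rewrite eq_le; move: h; rewrite AB distxx; lra.
  rewrite dist_eq0 => /eqP <-; exact: segment_l.
have BA0 : B - A != 0 by rewrite subr_eq0 eq_sym.
have c0 : cross (B - A) (z - A) = 0.
  apply/eqP/negPn/negP => c0; move: h; apply/negP; rewrite -ltNge; apply: dist_triangle_lt.
  by have -> : cross (A - z) (B - z) = cross (B - A) (z - A) by rewrite /cross !mxE; ring.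
have := cross0_colinear BA0 c0; move: (_ / _) => m e.
have ez : z = mid m A B by rewrite /mid -e addrC subrK.
apply/line_segmentP; exists m => //.
have D : 0 < dist A B by rewrite dist_gt0.
have dA : dist A z = `|m| * dist A B by have := dist_mids A B 0 m; rewrite mid0 -ez sub0r normrN.
have dB : dist z B = `|m - 1| * dist A B by have := dist_mids A B m 1; rewrite mid1 -ez.
move: h; rewrite dA dB.
rewrite -mulrDl -[leRHS]mul1r ler_pM2r // => h.
have := ler_norm m; have := ler_norm (- m); have := ler_norm (m - 1); have := ler_norm (- (m - 1)).
by rewrite !normrN; move: h; move: `|m| `|m - 1| => p q; lra.
Qed.

Lemma segment_convex x y : convex_set (line_segment x y).
Proof.
apply: mid_convex => p q m /line_segmentP[s s01 ->] /line_segmentP[t t01 ->] m01.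
apply/line_segmentP; exists ((1 - m) * s + m * t).
  move: s01 t01 m01 => /andP[s0 s1] /andP[t0 t1] /andP[m0 m1].
  have h1 : 0 <= (1 - m) * s by rewrite mulr_ge0 //; lra.
  have h2 : 0 <= m * t by rewrite mulr_ge0.
  have h3 : 0 <= (1 - m) * (1 - s) by rewrite mulr_ge0; lra.
  have h4 : 0 <= m * (1 - t) by rewrite mulr_ge0; lra.
  by apply/andP; split; lra.
by apply: pt_eq; rewrite !mxE; ring.
Qed.

Variables (x y : point) (a b : R) (phi : R -> point).
Hypotheses (ab : a <= b) (hphi : {within `[a, b], continuous phi}).
Hypothesis dom : dominates (phi @` `[a, b]) (line_segment x y).

(** In the direction of the segment the curve reaches at least as far as both its ends. *)
Lemma long_chord : exists t1 t2, [/\ a <= t1, t1 <= t2, t2 <= b & dist x y <= dist (phi t1) (phi t2)].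
Proof.
have [_ [t1 /= t1ab <-] h1] := dom (y - x) (segment_r x y).
have [_ [t2 /= t2ab <-] h2] := dom (- (y - x)) (segment_l x y).
rewrite !in_itv /= in t1ab t2ab; have /andP[a1 b1] := t1ab; have /andP[a2 b2] := t2ab.
have h : dist x y <= dist (phi t1) (phi t2).
  have [->|xy] := eqVneq x y; first by rewrite distxx dist_ge0.
  have n0 : 0 < dist x y by rewrite dist_gt0.
  rewrite -(ler_pM2l n0) -expr2 sqr_dist.
  have -> : dist x y = nrm (y - x) by rewrite distC distE.
  rewrite (distE (phi t1)); apply: le_trans (dot_le_nrm _ _).
  have -> : dot (x - y) (x - y) = dot (y - x) (y - x) by rewrite -[x - y]opprB dotNl dotNr opprK.
  by move: h1 h2; rewrite !dotNl !dotBr; lra.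
have [t12|/ltW t21] := leP t1 t2; first by exists t1, t2.
by exists t2, t1; rewrite (distC (phi t2)).
Qed.

Lemma segment_curve_inequality : ((dist x y)%:E <= curve_length a b phi)%E.
Proof.
have [t1 [t2 [a1 t12 b2 h]]] := long_chord.
have ps : path <=%R a [:: t1; t2] by rewrite /= a1 t12.
apply: le_trans (curve_length_ge phi ps b2); rewrite lee_fin /=.
by have := dist_ge0 (phi a) (phi t1); have := dist_ge0 (phi t2) (phi b); lra.
Qed.

Hypothesis hl : curve_length a b phi = (dist x y)%:E.

Let chain s r t : a <= s -> s <= r -> r <= t -> t <= b ->
  dist (phi a) (phi s) + dist (phi s) (phi r) + dist (phi r) (phi t) + dist (phi t) (phi b) <= dist x y.
Proof.
move=> h1 h2 h3 h4; have ps : path <=%R a [:: s; r; t] by rewrite /= h1 h2 h3.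
by have := curve_length_ge phi ps h4; rewrite hl lee_fin /= addr0; lra.
Qed.

Lemma segment_endpoints : dist (phi a) (phi b) = dist x y.
Proof.
have [t1 [t2 [a1 t12 b2 h]]] := long_chord.
have := chain a1 t12 (lexx t2) b2; rewrite distxx => h'.
have g1 := dist_ge0 (phi a) (phi t1); have g2 := dist_ge0 (phi t2) (phi b).
have /eqP : dist (phi a) (phi t1) = 0 by lra.
rewrite dist_eq0 => /eqP ->; have /eqP : dist (phi t2) (phi b) = 0 by lra.
by rewrite dist_eq0 => /eqP <-; lra.
Qed.

Lemma segment_curve_sub t : a <= t <= b -> line_segment (phi a) (phi b) (phi t).
Proof.
move=> /andP[ta tb]; apply: between_segment; rewrite segment_endpoints.
by have := chain ta (lexx t) (lexx t) tb; rewrite !distxx; lra.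
Qed.

Lemma segment_no_revisit s r t : a <= s -> s < r -> r < t -> t <= b -> phi s = phi t -> phi r = phi s.
Proof.
move=> as' sr rt tb e; have := chain as' (ltW sr) (ltW rt) tb; rewrite -segment_endpoints.
have := dist_triangle (phi s) (phi a) (phi b); rewrite {2}e => h1 h2.
have g1 := dist_ge0 (phi s) (phi r); have g2 := dist_ge0 (phi r) (phi t).
have /eqP : dist (phi s) (phi r) = 0 by lra.
by rewrite dist_eq0 => /eqP ->.
Qed.

(** A segment inside another one of the same length is equal to it. *)
Lemma segment_eq : line_segment x y `<=` convex_hull (phi @` `[a, b]) ->
  line_segment x y = line_segment (phi a) (phi b).
Proof.
move=> sub; have incl : line_segment x y `<=` line_segment (phi a) (phi b).
  apply: subset_trans sub _; apply: hull_sub; first exact: segment_convex.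
  by move=> _ [t /= tab <-]; apply: segment_curve_sub; rewrite in_itv in tab.
apply/seteqP; split => //.
suff [ha hb] : line_segment x y (phi a) /\ line_segment x y (phi b).
  move=> z /line_segmentP[t t01 ->]; apply: convex_mid => //; exact: segment_convex.
have eD := segment_endpoints.
have [s /andP[s0 s1] ex] := (line_segmentP _ _ _).1 (incl _ (segment_l x y)).
have [t /andP[t0 t1] ey] := (line_segmentP _ _ _).1 (incl _ (segment_r x y)).
have [AB|AB] := eqVneq (phi a) (phi b).
  have e0 : x = phi a by rewrite ex -AB /mid subrr scaler0 addr0.
  by rewrite -AB -e0; split; exact: segment_l.
have D : 0 < dist (phi a) (phi b) by rewrite dist_gt0.
have : `|s - t| = 1.
  apply: (mulIf (lt0r_neq0 D)); rewrite mul1r -dist_mids -ex -ey eD //.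
have [h|h] := lerP 0 (s - t); [rewrite ger0_norm //|rewrite ltr0_norm //] => e.
  have [es et] : s = 1 /\ t = 0 by split; lra.
  move: ex ey; rewrite es et mid0 mid1 => <- <-; split; [exact: segment_r|exact: segment_l].
have [es et] : s = 0 /\ t = 1 by split; lra.
move: ex ey; rewrite es et mid0 mid1 => <- <-; split; [exact: segment_l|exact: segment_r].
Qed.

End SegmentCase.

(** * Assembly of the inequality and of the equality case *)

Section Equality.
Context {R : realType}.
Notation point := 'rV[R]_2.
Notation dist := (@eucl_dist R).
Implicit Types (K : set point) (a b : R) (phi : R -> point).

Lemma traversed_once_norev a b phi s q t : traversed_once a b phi ->
  a <= s -> s < q -> q < t -> t <= b -> phi s = phi t -> phi q = phi s.
Proof.
move=> once as' sq qt tb e; have sab : a <= s <= b by rewrite as' (le_trans (ltW sq)) // (le_trans (ltW qt)).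
have Xs : (phi @` `[a, b]) (phi s) by exists s => //=; rewrite in_itv.
have iv := (connected_intervalP _).1 (once _ Xs).
have tab : a <= t <= b by rewrite tb andbT (le_trans as') // ltW // (lt_trans sq).
suff [] : (`[a, b] `&` phi @^-1` [set phi s]) q by [].
by apply: (iv s t); rewrite ?ltW //; split => //=; rewrite in_itv.
Qed.

Lemma norev_traversed_once a b phi :
  (forall s q t, a <= s -> s < q -> q < t -> t <= b -> phi s = phi t -> phi q = phi s) ->
  traversed_once a b phi.
Proof.
move=> norev p _; apply: (connected_intervalP _).2 => s t [/= sab es] [/= tab et] q /andP[sq qt].
rewrite !in_itv /= in sab tab; have /andP[as' sb] := sab; have /andP[at' tb] := tab.
split => /=; first by rewrite in_itv /= (le_trans as' sq) (le_trans qt tb).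
move: sq; rewrite le_eqVlt => /orP[/eqP <- //|sq].
move: qt; rewrite le_eqVlt => /orP[/eqP -> //|qt].
by rewrite (norev s q t) // es et.
Qed.

Lemma curve_closed_connected a b phi : {within `[a, b], continuous phi} ->
  closed (phi @` `[a, b]) /\ connected (phi @` `[a, b]).
Proof.
move=> hphi; split; first by apply: compact_is_closed; exact: image_compact.
by apply: connected_continuous_connected => //; apply: segment_connected.
Qed.

Lemma boundary_curve_length K a b phi : convex_figure K -> {within `[a, b], continuous phi} ->
  traversed_once a b phi -> phi @` `[a, b] `<=` boundary K ->
  (curve_length a b phi <= (cauchy_per K - dist (phi a) (phi b))%:E)%E.
Proof.
move=> [[k0 Kk0] cK vK] hphi once sub; apply: curve_length_le => s ps ls.
rewrite lerBrDr; apply: (@boundary_curve_le R K k0) => //.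
  by move=> t tab; apply: sub; exists t => //=; rewrite in_itv.
by move=> s1 q t /ltW as' sq qt /ltW tb; exact: (traversed_once_norev once as' sq qt tb).
Qed.

Variables (K : set point) (a b : R) (phi : R -> point).
Hypotheses (hK : convex_figure K) (ab : a <= b) (hphi : {within `[a, b], continuous phi}).
Hypothesis hsub : K `<=` convex_hull (phi @` `[a, b]).

Let dom : dominates (phi @` `[a, b]) K. Proof. exact: hull_dominates. Qed.

Let hull_eq : (forall t, a <= t <= b -> K (phi t)) -> convex_hull (phi @` `[a, b]) = K.
Proof.
have [_ _ vK] := hK; move=> subK; apply/seteqP; split => //; apply: hull_sub => //.
by move=> _ [t /= tab <-]; apply: subK; rewrite in_itv in tab.
Qed.

Lemma interior_inequality : K° !=set0 -> ((cauchy_per K - diam K)%:E <= curve_length a b phi)%E.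
Proof.
have [_ cK _] := hK; move=> [c /interior_ball[r r0 hB]].
have hd k k' : K k -> K k' -> dist k k' <= diam K by exact: diam_ge.
have := curve_length_ge0 phi ab; case hl: (curve_length a b phi) => [l| |] // _; last by rewrite leey.
rewrite lee_fin; exact: (curve_inequality cK r0 hB ab hphi dom hd hl).
Qed.

Lemma interior_equality : K° !=set0 -> curve_length a b phi = (cauchy_per K - diam K)%:E ->
  [/\ convex_curve (phi @` `[a, b]), traversed_once a b phi,
    boundary K = phi @` `[a, b] `|` line_segment (phi a) (phi b) & diam K = dist (phi a) (phi b)].
Proof.
have [_ cK vK] := hK; move=> [c Kc] hl; have [r r0 hB] := interior_ball Kc.
have K0 : K c by apply: hB; rewrite distxx ltW.
have hd k k' : K k -> K k' -> dist k k' <= diam K by exact: diam_ge.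
have D_le : dist (phi a) (phi b) <= diam K.
  rewrite leNgt; apply/negP => lt.
  by have := curve_inequality_strict cK r0 hB ab hphi dom hd hl lt; rewrite ltxx.
have D_ge := closed_curve_inequality cK r0 hB ab hphi dom hl.
have eD : diam K = dist (phi a) (phi b) by lra.
have eq' : cauchy_per K - diam K + dist (phi a) (phi b) = cauchy_per K by lra.
(* [K] contains a disc, so its diameter, here |AB|, is positive; [no_revisit] depends on this. *)
have AB : phi a != phi b.
  rewrite -dist_gt0 -eD; pose e : point := r *: delta_mx 0 0.
  have ne : nrm e = r by rewrite nrmZ gtr0_norm // /nrm /dot !mxE /= mul1r mul0r addr0 sqrtr1 mulr1.
  have : K (c + e) by apply: hB; rewrite distC distE addrC addKr ne.
  by move=> /(hd _ _ K0); rewrite distC distE addrC addKr ne; lra.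
have subK := curve_sub cK vK r0 hB ab hphi dom hl eq'.
have osc := no_oscillation cK r0 hB ab hphi dom hl eq'.
have osc' := no_oscillation' cK r0 hB ab hphi dom hl eq'.
have bd t : a <= t <= b -> boundary K (phi t) by exact: (curve_on_boundary cK K0 dom subK osc osc').
have [clX conX] := curve_closed_connected hphi.
split => //.
- split => //; rewrite hull_eq // => _ [t /= tab <-]; apply: bd; by rewrite in_itv in tab.
- apply: norev_traversed_once => s q t as' sq qt tb.
  exact: (no_revisit cK K0 dom osc osc' Kc AB).
apply/seteqP; split => p.
  case/(boundary_sub cK vK K0 ab hphi dom subK osc osc') => [[t tab <-]|h]; last by right.
  by left; exists t => //=; rewrite in_itv.
move=> [[t /= tab <-]|h]; first by apply: bd; rewrite in_itv in tab.
exact: (chord_on_boundary cK vK K0 ab dom subK osc osc').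
Qed.

Lemma degenerate_inequality : ~ (K° !=set0) -> ((cauchy_per K - diam K)%:E <= curve_length a b phi)%E.
Proof.
have [Kn cK vK] := hK; move=> /(empty_interior_segment cK vK Kn)[x [y e]].
move: cK dom; rewrite e => cK' dom'; rewrite segment_cauchy_per // diam_segment //.
by rewrite mulr2n mulrDl mul1r addrK; exact: segment_curve_inequality.
Qed.

Lemma degenerate_equality : ~ (K° !=set0) -> curve_length a b phi = (cauchy_per K - diam K)%:E ->
  [/\ convex_curve (phi @` `[a, b]), traversed_once a b phi,
    boundary K = phi @` `[a, b] `|` line_segment (phi a) (phi b) & diam K = dist (phi a) (phi b)].
Proof.
have [Kn cK vK] := hK; move=> i0; have [x [y e]] := empty_interior_segment cK vK Kn i0.
have bK : boundary K = K.
  by rewrite boundaryE //; apply/seteqP; split => [z []//|z Kz]; split => // ?; apply: i0; exists z.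
have [cl dom' sub'] : [/\ compact (line_segment x y), dominates (phi @` `[a, b]) (line_segment x y) &
  line_segment x y `<=` convex_hull (phi @` `[a, b])] by rewrite -e.
rewrite e segment_cauchy_per // diam_segment // -e mulr2n mulrDl mul1r addrK => hl.
have eAB : K = line_segment (phi a) (phi b) by rewrite {1}e; exact: (segment_eq dom' hl).
have subK t : a <= t <= b -> K (phi t) by rewrite eAB; exact: (segment_curve_sub dom' hl).
have sX : phi @` `[a, b] `<=` K by move=> _ [t /= tab <-]; apply: subK; rewrite in_itv in tab.
have [clX conX] := curve_closed_connected hphi.
split; last by rewrite (segment_endpoints dom' hl).
- by split => //; rewrite hull_eq // bK.
- by apply: norev_traversed_once => s q t; exact: (segment_no_revisit dom' hl).
- by rewrite bK -eAB; apply/esym/setUidPr.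
Qed.

End Equality.

Theorem theorem1 (R : realType) (K : set 'rV[R]_2) (a b : R)
    (phi : R -> 'rV[R]_2)
    (hK : convex_figure K)
    (hab : a <= b)
    (hphi : {within `[a, b], continuous phi})
    (hsub : K `<=` convex_hull (phi @` `[a, b])) :
  (perimeter K - (diam K)%:E <= curve_length a b phi)%E /\
  (curve_length a b phi = (perimeter K - (diam K)%:E)%E <->
   [/\ convex_curve (phi @` `[a, b]),
       traversed_once a b phi,
       boundary K = phi @` `[a, b] `|` line_segment (phi a) (phi b) &
       diam K = eucl_dist (phi a) (phi b)]).
Proof.
rewrite perimeterE // -EFinB.
have ineq : ((cauchy_per K - diam K)%:E <= curve_length a b phi)%E.
  have [h|h] := pselect (K° !=set0); first exact: interior_inequality.
  exact: degenerate_inequality.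
split => //; split=> [hl|[_ once bd eD]].
  have [h|h] := pselect (K° !=set0); first exact: interior_equality.
  exact: degenerate_equality.
apply/eqP; rewrite eq_le ineq andbT eD; apply: boundary_curve_length => //.
by rewrite bd; exact: subsetUl.
Qed.
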